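(* Let $H=F/F''$ be the free metabelian group of rank $r$, where $F=F(X)$ is the free group on $X=\{x_1,\dots,x_r\}$ and $F''$ is its second derived subgroup, generated by the image of $X$. There is a polynomial-time deterministic $2$-approximation algorithm for the Geodesic Problem in $H$ with respect to $X$.
   Context: Let $\mu':F(X)\to H$ be the canonical epimorphism; the geodesic length of $h\in H$ is $l_X(h)=\min\{|w| : w\in F(X),\ \mu'(w)=h\}$, where $|w|$ is the length of the reduced word. The Geodesic Problem asks, given $w\in F(X)$, to find a word $w'$ with $\mu'(w')=\mu'(w)$ and $|w'|=l_X(\mu'(w))$. An algorithm approximates this minimization problem within a factor $\rho\ge1$ ($\rho$-approximation) if the value it produces divided by the optimal value $l_X(\mu'(w))$ is at most $\rho$. *)

(* Defs.v *)
From mathcomp Require Import all_boot.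
Set Implicit Arguments. Unset Strict Implicit. Unset Printing Implicit Defensive.

(* A letter is (i, b): b = false means x_i, b = true means x_i^{-1}. *)
Definition letter (r : nat) : finType := ('I_r * bool)%type.

Section FreeGroup.
Variable r : nat.
Local Notation L := (letter r).

Definition linv (x : L) : L := (x.1, ~~ x.2).

Definition cons_red (x : L) (s : seq L) : seq L :=
  match s with
  | y :: t => if y == linv x then t else x :: s
  | [::] => [:: x]
  end.

Definition reduce (w : seq L) : seq L := foldr cons_red [::] w.

Definition rlen (w : seq L) : nat := size (reduce w).

Definition winv (w : seq L) : seq L := rev (map linv w).

Definition comm (u v : seq L) : seq L := u ++ v ++ winv u ++ winv v.

(* subgroup of F(X) generated by a set S of words (elements of F are
   words up to free reduction) *)
Inductive gen (S : seq L -> Prop) : seq L -> Prop :=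
| gen_base w : S w -> gen S w
| gen_nil : gen S [::]
| gen_cat u v : gen S u -> gen S v -> gen S (u ++ v)
| gen_inv u : gen S u -> gen S (winv u)
| gen_red u v : reduce u = reduce v -> gen S u -> gen S v.

Definition derived1 : seq L -> Prop :=
  gen (fun w => exists u v, w = comm u v).
Definition derived2 : seq L -> Prop :=
  gen (fun w => exists u v, [/\ derived1 u, derived1 v & w = comm u v]).

(* mu'(w1) = mu'(w2) in H = F/F'' *)
Definition mu_eq (w1 w2 : seq L) : Prop := derived2 (w1 ++ winv w2).

Definition geodesic_length (w : seq L) (n : nat) : Prop :=
  (exists v, mu_eq v w /\ rlen v = n) /\ (forall v, mu_eq v w -> n <= rlen v).

End FreeGroup.

Inductive move := MLeft | MRight | MStay.

Record TM (A : finType) := {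
  tm_state : finType;
  tm_sym : finType;
  tm_blank : tm_sym;
  tm_in : A -> tm_sym;
  tm_out : tm_sym -> option A;
  tm_out_in : forall a, tm_out (tm_in a) = Some a;
  tm_out_blank : tm_out tm_blank = None;
  tm_start : tm_state;
  tm_halt : tm_state -> bool;
  tm_delta : tm_state -> tm_sym -> tm_state * tm_sym * move
}.

Arguments tm_blank {A} M : rename.
Arguments tm_in {A} M _ : rename.
Arguments tm_out {A} M _ : rename.
Arguments tm_start {A} M : rename.
Arguments tm_halt {A} M _ : rename.
Arguments tm_delta {A} M _ _ : rename.

Section TMRun.
Variables (A : finType) (TMm : TM A).

(* configuration: state, left tape (reversed, nearest first), head symbol,
   right tape *)
Definition config := (tm_state TMm * seq (tm_sym TMm) * tm_sym TMm * seq (tm_sym TMm))%type.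

Definition tm_step (c : config) : config :=
  let: (q, l, a, rt) := c in
  if tm_halt TMm q then c else
  let: (q', b, mv) := tm_delta TMm q a in
  match mv with
  | MStay => (q', l, b, rt)
  | MLeft => match l with
             | [::] => (q', [::], tm_blank TMm, b :: rt)
             | x :: l' => (q', l', x, b :: rt)
             end
  | MRight => match rt with
              | [::] => (q', b :: l, tm_blank TMm, [::])
              | x :: rt' => (q', b :: l, x, rt')
              end
  end.

Definition tm_run (n : nat) (c : config) : config := iter n tm_step c.

Definition tm_init (w : seq A) : config :=
  match map (tm_in TMm) w with
  | [::] => (tm_start TMm, [::], tm_blank TMm, [::])
  | a :: t => (tm_start TMm, [::], a, t)
  end.

Definition tm_halted (c : config) : bool := let: (q, _, _, _) := c in tm_halt TMm q.

Fixpoint take_letters (s : seq (tm_sym TMm)) : seq A :=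
  match s with
  | [::] => [::]
  | x :: t => match tm_out TMm x with Some a => a :: take_letters t | None => [::] end
  end.

Definition tm_output (c : config) : seq A :=
  let: (_, _, a, rt) := c in take_letters (a :: rt).

End TMRun.

Arguments tm_step {A} TMm _.
Arguments tm_run {A} TMm _ _.
Arguments tm_init {A} TMm _.
Arguments tm_halted {A} TMm _.
Arguments tm_output {A} TMm _.

(* Main.v *)
(* Two words are equal in F/F'' exactly when they have the same displacement and
   induce the same flow on the edges of the Cayley graph of Z^r.  A word with flow
   f has to pay |f| for the flow itself and must also connect the components of
   the support of f with each other and with the origin.

   Starting from w, opposite edges at the two ends of a loop are cancelled by
   splitting the loop off, and pieces that share a vertex are spliced, until the
   pieces traverse exactly the flow.  Then Kruskal's algorithm is run on the
   pieces: for d = 1, 2, ... two pieces at distance d are spliced along a path of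
   length d and its inverse, at cost 2d.  A competitor v visits the pieces in some
   order; the distance from each piece to the earlier ones is bounded by the
   number of steps of v off the flow just before it first enters the piece.
   Hence v has at least |f| + q letters, where q bounds the cost of joining the
   pieces in that order, and each splice at distance d lowers this cost by at
   least d; so the result has length at most |f| + 2q <= 2|v|. *)

(* Only endpoints of black letters count as vertices of a piece. A bought connection may pass close
   to other pieces; if its vertices were included, the separation of the pieces at the current
   distance would be lost. With this convention a merge replaces two vertex sets exactly by their
   union, so the chain of every competitor can be updated without looking at [v] again.

   The factor 2 arises because each connection is traversed in both directions, whereas [v] pays for
   it at least once. The distances 1, ..., |w| suffice since [w] is itself a competitor: joining the
   pieces costs at most |w|, so none of them can stay further away.

   All pieces live in one word. White letters between them keep the base points in place, so a local
   surgery moves no other piece. The number of paid letters plus the number of pieces drops at every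
   step at distance 0, later the number of pieces alone; this potential bounds both the growth of
   the word and the number of rounds. As a genuine Turing machine is required, the algorithm is a
   program on eight stacks, compiled to a single tape. *)
Require Import Defs.
From mathcomp Require Import all_boot all_order all_algebra.
From mathcomp Require Import zify.
Set Implicit Arguments. Unset Strict Implicit. Unset Printing Implicit Defensive.
Import Order.TTheory GRing.Theory Num.Theory.

(** * Flows of words on the Cayley graph of Z^r *)

Section FreeReduction.
Variable r : nat.
Local Notation L := (letter r).
Implicit Types (x y : L) (u v w s : seq L).

Lemma linvK : involutive (@linv r).
Proof. by case=> i b; rewrite /linv /= negbK. Qed.

Lemma linv_neq x : linv x != x.
Proof. by case: x => i b; rewrite /linv /= xpair_eqE /= eqxx; case: b. Qed.

Definition cancels x y := y == linv x.
Definition reduced s := sorted (fun x y => ~~ cancels x y) s.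

Lemma cons_red_reduced x s : reduced s -> reduced (cons_red x s).
Proof.
case: s => [|y s] //= ps; case: ifP => [_|/= ny]; first exact: path_sorted ps.
by rewrite /cancels ny.
Qed.

Lemma reduce_reduced w : reduced (reduce w).
Proof. by elim: w => //= x w IH; apply: cons_red_reduced. Qed.

(** The letters act on reduced words by mutually inverse bijections, so inserting or deleting a
    cancelling pair never changes [reduce]. *)
Lemma cons_redK x s : reduced s -> cons_red x (cons_red (linv x) s) = s.
Proof.
case: s => [|y s] /= ps; first by rewrite eqxx.
rewrite linvK; case: eqP ps => [->|_] ps /=; last by rewrite eqxx.
by case: s ps => [|z s] //= /andP[]; rewrite /cancels => /negPf ->.
Qed.

Lemma reduce_cat u v : reduce (u ++ v) = foldr (@cons_red r) (reduce v) u.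
Proof. by rewrite /reduce foldr_cat. Qed.

Lemma reduce_catr u v v' : reduce v = reduce v' -> reduce (u ++ v) = reduce (u ++ v').
Proof. by rewrite !reduce_cat => ->. Qed.

Lemma winv_cons x w : winv (x :: w) = winv w ++ [:: linv x].
Proof. by rewrite /winv /= rev_cons -cats1. Qed.

Lemma winv_cat u v : winv (u ++ v) = winv v ++ winv u.
Proof. by rewrite /winv map_cat rev_cat. Qed.

Lemma winvK : involutive (@winv r).
Proof. by move=> w; rewrite /winv map_rev revK mapK //; apply: linvK. Qed.

Lemma size_winv w : size (winv w) = size w.
Proof. by rewrite size_rev size_map. Qed.

Lemma reduce_cancel u z v : reduce (u ++ z ++ winv z ++ v) = reduce (u ++ v).
Proof.
apply: reduce_catr; elim: z v => [|x z IH] v //=.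
by rewrite winv_cons -!catA IH /= cons_redK //; apply: reduce_reduced.
Qed.

Lemma reduce_cancelV u z v : reduce (u ++ winv z ++ z ++ v) = reduce (u ++ v).
Proof. by rewrite -{2}[z]winvK reduce_cancel. Qed.

End FreeReduction.

Section Flow.
Variable r : nat.
Local Notation L := (letter r).
Implicit Types (x y : L) (u v w : seq L).
Local Open Scope ring_scope.

Definition vertex := {ffun 'I_r -> int}.
Implicit Types p q : vertex.

Definition dl x : vertex := [ffun i => if i == x.1 then (if x.2 then -1 else 1) else 0].
Definition disp w : vertex := \sum_(x <- w) dl x.

Lemma dl_linv x : dl (linv x) = - dl x.
Proof.
apply/ffunP=> i; rewrite !ffunE /=; case: eqP => _; last by rewrite oppr0.
by case: (x.2); rewrite ?opprK.
Qed.

Lemma disp_nil : disp [::] = 0. Proof. exact: big_nil. Qed.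
Lemma disp_cons x w : disp (x :: w) = dl x + disp w. Proof. exact: big_cons. Qed.
Lemma disp_cat u v : disp (u ++ v) = disp u + disp v. Proof. exact: big_cat. Qed.

Lemma disp_winv w : disp (winv w) = - disp w.
Proof.
elim: w => [|x w IH]; first by rewrite disp_nil oppr0.
by rewrite winv_cons disp_cat IH disp_cons disp_cons disp_nil dl_linv addr0 opprD addrC.
Qed.

Lemma disp_perm u v : perm_eq u v -> disp u = disp v.
Proof. by move=> uv; apply: perm_big. Qed.

Lemma disp_coord w i :
  disp w i = (count_mem (i, false) w)%:Z - (count_mem (i, true) w)%:Z.
Proof.
elim: w => [|[j b] w IH]; first by rewrite disp_nil ffunE.
rewrite disp_cons ffunE IH ffunE /= !xpair_eqE.
by rewrite (eq_sym i); case: (j == i) => /=; case: b => /=; lia.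
Qed.

Lemma disp_count w x : 
  (count_mem x w)%:Z - (count_mem (linv x) w)%:Z = if x.2 then - disp w x.1 else disp w x.1.
Proof. by case: x => i []; rewrite disp_coord /linv /= ?opprB. Qed.

Lemma disp_reduce w : disp (reduce w) = disp w.
Proof.
elim: w => // x w IH; rewrite disp_cons -IH /=.
case: (reduce w) => [|y s] /=; first by rewrite disp_cons.
by case: eqP => [->|_]; rewrite !disp_cons // dl_linv addrA subrr add0r.
Qed.

Definition edge := (vertex * L)%type.
Definition ebar (e : edge) : edge := (e.1 + dl e.2, linv e.2).

Lemma ebarK : involutive ebar.
Proof. by case=> p x; rewrite /ebar /= linvK dl_linv addrK. Qed.

Lemma ebar_neq e : ebar e != e.
Proof. by case: e => p x; rewrite /ebar xpair_eqE (negPf (linv_neq x)) andbF. Qed.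

Fixpoint edges p w : seq edge :=
  if w is x :: w' then (p, x) :: edges (p + dl x) w' else [::].

Lemma edges_cat p u v : edges p (u ++ v) = edges p u ++ edges (p + disp u) v.
Proof.
elim: u p => [|x u IH] p /=; first by rewrite disp_nil addr0.
by rewrite IH disp_cons addrA.
Qed.

Lemma size_edges p w : size (edges p w) = size w.
Proof. by elim: w p => //= x w IH p; rewrite IH. Qed.

Definition flow (E : seq edge) (e : edge) : int :=
  (count_mem e E)%:Z - (count_mem (ebar e) E)%:Z.
Arguments flow : simpl never.

Lemma flow_cat E1 E2 e : flow (E1 ++ E2) e = flow E1 e + flow E2 e.
Proof. by rewrite /flow !count_cat; lia. Qed.

Lemma flow_cons e1 E e : flow (e1 :: E) e = flow [:: e1] e + flow E e.
Proof. by rewrite -cat1s flow_cat. Qed.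

Lemma flow_pair e1 e : flow [:: e1; ebar e1] e = 0.
Proof.
rewrite /flow /= (inj_eq (can_inj ebarK)).
have -> : (e1 == ebar e) = (ebar e1 == e) by rewrite -(inj_eq (can_inj ebarK)) ebarK.
by lia.
Qed.

Lemma flow_winv p w e :
  flow (edges (p + disp w) (winv w)) e = - flow (edges p w) e.
Proof.
elim: w p => [|x w IH] p; first by rewrite /flow /= oppr0.
rewrite winv_cons edges_cat flow_cat disp_cons (addrA p) IH disp_winv addrK /=.
rewrite [X in _ = - X]flow_cons (opprD (flow [:: _] e)) [RHS]addrC; congr (_ + _).
by have := flow_pair (p, x) e; rewrite flow_cons => /addr0_eq ->.
Qed.

Lemma flow_reduce p w e : flow (edges p (reduce w)) e = flow (edges p w) e.
Proof.
elim: w p => // x w IH p; rewrite [in RHS]/= flow_cons -IH /=.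
case: (reduce w) => [|y s] /=; first by rewrite /= -flow_cons.
case: eqP => [->|_] /=; last by rewrite -flow_cons.
rewrite dl_linv addrK -flow_cons -[RHS]/(flow ([:: (p, x); ebar (p, x)] ++ _) e).
by rewrite flow_cat flow_pair add0r.
Qed.

Lemma derived1_disp w : derived1 w -> disp w = 0.
Proof.
elim=> [_ [u [v ->]]||u v _ IHu _ IHv|u _ IHu|u v uv _ IHu].
- by rewrite /comm !disp_cat !disp_winv addrA -opprD subrr.
- exact: disp_nil.
- by rewrite disp_cat IHu IHv addr0.
- by rewrite disp_winv IHu oppr0.
- by rewrite -disp_reduce -uv disp_reduce.
Qed.

(** For [u] and [v] in F' the four factors of the commutator all start at the same vertex, so the
    flows of [u] and [v] cancel against those of their inverses. *)
Lemma derived2_flow w : derived2 w -> disp w = 0 /\ forall p e, flow (edges p w) e = 0.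
Proof.
elim=> [_ [u [v [/derived1_disp du /derived1_disp dv ->]]]||u v _ [du fu] _ [dv fv]
       |u _ [du fu]|u v uv _ [du fu]].
- rewrite /comm !disp_cat !disp_winv du dv; split; first by rewrite oppr0 !addr0.
  move=> p e; rewrite !edges_cat !flow_cat !disp_winv du dv oppr0 !addr0.
  have := flow_winv p u e; have := flow_winv p v e; rewrite du dv addr0 => -> ->.
  by lia.
- by rewrite disp_nil.
- split=> [|p e]; first by rewrite disp_cat du dv addr0.
  by rewrite edges_cat flow_cat fu fv.
- split=> [|p e]; first by rewrite disp_winv du oppr0.
  by have := flow_winv p u e; rewrite du addr0 fu oppr0.
- split=> [|p e]; first by rewrite -disp_reduce -uv disp_reduce.
  by rewrite -flow_reduce -uv flow_reduce.
Qed.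

Lemma mu_eq_flow v w e : mu_eq v w -> flow (edges 0 v) e = flow (edges 0 w) e.
Proof.
case/derived2_flow; rewrite disp_cat disp_winv => /eqP; rewrite subr_eq0 => /eqP dvw f0.
have := f0 0 e; rewrite edges_cat flow_cat dvw flow_winv => /eqP.
by rewrite subr_eq0 => /eqP.
Qed.

(** The inverse of the first letter occurs later, and [x A x^-1 B] equals [[x, A] A B], which leaves
    [A B], two letters shorter. *)
Lemma disp0_derived1 w : disp w = 0 -> derived1 w.
Proof.
have [n] := ubnP (size w); elim: n w => // n IH [|x w] sw dw; first exact: gen_nil.
have xw : linv x \in w.
  rewrite -has_pred1 has_count.
  have := disp_count (x :: w) x.
  rewrite dw ffunE oppr0 if_same /= eqxx eq_sym (negPf (linv_neq x)).
  by rewrite /= ; lia.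
case/splitPr: xw sw dw => A B /= sw dw.
apply: (@gen_red _ _ (comm [:: x] A ++ A ++ B)).
  have -> : comm [:: x] A ++ A ++ B = ([:: x] ++ A ++ [:: linv x]) ++ winv A ++ A ++ B.
    by rewrite /comm -!catA.
  by rewrite reduce_cancelV -!catA.
apply: gen_cat; first by apply: gen_base; exists [:: x], A.
apply: IH; first by move: sw; rewrite !size_cat /= ; lia.
move: dw; rewrite disp_cons !disp_cat disp_cons dl_linv => <-.
by rewrite (addrCA (disp A)) (addrA (dl x)) subrr add0r.
Qed.

(** A prefix-closed transversal of F' in F, one coordinate after the other; [lam] below is the
    associated family of Schreier generators. *)
Definition cpath p : seq L :=
  flatten [seq nseq `|p i|%N (i, (p i < 0)) | i <- enum 'I_r].

Lemma count_cpath p i b :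
  count_mem (i, b) (cpath p) = if b == (p i < 0) then `|p i|%N else 0%N.
Proof.
rewrite /cpath count_flatten -map_comp.
rewrite (eq_map (g := fun j => if j == i then (if b == (p i < 0) then `|p i|%N else 0%N) else 0%N)).
  by rewrite sumnE big_map -big_mkcond big_enum_cond /= (big_pred1 i).
move=> j /=; rewrite count_nseq /= xpair_eqE.
case: (eqVneq j i) => [->|] //=; rewrite [_ == b]eq_sym.
by case: (b == _); rewrite ?mul1n.
Qed.

Lemma disp_cpath p : disp (cpath p) = p.
Proof.
apply/ffunP=> i; rewrite disp_coord !count_cpath.
by case: (ltrP (p i) 0) => /= h; lia.
Qed.

(* Loops through one edge along canonical paths: every closed word is a product
   of them, and modulo F'' they commute. *)
Definition lam (e : edge) : seq L := cpath e.1 ++ e.2 :: winv (cpath (e.1 + dl e.2)).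

Arguments lam : simpl never.

Lemma lam_derived1 e : derived1 (lam e).
Proof.
apply: disp0_derived1.
by rewrite disp_cat disp_cons disp_winv !disp_cpath addrA subrr.
Qed.

Lemma lam_ebar e : lam (ebar e) = winv (lam e).
Proof.
case: e => p x; rewrite /lam /ebar /= dl_linv addrK winv_cat winv_cons winvK.
by rewrite -catA.
Qed.

(** The canonical path that ends one loop cancels against the one that starts the next. *)
Lemma telescope_lam p w :
  reduce (cpath p ++ w) =
  reduce (flatten [seq lam e | e <- edges p w] ++ cpath (p + disp w)).
Proof.
elim: w p => [|x w IH] p /=; first by rewrite disp_nil addr0 cats0.
rewrite disp_cons addrA -catA -(reduce_catr (lam (p, x)) (IH (p + dl x))).
by rewrite /lam /= -catA /= -!cat_rcons (reduce_cancelV (rcons (cpath p) x)).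
Qed.

(** The exchange of [disp0_derived1] with the loops [lam e] as letters: the commutators now have
    both entries in F', hence lie in F''. *)
Lemma flow0_derived2 (E : seq edge) :
  (forall e, flow E e = 0) -> derived2 (flatten [seq lam e | e <- E]).
Proof.
have [n] := ubnP (size E); elim: n E => // n IH [|e E] sE fE; first exact: gen_nil.
have eE : ebar e \in E.
  rewrite -has_pred1 has_count.
  by have := fE e; rewrite /flow /= eqxx eq_sym (negPf (ebar_neq e)) /=; lia.
case/splitPr: eE sE fE => A B sE fE.
rewrite /= map_cat flatten_cat /=.
set LA := flatten _; set LB := flatten _.
apply: (@gen_red _ _ (comm (lam e) LA ++ LA ++ LB)).
  have -> : comm (lam e) LA ++ LA ++ LB = (lam e ++ LA ++ winv (lam e)) ++ winv LA ++ LA ++ LB.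
    by rewrite /comm -!catA.
  by rewrite reduce_cancelV lam_ebar -!catA.
apply: gen_cat.
  apply: gen_base; exists (lam e), LA; split=> //; first exact: lam_derived1.
  rewrite {}/LA; elim: A {sE fE} => [|a A IHA]; first exact: gen_nil.
  by apply: gen_cat; [apply: lam_derived1|].
rewrite -flatten_cat -map_cat; apply: IH => [|e'].
  by move: sE; rewrite /= !size_cat /=; lia.
have := fE e'; rewrite (flow_cons e) !flow_cat (flow_cons (ebar e)).
by have := flow_pair e e'; rewrite flow_cons; lia.
Qed.

Lemma flow_mu_eq v w :
  disp v = disp w -> (forall e, flow (edges 0 v) e = flow (edges 0 w) e) -> mu_eq v w.
Proof.
move=> dvw fvw; rewrite /mu_eq.
set u := v ++ winv w.
have du : disp u = 0 by rewrite disp_cat disp_winv dvw subrr.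
have c0 : cpath 0 = [::].
  by rewrite /cpath; elim: (enum _) => //= i s ->; rewrite ffunE.
(* Since [u] is closed, no canonical path is left over and [u] is freely equal to a product of
   loops. *)
apply: (@gen_red _ _ (flatten [seq lam e | e <- edges 0 u])).
  by have := telescope_lam 0 u; rewrite add0r du c0 cats0 => ->.
apply: flow0_derived2 => e.
by rewrite edges_cat flow_cat add0r dvw -[disp w]add0r flow_winv fvw subrr.
Qed.

End Flow.

(** * Turing machines running register programs *)

Section Machines.
Variable G : finType.

Local Notation cell := (G + option bool)%type.
(** Besides data symbols [inl g], the tape alphabet has the blank, the end [dol] of a register, and
    a [mark] present only during a deletion. *)
Definition blank : cell := inr None.
Definition dol : cell := inr (Some true).
Definition mark : cell := inr (Some false).
Implicit Types (x y a : cell) (l s z u : seq cell).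

Definition tape := (seq cell * cell * seq cell)%type.

Definition tape_at l s : tape :=
  if s is a :: s' then (l, a, s') else (l, blank, [::]).

Definition tape_move (m : move) (t : tape) : tape :=
  let: (l, a, s) := t in
  match m with
  | MStay => (l, a, s)
  | MLeft => if l is x :: l' then (l', x, a :: s) else ([::], blank, a :: s)
  | MRight => tape_at (a :: l) s
  end.

(** A halting state carries a Boolean answer, so that any machine can serve as the condition of
    [mif] and [mwhile]. *)
Record mach := Mach {
  mstate : finType;
  mstart : mstate;
  mhalt : mstate -> option bool;
  mdelta : mstate -> cell -> mstate * cell * move }.

Definition mstep (M : mach) (c : mstate M * tape) : mstate M * tape :=
  let: (q, (l, a, s)) := c in
  let: (q', b, m) := mdelta q a in (q', tape_move m (l, b, s)).

Inductive msteps (M : mach) : nat -> mstate M * tape -> mstate M * tape -> Prop :=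
| msteps0 (c : mstate M * tape) : msteps 0 c c
| mstepsS n (c c' : mstate M * tape) : mhalt c.1 = None -> msteps n (mstep c) c' -> msteps n.+1 c c'.

Lemma msteps_trans M n1 n2 (c1 c2 c3 : mstate M * tape) :
  msteps n1 c1 c2 -> msteps n2 c2 c3 -> msteps (n1 + n2) c1 c3.
Proof. by elim=> // n c c' hc _ IH /IH; apply: mstepsS. Qed.

Definition exec (M : mach) (t : tape) (b : bool) (t' : tape) (N : nat) :=
  exists n q, [/\ n <= N, msteps n (mstart M, t) (q, t') & mhalt q = Some b].

Lemma exec_le M t b t' N N' : N <= N' -> exec M t b t' N -> exec M t b t' N'.
Proof. by move=> leN [n [q [ln h1 h2]]]; exists n, q; split=> //; apply: leq_trans leN. Qed.

Definition mconst (b : bool) : mach :=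
  @Mach unit tt (fun _ => Some b) (fun q a => (q, a, MStay)).

Lemma exec_const b t : exec (mconst b) t b t 0.
Proof. by exists 0, tt; split=> //; apply: msteps0. Qed.

Definition mtest (p : pred cell) : mach :=
  @Mach (option bool) None id (fun _ a => (Some (p a), a, MStay)).

Lemma exec_test p l a s : exec (mtest p) (l, a, s) (p a) (l, a, s) 1.
Proof. by exists 1, (Some (p a)); split=> //; apply: mstepsS => //=; apply: msteps0. Qed.

Definition mact (f : cell -> cell) (m : move) : mach :=
  @Mach bool false (fun q => if q then Some true else None) (fun _ a => (true, f a, m)).

Lemma exec_act f m l a s :
  exec (mact f m) (l, a, s) true (tape_move m (l, f a, s)) 1.
Proof. by exists 1, true; split=> //; apply: mstepsS => //=; apply: msteps0. Qed.

Section If.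
Variables M1 M2 M3 : mach.

Definition mif : mach :=
  @Mach (mstate M1 + (mstate M2 + mstate M3))%type (inl (mstart M1))
    (fun q => match q with
              | inl _ => None | inr (inl q) => mhalt q | inr (inr q) => mhalt q end)
    (fun q a => match q with
      | inl q =>
        match mhalt q with
        | Some true => (inr (inl (mstart M2)), a, MStay)
        | Some false => (inr (inr (mstart M3)), a, MStay)
        | None => let: (q', b, m) := mdelta q a in (inl q', b, m)
        end
      | inr (inl q) => let: (q', b, m) := mdelta q a in (inr (inl q'), b, m)
      | inr (inr q) => let: (q', b, m) := mdelta q a in (inr (inr q'), b, m)
      end).

Lemma msteps_if1 n c c' : msteps n c c' -> @msteps mif n (inl c.1, c.2) (inl c'.1, c'.2).
Proof.
elim=> {n c c'} [[q t]|n [q [[l a] s]] c' /= hq _ IH]; first exact: msteps0.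
apply: mstepsS => //=; move: IH; rewrite hq.
by case: (mdelta q a) => [[q' b] m].
Qed.

Lemma msteps_if2 n c c' :
  msteps n c c' -> @msteps mif n (inr (inl c.1), c.2) (inr (inl c'.1), c'.2).
Proof.
elim=> {n c c'} [[q t]|n [q [[l a] s]] c' /= hq _ IH]; first exact: msteps0.
by apply: mstepsS => //=; move: IH; case: (mdelta q a) => [[q' b] m].
Qed.

Lemma msteps_if3 n c c' :
  msteps n c c' -> @msteps mif n (inr (inr c.1), c.2) (inr (inr c'.1), c'.2).
Proof.
elim=> {n c c'} [[q t]|n [q [[l a] s]] c' /= hq _ IH]; first exact: msteps0.
by apply: mstepsS => //=; move: IH; case: (mdelta q a) => [[q' b] m].
Qed.

Lemma exec_if t b1 t1 N1 b t' N2 :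
  exec M1 t b1 t1 N1 -> exec (if b1 then M2 else M3) t1 b t' N2 ->
  exec mif t b t' (N1 + N2).+1.
Proof.
case=> n1 [q1 [le1 /msteps_if1 s1 h1]]; case: b1 h1 => h1 [n2 [q2 [le2 s2 h2]]].
  exists (n1 + n2.+1), (inr (inl q2)); split=> //; first by lia.
  apply: msteps_trans s1 _; apply: mstepsS => //=.
  by case: t1 s2 => [[l a] s] /msteps_if2 /= s2; rewrite h1.
exists (n1 + n2.+1), (inr (inr q2)); split=> //; first by lia.
apply: msteps_trans s1 _; apply: mstepsS => //=.
by case: t1 s2 => [[l a] s] /msteps_if3 /= s2; rewrite h1.
Qed.

End If.

Section While.
Variable M : mach.

Definition mwhile : mach :=
  @Mach (option (mstate M)) (Some (mstart M))
    (fun q => if q is Some _ then None else Some true)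
    (fun q a => if q is Some q then
      match mhalt q with
      | Some true => (Some (mstart M), a, MStay)
      | Some false => (None, a, MStay)
      | None => let: (q', b, m) := mdelta q a in (Some q', b, m)
      end else (None, a, MStay)).

Lemma msteps_while n c c' :
  msteps n c c' -> @msteps mwhile n (Some c.1, c.2) (Some c'.1, c'.2).
Proof.
elim=> {n c c'} [[q t]|n [q [[l a] s]] c' /= hq _ IH]; first exact: msteps0.
apply: mstepsS => //=; move: IH; rewrite hq.
by case: (mdelta q a) => [[q' b] m].
Qed.

Lemma exec_while_stop t t1 N :
  exec M t false t1 N -> exec mwhile t true t1 N.+1.
Proof.
case=> n [q [len /msteps_while s1 h1]]; exists (n + 1), None; split=> //; first by lia.
apply: msteps_trans s1 _; apply: mstepsS => //=.
by case: t1 => [[l a] s]; rewrite h1 /=; apply: msteps0.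
Qed.

Lemma exec_while_step t t1 N1 b t2 N2 :
  exec M t true t1 N1 -> exec mwhile t1 b t2 N2 -> exec mwhile t b t2 (N1 + N2).+1.
Proof.
case=> n [q [len /msteps_while s1 h1]] [n2 [q2 [le2 s2 h2]]].
exists (n + n2.+1), q2; split=> //; first by lia.
apply: msteps_trans s1 _; apply: mstepsS => //=.
by case: t1 s2 => [[l a] s] s2; rewrite h1 /=.
Qed.

End While.

Definition mscan (p : pred cell) (m : move) : mach :=
  mwhile (mif (mtest p) (mact id m) (mconst false)).

Lemma exec_scan_stop (p : pred cell) m l a s : ~~ p a -> exec (mscan p m) (l, a, s) true (l, a, s) 5.
Proof.
move=> /negPf pa; apply: (@exec_le _ _ _ _ 3) => //; apply: exec_while_stop.
apply: (@exec_le _ _ _ _ (1 + 0).+1) => //; apply: exec_if (exec_test _ _ _ _) _.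
by rewrite pa; apply: exec_const.
Qed.

Lemma exec_scan_step (p : pred cell) m l a s b t' N :
  p a -> exec (mscan p m) (tape_move m (l, a, s)) b t' N ->
  exec (mscan p m) (l, a, s) b t' (N + 5).
Proof.
move=> pa h; apply: (@exec_le _ _ _ _ ((1 + 1).+1 + N).+1); first by lia.
apply: exec_while_step h; apply: exec_if (exec_test _ _ _ _) _.
by rewrite pa; apply: exec_act.
Qed.

Lemma tape_at_head l s : tape_at l s = (l, head blank s, behead s).
Proof. by case: s. Qed.

Lemma exec_scan_right (p : pred cell) l u s : all p u -> ~~ p (head blank s) ->
  exec (mscan p MRight) (tape_at l (u ++ s)) true (tape_at (rev u ++ l) s) (5 * (size u).+1).
Proof.
elim: u l => [|a u IH] l /=; first by move=> _; rewrite tape_at_head; apply: exec_scan_stop.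
case/andP=> pa pu ps; apply: (@exec_le _ _ _ _ (5 * (size u).+1 + 5)); first by lia.
apply: exec_scan_step => //=; rewrite rev_cons cat_rcons; exact: IH.
Qed.

(** The head stops on the blank before the data; [behead l] covers both a blank taken from [l] and a
    fresh one at the end of the tape. *)
Lemma exec_scan_left (p : pred cell) l u a s : all p (rcons u a) -> ~~ p blank -> all (pred1 blank) l ->
  exec (mscan p MLeft) (tape_at (rev u ++ l) (a :: s)) true
    (tape_at (behead l) (blank :: u ++ a :: s)) (5 * (size u).+2).
Proof.
move=> pu pb lb; elim/last_ind: u a s pu => [|u x IH] a s.
  rewrite /= andbT => pa; apply: (@exec_le _ _ _ _ (5 + 5)) => //.
  apply: exec_scan_step => //=; case: l lb => [|y l] //=; first by move=> _; apply: exec_scan_stop.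
  by case/andP=> /eqP -> _; apply: exec_scan_stop.
rewrite all_rcons => /andP[pa pu]; rewrite rev_rcons size_rcons.
apply: (@exec_le _ _ _ _ (5 * (size u).+2 + 5)); first by lia.
by apply: exec_scan_step => //=; rewrite cat_rcons; apply: IH.
Qed.

Definition mret : mach :=
  mif (mscan (predC1 blank) MLeft) (mact id MRight) (mconst true).

Lemma exec_ret l u a s : all (predC1 blank) (rcons u a) -> all (pred1 blank) l ->
  exec mret (tape_at (rev u ++ l) (a :: s)) true
    (tape_at (blank :: behead l) (u ++ a :: s)) (5 * (size u).+3).
Proof.
move=> pu lb; apply: (@exec_le _ _ _ _ (5 * (size u).+2 + 1).+1); first by lia.
apply: (@exec_if _ _ _ _ true); last by apply: exec_act.
by apply: exec_scan_left => //=; rewrite eqxx.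
Qed.

(** The state carries the cell displaced last, so everything up to the next blank moves one cell to
    the right. *)
Definition minsert (a : cell) : mach :=
  @Mach (option cell) (Some a) (fun q => if q is Some _ then None else Some true)
    (fun q x => if q is Some c then
        if x == blank then (None, c, MStay) else (Some x, c, MRight)
      else (None, x, MStay)).

Lemma exec_insert a l s z : all (predC1 blank) s -> all (pred1 blank) z ->
  exec (minsert a) (tape_at l (s ++ z)) true
    (tape_at (rev (belast a s) ++ l) (last a s :: behead z)) (size s).+1.
Proof.
move=> ps pz; exists (size s).+1, None; split=> //=.
suff: forall c : cell, msteps (size s).+1 ((Some c, tape_at l (s ++ z)) : mstate (minsert a) * tape)
  (None, tape_at (rev (belast c s) ++ l) (last c s :: behead z)) by apply.
elim: s l ps => [|x s IH] l ps c /=.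
  apply: mstepsS => //=; rewrite tape_at_head.
  have -> : head blank z == blank by case: z pz => //= y z /andP[].
  exact: msteps0.
case/andP: ps => px ps; apply: mstepsS => //=; rewrite (negPf px) /=.
by rewrite rev_cons cat_rcons; apply: IH.
Qed.

Definition mcarry : mach :=
  @Mach (option cell) (Some blank) (fun q => if q is Some _ then None else Some true)
    (fun q x => if q is Some c then
        if x == mark then (None, c, MStay) else (Some x, c, MLeft)
      else (None, x, MStay)).

Lemma exec_carry l s y z : all (predC1 mark) (rcons s y) ->
  exec mcarry (tape_at (rev s ++ mark :: l) (y :: z)) true
    (tape_at l (s ++ y :: blank :: z)) (size s).+2.
Proof.
move=> ps; exists (size s).+2, None; split=> //=.
suff: forall c : cell, msteps (size s).+2
  ((Some c, tape_at (rev s ++ mark :: l) (y :: z)) : mstate mcarry * tape)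
  (None, tape_at l (s ++ y :: c :: z)) by apply.
elim/last_ind: s y z ps => [|s x IH] y z ps c.
  move: ps => /=; rewrite andbT => py; apply: mstepsS => //=; rewrite (negPf py) /=.
  by apply: mstepsS => //=; apply: msteps0.
move: ps; rewrite all_rcons size_rcons rev_rcons => /andP[py ps].
apply: mstepsS => //=; rewrite (negPf py) /= cat_rcons; exact: IH.
Qed.

(* The cell to delete is marked; coming back from the right end, the machine
   shifts everything beyond the mark one cell to the left, onto it. *)
Definition mdelete : mach :=
  mif (mact (fun=> mark) MRight)
    (mif (mscan (predC1 blank) MRight)
       (mif (mact id MLeft) mcarry (mconst true)) (mconst true)) (mconst true).

Definition is_data : pred cell := fun x => (x != blank) && (x != mark).

Lemma exec_delete l x s y z : all is_data (rcons s y) -> all (pred1 blank) z ->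
  exec mdelete (tape_at l (x :: rcons s y ++ z)) true
    (tape_at l (rcons s y ++ blank :: blank :: behead z)) (10 * (size s).+3).
Proof.
move=> ps pz.
apply: (@exec_le _ _ _ _ (1 + (5 * (size (rcons s y)).+1 + (1 + (size s).+2).+1).+1).+1).
  by rewrite size_rcons; lia.
apply: exec_if (exec_act _ _ _ _ _) _ => /=.
apply: (@exec_if _ _ _ _ true); first apply: exec_scan_right.
- by apply: sub_all ps => a /andP[].
- by rewrite negbK; case: z pz => //= a z /andP[].
rewrite tape_at_head; apply: exec_if (exec_act _ _ _ _ _) _.
rewrite rev_rcons /=.
have -> : head blank z = blank by case: z pz => //= a z /andP[/eqP].
by rewrite !cat_rcons; apply: exec_carry; apply: sub_all ps => a /andP[].
Qed.

Fixpoint mskip (k : nat) : mach :=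
  if k is k'.+1 then
    mif (mscan (predC1 dol) MRight) (mif (mact id MRight) (mskip k') (mconst true)) (mconst true)
  else mconst true.

(** [dol] terminates a register rather than separating two, so an empty register still owns a cell
    at which the head can stop. *)
Definition enc (D : seq (seq G)) : seq cell := flatten [seq rcons (map inl w) dol | w <- D].

Lemma enc_cat D1 D2 : enc (D1 ++ D2) = enc D1 ++ enc D2.
Proof. by rewrite /enc map_cat flatten_cat. Qed.

Lemma enc_consE (x : seq G) (D : seq (seq G)) : enc (x :: D) = map inl x ++ dol :: enc D.
Proof. by rewrite /enc /= cat_rcons. Qed.

Lemma enc_data D : all is_data (enc D).
Proof.
elim: D => //= x D IH; rewrite -/(enc D) all_cat IH andbT all_rcons /=.
by elim: x.
Qed.

Lemma exec_skip l D s :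
  exec (mskip (size D)) (tape_at l (enc D ++ s)) true (tape_at (rev (enc D) ++ l) s)
    (10 * size (enc D)).
Proof.
elim: D l => [|x D IH] l /=; first exact: exec_const.
rewrite enc_consE -catA; set e : seq cell := map _ x.
apply: (@exec_le _ _ _ _ (5 * (size e).+1 + (1 + 10 * size (enc D)).+1).+1).
  by rewrite size_cat /=; lia.
apply: (@exec_if _ _ _ _ true); first apply: exec_scan_right.
- by rewrite /e; elim: (x).
- by [].
apply: exec_if (exec_act _ _ _ _ _) _ => /=.
rewrite rev_cat rev_cons cat_rcons -catA; exact: IH.
Qed.

(** The amount of blank padding is left open because deletions and excursions of the head change
    it. *)
Definition holds (D : seq (seq G)) (t : tape) := exists l z,
  [/\ all (pred1 blank) l, all (pred1 blank) z & t = tape_at l (enc D ++ z)].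

Definition mpush k (g : G) := mif (mskip k) (mif (minsert (inl g)) mret (mconst true)) (mconst true).
Definition mpop k :=
  mif (mskip k) (mif (mtest (pred1 dol)) mret (mif mdelete mret (mconst true))) (mconst true).
Definition cell_sym (x : cell) : option G := if x is inl g then Some g else None.
Definition mprobe k (p : pred (option G)) :=
  mif (mskip k)
    (mif (mtest (fun x => p (cell_sym x))) mret (mif mret (mconst false) (mconst true)))
    (mconst true).

Definition push k g (D : seq (seq G)) := set_nth [::] D k (g :: nth [::] D k).
Definition pop k (D : seq (seq G)) := set_nth [::] D k (behead (nth [::] D k)).

Lemma reg_split k (D : seq (seq G)) : k < size D ->
  D = take k D ++ nth [::] D k :: drop k.+1 D.
Proof. by move=> kD; rewrite -drop_nth // cat_take_drop. Qed.

Lemma data_nonblank s : all is_data s -> all (predC1 blank) s.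
Proof. by apply: sub_all => x /andP[]. Qed.

Lemma exec_push k g D t : k < size D -> holds D t ->
  exists2 t', holds (push k g D) t' & exec (mpush k g) t true t' (40 * (size (enc D)).+2).
Proof.
move=> kD [l [z [lb zb ->]]].
have kE : size (take k D) = k by rewrite size_take kD.
set D1 := take k D in kE; set x := nth [::] D k; set D2 := drop k.+1 D.
have eD : enc D = enc D1 ++ enc (x :: D2) by rewrite -enc_cat -reg_split.
set s := enc (x :: D2) in eD.
have ds : all is_data s by apply: enc_data.
have dD1 : all is_data (enc D1) by apply: enc_data.
have eD' : enc (push k g D) = enc D1 ++ inl g :: s.
  by rewrite /push set_nthE kD enc_cat /s !enc_consE.
have dg : all is_data (inl g :: s) by [].
exists (tape_at (blank :: behead l) (enc (push k g D) ++ behead z)).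
  exists (blank :: behead l), (behead z); split=> //=.
    by case: (l) lb => //= y l' /andP[].
  by case: (z) zb => //= y l' /andP[].
rewrite eD eD' -!(catA (enc D1)).
set A := 10 * size (enc D1); set B := (size s).+1.
apply: (@exec_le _ _ _ _ (A + (B + 5 * (size (enc D1 ++ belast (inl g) s)).+3).+1).+1).
  by rewrite /A /B !(size_cat (enc D1)) size_belast; lia.
rewrite -{1}kE; apply: exec_if (exec_skip _ _ _) _ => /=.
apply: (@exec_if _ _ _ _ true); first by apply: exec_insert => //; apply: data_nonblank.
rewrite catA -rev_cat.
have -> : enc D1 ++ (inl g :: s) ++ behead z =
   (enc D1 ++ belast (inl g) s) ++ last (inl g) s :: behead z.
  by rewrite lastI cat_rcons -!catA.
apply: exec_ret => //; rewrite -cats1 -catA cats1 -lastI all_cat.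
by rewrite !data_nonblank.
Qed.

Lemma exec_pop k D t : k < size D -> holds D t ->
  exists2 t', holds (pop k D) t' & exec (mpop k) t true t' (40 * (size (enc D)).+2).
Proof.
move=> kD [l [z [lb zb ->]]].
have kE : size (take k D) = k by rewrite size_take kD.
set D1 := take k D in kE; set x := nth [::] D k; set D2 := drop k.+1 D.
have eD : enc D = enc D1 ++ enc (x :: D2) by rewrite -enc_cat -reg_split.
have dD1 : all is_data (enc D1) by apply: enc_data.
have eD' : enc (pop k D) = enc D1 ++ enc (behead x :: D2).
  by rewrite /pop set_nthE kD enc_cat.
have ds := enc_data (x :: D2); have ds' := enc_data (behead x :: D2).
have lb' : all (pred1 blank) (blank :: behead l).
  by case: (l) lb => //= y l' /andP[].
rewrite /mpop -{2}kE eD -catA.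
case Ex: x => [|g x'].
  have eD'' : enc (pop k D) = enc D1 ++ enc (x :: D2) by rewrite eD' Ex.
  exists (tape_at (blank :: behead l) (enc (pop k D) ++ z)).
    by exists (blank :: behead l), z.
  rewrite eD'' -catA -Ex.
  apply: (@exec_le _ _ _ _ (10 * size (enc D1) + (1 + 5 * (size (enc D1)).+3).+1).+1).
    by rewrite (size_cat (enc D1)); lia.
  apply: exec_if (exec_skip _ _ _) _ => /=.
  rewrite Ex enc_consE /=; apply: exec_if (exec_test _ _ _ _) _ => /=.
  by apply: exec_ret => //; rewrite all_rcons; apply/andP; split=> //; apply: data_nonblank.
exists (tape_at (blank :: behead l) (enc (pop k D) ++ blank :: blank :: behead z)).
  exists (blank :: behead l), (blank :: blank :: behead z); split=> //=.
  by case: (z) zb => //= y l' /andP[].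
rewrite eD' -catA; set s := enc (behead x :: D2) in ds' *.
(* What follows the deleted symbol contains at least the closing [dol], so it has a last cell, as
   [exec_delete] requires. *)
have sE : s = rcons (belast (head dol s) (behead s)) (last (head dol s) (behead s)).
  by rewrite -lastI /s enc_consE; case: (behead x).
move: sE; set u := belast _ _; set y := last _ _ => sE.
have -> : enc ((g :: x') :: D2) = inl g :: s by rewrite /s Ex !enc_consE.
apply: (@exec_le _ _ _ _ (10 * size (enc D1) + (1 + (10 * (size u).+3 + 5 * (size (enc D1)).+3).+1).+1).+1).
  by rewrite (size_cat (enc D1)) /= sE size_rcons; lia.
apply: exec_if (exec_skip _ _ _) _ => /=.
apply: exec_if (exec_test _ _ _ _) _ => /=.
rewrite sE; apply: (@exec_if _ _ _ _ true); first by apply: exec_delete => //; rewrite -sE.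
rewrite -sE; have: s <> [::] by rewrite /s enc_consE; case: (behead x).
case: (s) ds' => // a s' das _ /=; apply: exec_ret => //.
by rewrite all_rcons (data_nonblank dD1) andbT; case/andP: das => /andP[].
Qed.

Lemma exec_probe k p D t : k < size D -> holds D t ->
  exists2 t', holds D t' &
    exec (mprobe k p) t (p (ohead (nth [::] D k))) t' (40 * (size (enc D)).+2).
Proof.
move=> kD [l [z [lb zb ->]]].
have kE : size (take k D) = k by rewrite size_take kD.
set D1 := take k D in kE; set x := nth [::] D k; set D2 := drop k.+1 D.
have eD : enc D = enc D1 ++ enc (x :: D2) by rewrite -enc_cat -reg_split.
have dD1 : all is_data (enc D1) by apply: enc_data.
have ds := enc_data (x :: D2).
exists (tape_at (blank :: behead l) (enc D ++ z)).
  exists (blank :: behead l), z; split=> //=.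
  by case: (l) lb => //= y l' /andP[].
rewrite /mprobe -kE eD -catA.
apply: (@exec_le _ _ _ _ (10 * size (enc D1) + (1 + (5 * (size (enc D1)).+3 + 0).+1).+1).+1).
  by rewrite (size_cat (enc D1)); lia.
apply: exec_if (exec_skip _ _ _) _ => /=.
have [a [s [eE pE]]] : exists a s, enc (x :: D2) = a :: s /\ cell_sym a = ohead x.
  rewrite enc_consE; case: (x) => [|g x']; first by exists dol, (enc D2).
  by exists (inl g), (map inl x' ++ dol :: enc D2).
move: ds; rewrite eE /= => /andP[/andP[da _] _].
apply: exec_if (exec_test _ _ _ _) _; rewrite pE.
have R := @exec_ret l (enc D1) a (s ++ z); rewrite all_rcons data_nonblank // andbT in R.
case: (p _); first by apply: exec_le (R da lb); lia.
by apply: exec_if (R da lb) _; apply: exec_const.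
Qed.

Inductive prog :=
| Const of bool
| Push of nat & G
| Pop of nat
| Test of nat & pred (option G)
| If of prog & prog & prog
| While of prog.

(* [ev P D b D' n]: on registers [D], the program [P] answers [b] and leaves
   [D'], in [n] elementary operations. *)
Inductive ev : prog -> seq (seq G) -> bool -> seq (seq G) -> nat -> Prop :=
| ev_const b D : ev (Const b) D b D 1
| ev_push k g D : k < size D -> ev (Push k g) D true (push k g D) 1
| ev_pop k D : k < size D -> ev (Pop k) D true (pop k D) 1
| ev_test k p D : k < size D -> ev (Test k p) D (p (ohead (nth [::] D k))) D 1
| ev_if P Q R D b1 D1 n1 b D2 n2 :
    ev P D b1 D1 n1 -> ev (if b1 then Q else R) D1 b D2 n2 ->
    ev (If P Q R) D b D2 (n1 + n2).+1
| ev_stop P D D1 n : ev P D false D1 n -> ev (While P) D true D1 n.+1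
| ev_loop P D D1 n1 D2 n2 :
    ev P D true D1 n1 -> ev (While P) D1 true D2 n2 ->
    ev (While P) D true D2 (n1 + n2).+1.

Fixpoint compile (P : prog) : mach :=
  match P with
  | Const b => mconst b
  | Push k g => mpush k g
  | Pop k => mpop k
  | Test k p => mprobe k p
  | If P Q R => mif (compile P) (compile Q) (compile R)
  | While P => mwhile (compile P)
  end.

Lemma size_enc_reg k (x : seq G) D : k < size D ->
  size (enc (set_nth [::] D k x)) + size (nth [::] D k) = size (enc D) + size x.
Proof.
move=> kD; have -> : enc D = enc (take k D) ++ enc (nth [::] D k :: drop k.+1 D).
  by rewrite -enc_cat -reg_split.
by rewrite set_nthE kD enc_cat !enc_consE !size_cat /= !size_map; lia.
Qed.

Lemma ev_size P D b D' n : ev P D b D' n -> size (enc D') <= size (enc D) + n.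
Proof.
elim=> // {P D b D' n}; try by lia.
- by move=> k g D kD; have := size_enc_reg (g :: nth [::] D k) kD; rewrite /push /=; lia.
- move=> k D kD; have := size_enc_reg (behead (nth [::] D k)) kD; rewrite /pop size_behead.
  by lia.
Qed.

(** An operation sweeps the tape a bounded number of times and lengthens the encoding by at most one
    cell, so [N] bounds that length throughout the run. *)
Lemma compile_exec P D b D' n N t :
  ev P D b D' n -> holds D t -> size (enc D) + n <= N ->
  exists2 t', holds D' t' & exec (compile P) t b t' (n * (40 * N.+2)).
Proof.
move=> e; elim: e N t => {P D b D' n}.
- by move=> b D N t ht _; exists t => //; apply: exec_le (exec_const _ _).
- move=> k g D kD N t ht leN; have [t' h1 h2] := exec_push g kD ht.
  by exists t' => //; apply: exec_le h2; lia.
- move=> k D kD N t ht leN; have [t' h1 h2] := exec_pop kD ht.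
  by exists t' => //; apply: exec_le h2; lia.
- move=> k p D kD N t ht leN; have [t' h1 h2] := exec_probe p kD ht.
  by exists t' => //; apply: exec_le h2; lia.
- move=> P Q R D b1 D1 n1 b D2 n2 e1 IH1 _ IH2 N t ht leN.
  have [|t1 h1 x1] := IH1 N t ht; first by lia.
  have [|t2 h2 x2] := IH2 N t1 h1; first by have := ev_size e1; lia.
  exists t2 => //; apply: (@exec_le _ _ _ _ (n1 * (40 * N.+2) + n2 * (40 * N.+2)).+1); first by lia.
  by apply: exec_if x1 _; case: (b1) x2.
- move=> P D D1 n e1 IH1 N t ht leN.
  have [|t1 h1 x1] := IH1 N t ht; first by lia.
  exists t1 => //; apply: (@exec_le _ _ _ _ (n * (40 * N.+2)).+1); first by lia.
  exact: exec_while_stop.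
- move=> P D D1 n1 D2 n2 e1 IH1 _ IH2 N t ht leN.
  have [|t1 h1 x1] := IH1 N t ht; first by lia.
  have [|t2 h2 x2] := IH2 N t1 h1; first by have := ev_size e1; lia.
  exists t2 => //; apply: (@exec_le _ _ _ _ (n1 * (40 * N.+2) + n2 * (40 * N.+2)).+1); first by lia.
  exact: exec_while_step x1 x2.
Qed.

End Machines.
Arguments enc {G} D : simpl never.

(** * Turing machines from register programs: input, output and running time *)

Section TuringMachine.
Variables (A G : finType) (gin : A -> G) (gout : G -> option A).
Hypothesis ginK : forall a, gout (gin a) = Some a.
Local Notation cell := (G + option bool)%type.

(** Writes [k.+1] terminators: one closes the register of the input, the others are [k] empty
    registers. *)
Fixpoint mdols (k : nat) : mach G :=
  if k is k'.+1 then mif (mact (fun=> dol G) MRight) (mdols k') (mconst G true)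
  else mact (fun=> dol G) MStay.

Lemma exec_dols k (l : seq cell) :
  exec (mdols k) (tape_at l [::]) true (tape_at (nseq k (dol G) ++ l) [:: dol G]) (2 * k).+1.
Proof.
elim: k l => [|k IH] l; first exact: exec_act.
apply: (@exec_le _ _ _ _ _ (1 + (2 * k).+1).+1); first by lia.
apply: exec_if (exec_act _ _ _ _ _) _ => /=.
have -> : dol G :: nseq k (dol G) ++ l = nseq k (dol G) ++ dol G :: l.
  by rewrite -cat_rcons -cat1s catA; congr (_ ++ _); elim: k {IH} => //= k <-.
exact: IH.
Qed.

Definition minit k :=
  mif (mscan (predC1 (blank G)) MRight) (mif (mdols k) (mret G) (mconst G true)) (mconst G true).

Lemma exec_init k (x : seq G) : exists2 t, holds (x :: nseq k [::]) t &
  exec (minit k) (tape_at [::] (map inl x)) true t (30 * (size x + k).+1).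
Proof.
have eE : enc (x :: nseq k [::]) = map inl x ++ nseq k (dol G) ++ [:: dol G].
  rewrite enc_consE; congr (_ ++ _); elim: k => //= k IH.
  by rewrite enc_consE /= IH.
exists (tape_at [:: blank G] (enc (x :: nseq k [::]))).
  by exists [:: blank G], [::]; rewrite cats0.
apply: (@exec_le _ _ _ _ _ (5 * (size x).+1 + ((2 * k).+1 + 5 * (size x + k).+3).+1).+1).
  by lia.
rewrite -[map inl x]cats0.
apply: (@exec_if _ _ _ _ _ true).
  by rewrite -(size_map (inl : G -> cell) x); apply: exec_scan_right => //; elim: (x).
apply: exec_if (exec_dols _ _) _.
have := @exec_ret G [::] (map inl x ++ nseq k (dol G)) (dol G) [::].
rewrite eE -!catA rev_cat rev_nseq !cats0 size_cat size_map size_nseq; apply=> //.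
rewrite all_rcons all_cat all_nseq /= orbT andbT.
by elim: (x).
Qed.

Definition TM_of (M : mach G) : TM A :=
  @Build_TM A (mstate M) (G + option bool)%type (blank G) (fun a => inl (gin a))
    (fun x => if x is inl g then gout g else None) ginK erefl (mstart M)
    (fun q => isSome (mhalt q)) (@mdelta G M).

Definition TM_config (M : mach G) (c : mstate M * tape G) : config (TM_of M) :=
  let: (q, (l, a, s)) := c in (q, l, a, s).

Lemma TM_run_msteps (M : mach G) n (c c' : mstate M * tape G) :
  msteps n c c' -> tm_run (TM_of M) n (TM_config c) = TM_config c'.
Proof.
elim=> // {n c c'} n [q [[l a] s]] c' hq _ <-.
rewrite /tm_run iterSr; congr iter; move: hq => /= ->.
by case: (mdelta q a) => [[q' b] []] //=; [case: l|case: s].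
Qed.

Fixpoint decode (x : seq G) : seq A :=
  if x is g :: x' then if gout g is Some a then a :: decode x' else [::] else [::].

(** The machine depends only on [P] and [k]. The bound is quadratic because each of the [n]
    operations costs time linear in the length of the tape. *)
Lemma prog_TM k (P : prog G) : exists M : TM A,
  forall (w : seq A) b x D n, ev P (map gin w :: nseq k [::]) b (x :: D) n ->
  exists t, [/\ t <= 100 * (size w + k + n).+2 ^ 2,
    tm_halted M (tm_run M t (tm_init M w)) &
    tm_output M (tm_run M t (tm_init M w)) = decode x].
Proof.
exists (TM_of (mif (minit k) (compile P) (mconst G true))) => w b x D n evP.
have [t0 h0 x0] := exec_init k (map gin w).
have sE : size (enc (map gin w :: nseq k [::])) = size w + k.+1.
  rewrite enc_consE size_cat !size_map /=; congr (_ + _.+1).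
  elim: k {evP h0 x0} => // k IH.
  by rewrite -[nseq _ _]/(([::] : seq G) :: nseq k [::]) enc_consE cat0s -[in RHS]IH.
have [t1 h1 x1] := compile_exec evP h0 (leqnn _).
have [t [q [let1 s1 hq]]] := @exec_if _ _ _ (mconst G true) _ _ _ _ _ _ _ x0 x1.
exists t.
set M0 := mif _ _ _ in q s1 hq *.
have -> : tm_init (TM_of M0) w =
   @TM_config M0 (mstart M0, tape_at [::] (map inl (map gin w))).
  by rewrite /tm_init -map_comp; case: (w).
rewrite (TM_run_msteps s1); case: h1 => l [z [_ _ t1E]] {s1}.
split.
- apply: leq_trans let1 _; rewrite sE size_map -mulnn; nia.
- by rewrite t1E tape_at_head; change (is_true (isSome (mhalt q))); rewrite hq.
(* Reading the output stops at the first symbol rejected by [gout], at the latest at the [dol] that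
   closes register 0. *)
have outE y u : @take_letters _ (TM_of M0) (map inl y ++ dol G :: u) = decode y.
  by elim: y => //= g y ->.
rewrite -(outE x (enc D ++ z)) t1E enc_consE -catA.
by case: (x).
Qed.

End TuringMachine.

(** * Longest prefixes satisfying a predicate *)

Section Prefix.
Variable T : Type.
Implicit Types (p : pred T) (s : seq T).

Definition pref p s := take (find (predC p) s) s.
Definition suff p s := drop (find (predC p) s) s.

Lemma pref_suff p s : pref p s ++ suff p s = s.
Proof. exact: cat_take_drop. Qed.

Lemma pref_cons p a s : pref p (a :: s) = if p a then a :: pref p s else [::].
Proof. by rewrite /pref /=; case: (p a). Qed.

Lemma suff_cons p a s : suff p (a :: s) = if p a then suff p s else a :: s.
Proof. by rewrite /suff /=; case: (p a). Qed.

Lemma all_pref p s : all p (pref p s).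
Proof. by elim: s => //= a s IH; rewrite pref_cons; case: ifP => //= ->. Qed.

Lemma all_pref_id p s : all p s -> pref p s = s /\ suff p s = [::].
Proof.
elim: s => //= a s IH /andP[pa /IH[e1 e2]].
by rewrite pref_cons suff_cons pa e1 e2.
Qed.

Lemma suff_head p s a s' : suff p s = a :: s' -> ~~ p a /\ ~~ all p s.
Proof.
elim: s => //= b s IH; rewrite suff_cons; case: ifP => [pb /IH[]|/negbT pb [<- _]] //.
Qed.

Lemma size_suff p s : size (suff p s) <= size s.
Proof. by rewrite size_drop leq_subr. Qed.

Lemma size_pref p s : size (pref p s) <= size s.
Proof. by rewrite size_take_min geq_minr. Qed.

End Prefix.

Lemma pref_map T U (f : T -> U) p s : pref p (map f s) = map f (pref (preim f p) s).
Proof. by elim: s => //= a s IH; rewrite !pref_cons IH /=; case: ifP. Qed.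

Lemma suff_map T U (f : T -> U) p s : suff p (map f s) = map f (suff (preim f p) s).
Proof. by elim: s => //= a s IH; rewrite !suff_cons IH /=; case: ifP. Qed.

(** * Derived instructions of the register language *)

Section Programs.
Variable G : finType.
Implicit Types (P Q R : prog G) (D : seq (seq G)) (x y z : seq G).

Definition runs P D b D' N := exists2 n, n <= N & ev P D b D' n.

Lemma runs_le N N' P D b D' : runs P D b D' N -> N <= N' -> runs P D b D' N'.
Proof. by case=> n le e leN; exists n => //; apply: leq_trans leN. Qed.

Lemma runs_const b D : runs (Const G b) D b D 1.
Proof. by exists 1 => //; constructor. Qed.

Lemma runs_push k g D : k < size D -> runs (Push k g) D true (push k g D) 1.
Proof. by exists 1 => //; constructor. Qed.

Lemma runs_pop k D : k < size D -> runs (Pop G k) D true (pop k D) 1.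
Proof. by exists 1 => //; constructor. Qed.

Lemma runs_test k (p : pred (option G)) D : k < size D -> runs (Test k p) D (p (ohead (nth [::] D k))) D 1.
Proof. by exists 1 => //; constructor. Qed.

Lemma runs_if P Q R D b1 D1 n1 b D2 n2 :
  runs P D b1 D1 n1 -> runs (if b1 then Q else R) D1 b D2 n2 ->
  runs (If P Q R) D b D2 (n1 + n2).+1.
Proof.
by case=> m1 l1 e1 [m2 l2 e2]; exists (m1 + m2).+1; [lia|apply: ev_if e1 e2].
Qed.

Definition Seq P Q := If P Q Q.

Lemma runs_seq P Q D b1 D1 n1 b D2 n2 :
  runs P D b1 D1 n1 -> runs Q D1 b D2 n2 -> runs (Seq P Q) D b D2 (n1 + n2).+1.
Proof. by move=> r1 r2; apply: runs_if r1 _; case: b1. Qed.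

Lemma runs_stop P D D1 n : runs P D false D1 n -> runs (While P) D true D1 n.+1.
Proof. by case=> m l e; exists m.+1 => //; apply: ev_stop. Qed.

Lemma runs_loop P D D1 n1 D2 n2 :
  runs P D true D1 n1 -> runs (While P) D1 true D2 n2 -> runs (While P) D true D2 (n1 + n2).+1.
Proof.
by case=> m1 l1 e1 [m2 l2 e2]; exists (m1 + m2).+1; [lia|apply: ev_loop e1 e2].
Qed.

Local Notation put k x D := (set_nth [::] D k x).

Lemma put_put k x y D : put k x (put k y D) = put k x D.
Proof. by rewrite set_set_nth eqxx. Qed.

Lemma put_comm k j x y D : k != j -> put k x (put j y D) = put j y (put k x D).
Proof. by move=> /negPf kj; rewrite set_set_nth eq_sym kj. Qed.

Lemma size_put k x D : k < size D -> size (put k x D) = size D.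
Proof. by move=> kD; rewrite size_set_nth; apply/maxn_idPr. Qed.

Lemma nth_put k j x D : nth [::] (put k x D) j = if j == k then x else nth [::] D j.
Proof. by rewrite nth_set_nth. Qed.

Lemma put_id k D : k < size D -> put k (nth [::] D k) D = D.
Proof.
move=> kD; apply: (@eq_from_nth _ [::]) => [|i _]; first exact: size_put.
by rewrite nth_put; case: eqP => // ->.
Qed.

(** Since the alphabet is finite, a chain of tests lets the continuation depend on the top symbol,
    although a single test only answers a Boolean. *)
Definition OnTop k (p : pred G) (f : G -> prog G) Q :=
  foldr (fun a R => If (Test k (pred1 (Some a))) (f a) R) Q [seq a <- enum G | p a].

Definition gcard := #|G|.

Lemma size_enum_filter (p : pred G) : 2 * size [seq a <- enum G | p a] <= 2 * gcard.
Proof. by rewrite leq_mul2l /= size_filter /gcard cardE count_size. Qed.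

Lemma runs_ontop k (p : pred G) f Q D a x b D' n :
  k < size D -> nth [::] D k = a :: x -> p a -> runs (f a) D b D' n ->
  runs (OnTop k p f Q) D b D' (2 * gcard + n).
Proof.
move=> kD Dk pa ra; have ain : a \in [seq a <- enum G | p a].
  by rewrite mem_filter pa mem_enum.
apply: (@runs_le (2 * size [seq a <- enum G | p a] + n)); last first.
  by rewrite leq_add2r size_enum_filter.
rewrite /OnTop; elim: [seq a <- _ | _] ain => //= c s IH.
rewrite inE; case: (eqVneq a c) => [<- _|ac /= /IH r].
  have := runs_test (pred1 (Some a)) kD; rewrite Dk /= eqxx => rt.
  by apply: runs_le (runs_if rt ra) _; lia.
have := runs_test (pred1 (Some c)) kD; rewrite Dk /= (inj_eq (@Some_inj _)) (negPf ac) => rt.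
by apply: runs_le (runs_if rt r) _; lia.
Qed.

Lemma runs_ontop_else k (p : pred G) f Q D b D' n :
  k < size D -> (if nth [::] D k is a :: _ then ~~ p a else true) -> runs Q D b D' n ->
  runs (OnTop k p f Q) D b D' (2 * gcard + n).
Proof.
move=> kD Dk rQ.
apply: (@runs_le (2 * size [seq a <- enum G | p a] + n)); last first.
  by rewrite leq_add2r size_enum_filter.
rewrite /OnTop; have: all p [seq a <- enum G | p a] by apply: filter_all.
elim: [seq a <- _ | _] => //= c s IH /andP[pc /IH r].
have := runs_test (pred1 (Some c)) kD.
have -> : pred1 (Some c) (ohead (nth [::] D k)) = false.
  by case: (nth _ _ _) Dk => //= a _; case: eqP => // -[->]; rewrite pc.
by move=> rt; apply: runs_le (runs_if rt r) _; lia.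
Qed.

Lemma runs_while_stop k (p : pred G) f D :
  k < size D -> (if nth [::] D k is a :: _ then ~~ p a else true) ->
  runs (While (OnTop k p f (Const G false))) D true D (2 * gcard + 2).
Proof.
move=> kD Dk; have r := runs_ontop_else f kD Dk (runs_const false D).
by apply: runs_le (runs_stop r) _; lia.
Qed.

Lemma runs_while_loop k (p : pred G) f D a x D1 n1 D2 n2 :
  k < size D -> nth [::] D k = a :: x -> p a -> runs (f a) D true D1 n1 ->
  runs (While (OnTop k p f (Const G false))) D1 true D2 n2 ->
  runs (While (OnTop k p f (Const G false))) D true D2 (2 * gcard + n1 + n2).+1.
Proof. by move=> kD Dk pa r1 r2; apply: runs_loop (runs_ontop _ kD Dk pa r1) r2. Qed.

(** One round per symbol and one for the exit; a round pays for the tests of [OnTop] and a bounded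
    number of other operations. *)
Definition xcost n := n.+1 * (2 * gcard + 10).

(** The prefix arrives reversed, as on a stack; a second transfer restores its order. *)
Definition Xfer k (p : pred G) j (f : G -> G) :=
  While (OnTop k p (fun a => Seq (Pop G k) (Push j (f a))) (Const G false)).

Lemma runs_xfer k (p : pred G) j f D y z : k < size D -> j < size D -> k != j ->
  runs (Xfer k p j f) (put k y (put j z D)) true
    (put k (suff p y) (put j (rev (map f (pref p y)) ++ z) D)) (xcost (size y)).
Proof.
move=> kD jD kj; have sz a b : size (put k a (put j b D)) = size D.
  by rewrite !size_put // size_put.
have nk a b : nth [::] (put k a (put j b D)) k = a by rewrite nth_put eqxx.
have nj a b : nth [::] (put k a (put j b D)) j = b.
  by rewrite !nth_put eq_sym (negPf kj) eqxx.
elim: y z => [|a y IH] z.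
  by apply: runs_le (runs_while_stop _ _ _) _; rewrite ?sz ?nk // /xcost /=; lia.
rewrite pref_cons suff_cons; case: ifP => pa; last first.
  by apply: runs_le (runs_while_stop _ _ _) _; rewrite ?sz ?nk ?pa // /xcost /=; lia.
rewrite /= rev_cons cat_rcons.
have r1 : runs (Seq (Pop G k) (Push j (f a))) (put k (a :: y) (put j z D)) true
    (put k y (put j (f a :: z) D)) 3.
  have -> : put k y (put j (f a :: z) D) = push j (f a) (pop k (put k (a :: y) (put j z D))).
    by rewrite /push /pop nk /= put_put nj (@put_comm j k) 1?eq_sym // put_put.
  by apply: runs_seq (runs_pop _) (runs_push _ _); rewrite ?/pop ?size_put ?sz.
apply: runs_le (runs_while_loop _ _ pa r1 (IH _)) _; rewrite ?sz ?nk //.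
by rewrite /xcost /=; lia.
Qed.

(** Feeding two registers at once is how words are copied. *)
Definition Xfer2 k (p : pred G) j (f : G -> G) i (h : G -> G) :=
  While (OnTop k p (fun a => Seq (Pop G k) (Seq (Push j (f a)) (Push i (h a)))) (Const G false)).

Lemma runs_xfer2 k (p : pred G) j f i h D y z w :
  k < size D -> j < size D -> i < size D -> k != j -> k != i -> j != i ->
  runs (Xfer2 k p j f i h) (put k y (put j z (put i w D))) true
    (put k (suff p y) (put j (rev (map f (pref p y)) ++ z)
      (put i (rev (map h (pref p y)) ++ w) D))) (xcost (size y)).
Proof.
move=> kD jD iD kj ki ji.
have sz a b c : size (put k a (put j b (put i c D))) = size D.
  by rewrite !size_put // !size_put.
have nk a b c : nth [::] (put k a (put j b (put i c D))) k = a by rewrite nth_put eqxx.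
have nj a b c : nth [::] (put k a (put j b (put i c D))) j = b.
  by rewrite !nth_put eq_sym (negPf kj) eqxx.
have ni a b c : nth [::] (put k a (put j b (put i c D))) i = c.
  by rewrite !nth_put eq_sym (negPf ki) eq_sym (negPf ji) eqxx.
elim: y z w => [|a y IH] z w.
  by apply: runs_le (runs_while_stop _ _ _) _; rewrite ?sz ?nk // /xcost /=; lia.
rewrite pref_cons suff_cons; case: ifP => pa; last first.
  by apply: runs_le (runs_while_stop _ _ _) _; rewrite ?sz ?nk ?pa // /xcost /=; lia.
rewrite /= !rev_cons !cat_rcons.
have r1 : runs (Seq (Pop G k) (Seq (Push j (f a)) (Push i (h a))))
    (put k (a :: y) (put j z (put i w D))) true
    (put k y (put j (f a :: z) (put i (h a :: w) D))) 5.
  have -> : put k y (put j (f a :: z) (put i (h a :: w) D)) =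
    push i (h a) (push j (f a) (pop k (put k (a :: y) (put j z (put i w D))))).
    rewrite /push /pop nk /= put_put nj (@put_comm j k) 1?eq_sym // put_put.
    by rewrite ni (@put_comm i k) 1?eq_sym // (@put_comm i j) 1?eq_sym // put_put.
  by apply: runs_seq (runs_pop _) (runs_seq (runs_push _ _) (runs_push _ _));
    rewrite /push /pop ?size_put ?sz.
apply: runs_le (runs_while_loop _ _ pa r1 (IH _ _)) _; rewrite ?sz ?nk //.
by rewrite /xcost /=; lia.
Qed.

End Programs.
Arguments gcard : simpl never.
Arguments xcost : simpl never.

(** * The approximation algorithm *)

(* Simplification may unfold the element type inside [size]; [slia] makes these
   types syntactically equal again, so that [lia] sees a single atom. *)
Ltac slia :=
  repeat match goal with H : is_true _ |- _ => move: H end;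
  repeat match goal with |- context [@size ?T ?s] =>
    let T' := eval lazy in T in progress (change (@size T s) with (@size T' s)) end;
  lia.

Section Algorithm.
Variable r : nat.
Local Notation L := (letter r).

(* Black and grey letters are paid for and form the pieces; grey letters are the
   two-way connections bought by merging.  White letters only move the base point
   of the next piece, and the output is cut at the first of them. *)
Definition tok : finType := (L * option bool)%type.
Implicit Types (g : tok) (A B C D K P T U : seq tok).

Definition black (x : L) : tok := (x, Some true).
Definition grey (x : L) : tok := (x, Some false).
Definition white (x : L) : tok := (x, None).
Definition nw : pred tok := fun g => g.2 != None.
Definition bk : pred tok := fun g => g.2 == Some true.
Definition lt (s : seq tok) : seq L := map fst s.

(** Cancellation with an inverse letter anywhere in [w], not only at its end: this is reduction in
    Z^r instead of F. *)
Definition insl (w : seq L) (x : L) : seq L :=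
  if suff (predC1 (linv x)) w is _ :: s then pref (predC1 (linv x)) w ++ s else rcons w x.
Definition abn (w : seq L) : seq L := foldl insl [::] w.

(* A state is a word with two cuts, [rev A ++ rev B ++ C], together with the
   current distance [D] and the distances [K] still to be tried, in unary. *)
Definition next_cut C A B D K :=
  match C, rev B, K with
  | g :: C', _, _ => (true, (C', A, g :: B, D, K))
  | [::], g :: C', _ => (true, (C', g :: A, [::], D, K))
  | [::], [::], k :: K' => (true, (rev A, [::], [::], k :: D, K'))
  | [::], [::], [::] => (false, (rev A, [::], [::], D, [::]))
  end.

(* [alpha e B e^-1 c gamma], with [B] a loop, becomes
   [alpha c (c^-1 e) B (e^-1 c) gamma] where the parenthesised parts are white. *)
Definition split_out C A B (e : tok) : seq tok :=
  let c := pref nw C in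
  rev A ++ c ++ map white (winv (lt c)) ++ white e.1 :: rev B ++
  white (linv e.1) :: map white (lt c) ++ suff nw C.

(* The piece [s t] cut by the second cut is rotated to [t s] and inserted at the
   first cut, at both ends of a shortest path [P] and its inverse. *)
Definition merge_out C A B (P : seq L) : seq tok :=
  rev A ++ map grey P ++ pref nw C ++ rev (pref nw B) ++ map grey (winv P) ++
  rev (suff nw B) ++ suff nw C.

(** Both cuts must be vertices of pieces: the start of the word, which is the origin, or the end of
    a black letter. Ends of grey letters are excluded. *)
Definition mergeable A B :=
  (if A is g :: _ then bk g else true) && (if B is g :: _ then bk g else false).

Definition step C A B D K :=
  let P := abn (lt B) in
  if size P <= size D then
    if all nw B then
      if A is e :: A' then
        if [&& nilp D, bk e & ohead C == Some (black (linv e.1))] then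
          (true, (split_out (behead C) A' B e, [::], [::], D, K))
        else next_cut C A B D K
      else next_cut C A B D K
    else if mergeable A B then (true, (merge_out C A B P, [::], [::], D, K))
    else next_cut C A B D K
  else next_cut C A B D K.

(** Registers 0 to 4 hold the state, register 5 the path between the two cuts, and 6 and 7 are
    scratch space. *)
Definition regs (s : seq tok * seq tok * seq tok * seq tok * seq tok) P T U : seq (seq tok) :=
  let: (C, A, B, D, K) := s in [:: C; A; B; D; K; P; T; U].

Definition All k j := Xfer k (@predT tok) j id.
Definition Mv k j := OnTop k (@predT tok) (fun a => Seq (Pop tok k) (Push j a)) (Const tok false).
Definition Nonempty k := Test k (fun o : option tok => isSome o).

Definition Ins (x : L) :=
  Seq (Xfer 5 (fun g : tok => g.1 != linv x) 7 id)
    (Seq (If (Nonempty 5) (Pop tok 5) (Push 5 (grey x))) (All 7 5)).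

Definition Abn :=
  Seq (While (OnTop 2 (@predT tok)
        (fun g : tok => Seq (Pop tok 2) (Seq (Push 6 g) (Ins g.1))) (Const tok false)))
    (All 6 2).

Definition Cmp :=
  Seq (While (If (Nonempty 5)
        (If (Nonempty 3) (Seq (Mv 5 6) (Mv 3 7)) (Const tok false)) (Const tok false)))
    (If (Nonempty 5) (Seq (All 6 5) (Seq (All 7 3) (Const tok false)))
       (Seq (All 6 5) (Seq (All 7 3) (Const tok true)))).

Definition AllNw :=
  Seq (Xfer 2 nw 6 id)
    (If (Nonempty 2) (Seq (All 6 2) (Const tok false)) (Seq (All 6 2) (Const tok true))).

Definition Split (e : tok) :=
  Seq (Pop tok 1) (Seq (Pop tok 0) (Seq (Xfer 0 nw 6 id)
  (Seq (Xfer2 6 (@predT tok) 0 (fun g : tok => white g.1) 7 id)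
  (Seq (Push 0 (white (linv e.1))) (Seq (All 2 0) (Seq (Push 0 (white e.1))
  (Seq (Xfer2 7 (@predT tok) 0 (fun g : tok => white (linv g.1)) 6 id)
  (Seq (All 6 0) (Seq (All 1 0) (Const tok true)))))))))).

Definition Merge :=
  Seq (Xfer 2 nw 6 id) (Seq (Xfer 0 nw 7 id) (Seq (All 2 0) (Seq (All 6 2)
  (Seq (Xfer2 5 (@predT tok) 0 (fun g : tok => grey (linv g.1)) 6 id)
  (Seq (All 2 0) (Seq (All 7 0) (Seq (All 6 0) (Seq (All 1 0) (Const tok true))))))))).

Definition Clear k := While (If (Nonempty k) (Pop tok k) (Const tok false)).

Definition Next :=
  Seq (Clear 5) (If (Nonempty 0) (Mv 0 2)
    (Seq (All 2 0) (If (Nonempty 0) (Mv 0 1)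
      (Seq (All 1 0) (If (Nonempty 4) (Mv 4 3) (Const tok false)))))).

Definition Body :=
  Seq Abn (If Cmp
    (If AllNw
      (If (Test 3 (fun o : option tok => ~~ isSome o))
         (OnTop 1 bk (fun e => If (Test 0 (pred1 (Some (black (linv e.1))))) (Split e) Next) Next)
         Next)
      (If (Test 1 (fun o : option tok => if o is Some g then bk g else true))
        (If (Test 2 (fun o : option tok => if o is Some g then bk g else false)) Merge Next)
        Next))
    Next).

(** The copy of the input placed in register 4 is the unary counter of the distances 1, ..., |w|. *)
Definition Main :=
  Seq (All 0 6) (Seq (Xfer2 6 (@predT tok) 0 id 4 id) (While Body)).

(** * The program implements [step], with running times *)

Local Notation X n := (xcost tok n).

Lemma leq_xcost m n : m <= n -> X m <= X n.
Proof. by move=> h; rewrite /xcost leq_mul2r; apply/orP; right. Qed.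

Lemma runs_xferR R k (p : pred tok) j f : k < size R -> j < size R -> k != j ->
  runs (Xfer k p j f) R true
    (set_nth [::] (set_nth [::] R j (rev (map f (pref p (nth [::] R k))) ++ nth [::] R j))
       k (suff p (nth [::] R k)))
    (X (size (nth [::] R k))).
Proof.
move=> kR jR kj; have := runs_xfer p f (nth [::] R k) (nth [::] R j) kR jR kj.
by rewrite !put_id.
Qed.

Lemma runs_allR R k j : k < size R -> j < size R -> k != j ->
  runs (All k j) R true
    (set_nth [::] (set_nth [::] R j (rev (nth [::] R k) ++ nth [::] R j)) k [::])
    (X (size (nth [::] R k))).
Proof.
move=> kR jR kj; have := runs_xferR predT id kR jR kj.
by case: (@all_pref_id _ predT (nth [::] R k)) => [|-> ->]; rewrite ?all_predT ?map_id.
Qed.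

Lemma runs_xfer2R R k j f i h : k < size R -> j < size R -> i < size R ->
  k != j -> k != i -> j != i ->
  runs (Xfer2 k (@predT tok) j f i h) R true
    (set_nth [::] (set_nth [::] (set_nth [::] R i (rev (map h (nth [::] R k)) ++ nth [::] R i))
       j (rev (map f (nth [::] R k)) ++ nth [::] R j)) k [::])
    (X (size (nth [::] R k))).
Proof.
move=> kR jR iR kj ki ji.
have := runs_xfer2 predT f h (nth [::] R k) (nth [::] R j) (nth [::] R i) kR jR iR kj ki ji.
rewrite !put_id //.
by case: (@all_pref_id _ predT (nth [::] R k)) => [|-> ->]; rewrite ?all_predT.
Qed.

Lemma runs_mv R k j g x : k < size R -> j < size R -> k != j -> nth [::] R k = g :: x ->
  runs (Mv k j) R true
    (set_nth [::] (set_nth [::] R k x) j (g :: nth [::] R j)) (2 * gcard tok + 3).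
Proof.
move=> kR jR kj Rk; have jk : (j == k) = false by rewrite eq_sym (negPf kj).
have -> : set_nth [::] (set_nth [::] R k x) j (g :: nth [::] R j) = push j g (pop k R).
  by rewrite /push /pop Rk nth_put jk.
apply: runs_ontop Rk _ (runs_seq (runs_pop _) (runs_push _ _)) => //.
by rewrite /pop size_put.
Qed.

Lemma runs_ins x C A B D K (w : seq L) T :
  runs (Ins x) [:: C; A; B; D; K; map grey w; T; [::]] true
    [:: C; A; B; D; K; map grey (insl w x); T; [::]] (2 * X (size w) + 5).
Proof.
set R := [:: C; A; B; D; K; map grey w; T; [::]].
have r1 := @runs_xferR R 5 (fun g : tok => g.1 != linv x) 7 id isT isT isT.
rewrite /= pref_map suff_map map_id cats0 in r1.
set u := pref _ w in r1; set v := suff _ w in r1.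
have su : size u <= size w by apply: size_pref.
have r2 : runs (If (Nonempty 5) (Pop tok 5) (Push 5 (grey x)))
  [:: C; A; B; D; K; map grey v; T; rev (map grey u)] true
  [:: C; A; B; D; K; map grey (if v is _ :: s then s else [:: x]); T; rev (map grey u)] 3.
  apply: runs_if (runs_test _ _) _ => //=.
  by case: (v) => [|y s] /=; [apply: runs_push|apply: runs_pop].
have r3 := @runs_allR [:: C; A; B; D; K; map grey (if v is _ :: s then s else [:: x]); T; rev (map grey u)]
  7 5 isT isT isT.
rewrite /= revK -map_cat in r3.
have e : u ++ (if v is _ :: s then s else [:: x]) = insl w x.
  rewrite /insl -/u -/v; case: (v) (pref_suff (predC1 (linv x)) w : u ++ v = w) => //.
  by rewrite cats0 cats1 => ->.
rewrite e in r3; apply: runs_le (runs_seq r1 (runs_seq r2 r3)) _.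
by rewrite size_rev !size_map; have := leq_xcost su; slia.
Qed.

Lemma size_insl w x : size (insl w x) <= (size w).+1.
Proof.
have e := pref_suff (predC1 (linv x)) w; rewrite -[in leqRHS]e size_cat.
rewrite /insl; case E: (suff _ w) => [|y s] /=; last by rewrite size_cat; slia.
by rewrite size_rcons -[in leqLHS]e E cats0 addn0.
Qed.

Lemma size_foldl_insl w v : size (foldl insl w v) <= size w + size v.
Proof.
elim: v w => [|x v IH] w /=; first by rewrite addn0.
by apply: leq_trans (IH _) _; have := size_insl w x; slia.
Qed.

Lemma runs_abn C A B D K N : size B <= N ->
  runs Abn [:: C; A; B; D; K; [::]; [::]; [::]] true
    [:: C; A; B; D; K; map grey (abn (lt B)); [::]; [::]] (6 * (N.+1 * X N)).
Proof.
move=> sB.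
have main B' (w : seq L) T : size w + size B' <= N ->
  runs (While (OnTop 2 (@predT tok)
        (fun g : tok => Seq (Pop tok 2) (Seq (Push 6 g) (Ins g.1))) (Const tok false)))
    [:: C; A; B'; D; K; map grey w; T; [::]] true
    [:: C; A; [::]; D; K; map grey (foldl insl w (lt B')); rev B' ++ T; [::]]
    ((size B').+1 * (3 * X N)).
  elim: B' w T => [|g B' IH] w T sw.
    apply: (@runs_le _ (2 * gcard tok + 2)); first exact: runs_while_stop.
    by rewrite /xcost; nia.
  rewrite /= in sw.
  have swg := size_insl w g.1.
  have r1 : runs (Seq (Pop tok 2) (Seq (Push 6 g) (Ins g.1)))
     [:: C; A; g :: B'; D; K; map grey w; T; [::]] true
     [:: C; A; B'; D; K; map grey (insl w g.1); g :: T; [::]] (2 * X N + 9).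
    have rp := @runs_pop _ 2 [:: C; A; g :: B'; D; K; map grey w; T; [::]] isT.
    have rq := @runs_push _ 6 g [:: C; A; B'; D; K; map grey w; T; [::]] isT.
    apply: runs_le (runs_seq rp (runs_seq rq (runs_ins g.1 C A B' D K w (g :: T)))) _.
    by have : X (size w) <= X N by [apply: leq_xcost; slia]; slia.
  have sI : size (insl w g.1) + size B' <= N by slia.
  have r2 := IH (insl w g.1) (g :: T) sI; rewrite /= rev_cons cat_rcons.
  apply: runs_le (runs_while_loop _ _ _ r1 r2) _ => //.
  rewrite -[(size (g :: B')).+1]/((size B').+2) mulSn.
  by have: 2 * gcard tok + 10 <= X N by [rewrite /xcost; nia]; slia.
have := main B [::] [::] sB; rewrite cats0 => r1.
have := @runs_allR [:: C; A; [::]; D; K; map grey (abn (lt B)); rev B; [::]] 6 2 isT isT isT.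
rewrite /= revK cats0 size_rev => r2; apply: runs_le (runs_seq r1 r2) _.
have := leq_xcost sB; have: (size B).+1 * X N <= N.+1 * X N by rewrite leq_mul2r ltnS sB orbT.
have: 10 <= X N by rewrite /xcost; nia.
have: X N <= N.+1 * X N by rewrite leq_pmull.
by rewrite (mulnCA (size B).+1); slia.
Qed.

Lemma runs_nonempty k (R : seq (seq tok)) : k < size R ->
  runs (Nonempty k) R (~~ nilp (nth [::] R k)) R 1.
Proof.
move=> kR; have -> : ~~ nilp (nth [::] R k) = isSome (ohead (nth [::] R k)).
  by case: (nth _ _ _).
exact: runs_test.
Qed.

Lemma runs_cmp C A B D K P N : size P <= N -> size D <= N ->
  runs Cmp [:: C; A; B; D; K; P; [::]; [::]] (size P <= size D)
    [:: C; A; B; D; K; P; [::]; [::]] (8 * X N).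
Proof.
move=> sP sD.
have main P' D' T U :
  runs (While (If (Nonempty 5)
        (If (Nonempty 3) (Seq (Mv 5 6) (Mv 3 7)) (Const tok false)) (Const tok false)))
    [:: C; A; B; D'; K; P'; T; U] true
    [:: C; A; B; drop (size P') D'; K; drop (size D') P';
        rev (take (size D') P') ++ T; rev (take (size P') D') ++ U]
    ((size P').+1 * (4 * gcard tok + 20)).
  elim: P' D' T U => [|p P' IH] [|d D'] T U.
  - have r1 := @runs_nonempty 5 [:: C; A; B; [::]; K; [::]; T; U] isT.
    by apply: runs_le (runs_stop (runs_if r1 (runs_const _ _))) _; lia.
  - have r1 := @runs_nonempty 5 [:: C; A; B; d :: D'; K; [::]; T; U] isT.
    by apply: runs_le (runs_stop (runs_if r1 (runs_const _ _))) _; lia.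
  - have r1 := @runs_nonempty 5 [:: C; A; B; [::]; K; p :: P'; T; U] isT.
    have r2 := @runs_nonempty 3 [:: C; A; B; [::]; K; p :: P'; T; U] isT.
    apply: runs_le (runs_stop (runs_if r1 (runs_if r2 (runs_const _ _)))) _.
    by rewrite mulSn; lia.
  - have r1 := @runs_nonempty 5 [:: C; A; B; d :: D'; K; p :: P'; T; U] isT.
    have r2 := @runs_nonempty 3 [:: C; A; B; d :: D'; K; p :: P'; T; U] isT.
    have r3 := @runs_mv [:: C; A; B; d :: D'; K; p :: P'; T; U] 5 6 p P' isT isT isT erefl.
    have r4 := @runs_mv [:: C; A; B; d :: D'; K; P'; p :: T; U] 3 7 d D' isT isT isT erefl.
    have r5 := IH D' (p :: T) (d :: U).
    rewrite /= !rev_cons !cat_rcons.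
    apply: runs_le (runs_loop (runs_if r1 (runs_if r2 (runs_seq r3 r4))) r5) _.
    by rewrite [leqRHS]mulSn; slia.
have r1 := main P D [::] [::]; rewrite !cats0 in r1.
set D1 := drop (size P) D in r1; set P1 := drop (size D) P in r1.
set T1 := rev _ in r1; set U1 := rev _ in r1.
have r2 := @runs_nonempty 5 [:: C; A; B; D1; K; P1; T1; U1] isT.
have r3 := @runs_allR [:: C; A; B; D1; K; P1; T1; U1] 6 5 isT isT isT.
rewrite /= revK cat_take_drop in r3.
have r4 := @runs_allR [:: C; A; B; D1; K; P; [::]; U1] 7 3 isT isT isT.
rewrite /= revK cat_take_drop in r4.
have s6 : size T1 <= N.
  by rewrite size_rev; apply: leq_trans sP; rewrite size_take_min geq_minr.
have s7 : size U1 <= N.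
  by rewrite size_rev; apply: leq_trans sD; rewrite size_take_min geq_minr.
have -> : (size P <= size D) = nilp P1.
  by rewrite /nilp size_drop subn_eq0.
have rr := runs_seq r3 (runs_seq r4 (runs_const (nilp P1) _)).
have := leq_xcost s6; have := leq_xcost s7.
have: (size P).+1 * (4 * gcard tok + 20) <= 2 * X N.
  by rewrite /xcost mulnCA leq_mul //; lia.
have: 10 <= X N by rewrite /xcost; nia.
rewrite /= in r2; move: r2 rr; case: (nilp P1) => /= r2 rr X10 W10 X6 X7;
  by apply: runs_le (runs_seq r1 (runs_if r2 rr)) _; slia.
Qed.

Lemma runs_allnw C A B D K P N : size B <= N ->
  runs AllNw [:: C; A; B; D; K; P; [::]; [::]] (all nw B)
    [:: C; A; B; D; K; P; [::]; [::]] (4 * X N).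
Proof.
move=> sB; have r1 := @runs_xferR [:: C; A; B; D; K; P; [::]; [::]] 2 nw 6 id isT isT isT.
rewrite /= map_id cats0 in r1.
have r2 := @runs_nonempty 2 [:: C; A; suff nw B; D; K; P; rev (pref nw B); [::]] isT.
have r3 := @runs_allR [:: C; A; suff nw B; D; K; P; rev (pref nw B); [::]] 6 2 isT isT isT.
rewrite /= revK pref_suff in r3.
have -> : all nw B = nilp (suff nw B).
  case E: (suff nw B) => [|g s]; last by have [_ /negPf] := suff_head E.
  by rewrite -(pref_suff nw B) E cats0 all_pref.
have rr := runs_seq r3 (runs_const (nilp (suff nw B)) _).
have := leq_xcost sB; have: size (rev (pref nw B)) <= N.
  by rewrite size_rev; apply: leq_trans sB; apply: size_pref.
move=> /leq_xcost; have: 10 <= X N by rewrite /xcost; nia.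
rewrite /= in r2; move: r2 rr; case: (nilp _) => /= r2 rr X10 X6 X7;
  by apply: runs_le (runs_seq r1 (runs_if r2 rr)) _; slia.
Qed.

Lemma runs_split C A B D K e e' N :
  size A <= N -> size B <= N -> size C <= N ->
  runs (Split e) [:: e' :: C; e :: A; B; D; K; [::]; [::]; [::]] true
    [:: split_out C A B e; [::]; [::]; D; K; [::]; [::]; [::]] (8 * X N).
Proof.
move=> sA sB sC.
have r1 := @runs_pop _ 1 [:: e' :: C; e :: A; B; D; K; [::]; [::]; [::]] isT.
have r2 := @runs_pop _ 0 [:: e' :: C; A; B; D; K; [::]; [::]; [::]] isT.
have r3 := @runs_xferR [:: C; A; B; D; K; [::]; [::]; [::]] 0 nw 6 id isT isT isT.
rewrite /= map_id cats0 in r3; set c := pref nw C in r3; set C1 := suff nw C in r3.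
have r4 := @runs_xfer2R [:: C1; A; B; D; K; [::]; rev c; [::]] 6 0
  (fun g : tok => white g.1) 7 id isT isT isT isT isT isT.
rewrite /= map_id cats0 map_rev !revK in r4.
set C2 := _ ++ C1 in r4.
have r5 := @runs_push _ 0 (white (linv e.1)) [:: C2; A; B; D; K; [::]; [::]; c] isT.
have r6 := @runs_allR [:: white (linv e.1) :: C2; A; B; D; K; [::]; [::]; c] 2 0 isT isT isT.
rewrite /= in r6; set C3 := rev B ++ _ in r6.
have r7 := @runs_push _ 0 (white e.1) [:: C3; A; [::]; D; K; [::]; [::]; c] isT.
have r8 := @runs_xfer2R [:: white e.1 :: C3; A; [::]; D; K; [::]; [::]; c] 7 0
  (fun g : tok => white (linv g.1)) 6 id isT isT isT isT isT isT.
rewrite /= map_id cats0 in r8; set C4 := _ ++ white e.1 :: C3 in r8.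
have r9 := @runs_allR [:: C4; A; [::]; D; K; [::]; rev c; [::]] 6 0 isT isT isT.
rewrite /= revK in r9.
have r10 := @runs_allR [:: c ++ C4; A; [::]; D; K; [::]; [::]; [::]] 1 0 isT isT isT.
rewrite /= in r10.
have -> : split_out C A B e = rev A ++ c ++ C4.
  by rewrite /split_out -/c -/C1 /C4 /C3 /C2 /lt /winv map_rev -!map_comp.
apply: runs_le (runs_seq r1 (runs_seq r2 (runs_seq r3 (runs_seq r4 (runs_seq r5 (runs_seq r6
  (runs_seq r7 (runs_seq r8 (runs_seq r9 (runs_seq r10 (runs_const _ _))))))))))) _.
have sc : size c <= N by apply: leq_trans sC; apply: size_pref.
have := leq_xcost sA; have := leq_xcost sB; have := leq_xcost sC; have := leq_xcost sc.
have: 10 <= X N by rewrite /xcost; nia.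
rewrite !size_rev; slia.
Qed.

Lemma runs_merge C A B D K (P : seq L) N :
  size A <= N -> size B <= N -> size C <= N -> size P <= N ->
  runs Merge [:: C; A; B; D; K; map grey P; [::]; [::]] true
    [:: merge_out C A B P; [::]; [::]; D; K; [::]; [::]; [::]] (11 * X N).
Proof.
move=> sA sB sC sP.
have r1 := @runs_xferR [:: C; A; B; D; K; map grey P; [::]; [::]] 2 nw 6 id isT isT isT.
rewrite /= map_id cats0 in r1; set s := pref nw B in r1; set B1 := suff nw B in r1.
have r2 := @runs_xferR [:: C; A; B1; D; K; map grey P; rev s; [::]] 0 nw 7 id isT isT isT.
rewrite /= map_id cats0 in r2; set t := pref nw C in r2; set C1 := suff nw C in r2.
have r3 := @runs_allR [:: C1; A; B1; D; K; map grey P; rev s; rev t] 2 0 isT isT isT.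
rewrite /= in r3.
have r4 := @runs_allR [:: rev B1 ++ C1; A; [::]; D; K; map grey P; rev s; rev t] 6 2 isT isT isT.
rewrite /= cats0 revK in r4.
have r5 := @runs_xfer2R [:: rev B1 ++ C1; A; s; D; K; map grey P; [::]; rev t] 5 0
  (fun g : tok => grey (linv g.1)) 6 id isT isT isT isT isT isT.
rewrite /= map_id cats0 in r5; set C2 := _ ++ rev B1 ++ C1 in r5.
have r6 := @runs_allR [:: C2; A; s; D; K; [::]; rev (map grey P); rev t] 2 0 isT isT isT.
rewrite /= in r6.
have r7 := @runs_allR [:: rev s ++ C2; A; [::]; D; K; [::]; rev (map grey P); rev t] 7 0 isT isT isT.
rewrite /= revK in r7.
have r8 := @runs_allR [:: t ++ rev s ++ C2; A; [::]; D; K; [::]; rev (map grey P); [::]] 6 0 isT isT isT.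
rewrite /= revK in r8.
have r9 := @runs_allR [:: map grey P ++ t ++ rev s ++ C2; A; [::]; D; K; [::]; [::]; [::]] 1 0 isT isT isT.
rewrite /= in r9.
have -> : merge_out C A B P = rev A ++ map grey P ++ t ++ rev s ++ C2.
  by rewrite /merge_out -/t -/s -/C1 -/B1 /C2 /winv map_rev -!map_comp.
apply: runs_le (runs_seq r1 (runs_seq r2 (runs_seq r3 (runs_seq r4 (runs_seq r5 (runs_seq r6
  (runs_seq r7 (runs_seq r8 (runs_seq r9 (runs_const _ _)))))))))) _.
have ss : size s <= N by apply: leq_trans sB; apply: size_pref.
have st : size t <= N by apply: leq_trans sC; apply: size_pref.
have sB1 : size B1 <= N by apply: leq_trans sB; apply: size_suff.
have := leq_xcost sA; have := leq_xcost sB; have := leq_xcost sC; have := leq_xcost sP.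
have := leq_xcost ss; have := leq_xcost st; have := leq_xcost sB1.
have: 10 <= X N by rewrite /xcost; nia.
rewrite !size_rev !size_map; slia.
Qed.

Lemma runs_clear C A B D K P N : size P <= N ->
  runs (Clear 5) [:: C; A; B; D; K; P; [::]; [::]] true
    [:: C; A; B; D; K; [::]; [::]; [::]] (X N).
Proof.
move=> sP; apply: runs_le (leq_xcost sP).
elim: P {sP} => [|p P IH].
  have r1 := @runs_nonempty 5 [:: C; A; B; D; K; [::]; [::]; [::]] isT.
  by apply: runs_le (runs_stop (runs_if r1 (runs_const _ _))) _; rewrite /xcost /=; lia.
have r1 := @runs_nonempty 5 [:: C; A; B; D; K; p :: P; [::]; [::]] isT.
have r2 := @runs_pop _ 5 [:: C; A; B; D; K; p :: P; [::]; [::]] isT.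
by apply: runs_le (runs_loop (runs_if r1 r2) IH) _; rewrite /xcost /=; lia.
Qed.

Lemma runs_next C A B D K P N : size P <= N -> size A <= N -> size B <= N ->
  runs Next [:: C; A; B; D; K; P; [::]; [::]] (next_cut C A B D K).1
    (regs (next_cut C A B D K).2 [::] [::] [::]) (5 * X N).
Proof.
move=> sP sA sB; have r1 := runs_clear C A B D K sP.
have XN : 2 * gcard tok + 10 <= X N by rewrite /xcost; nia.
have XA := leq_xcost sA; have XB := leq_xcost sB.
have r2 := @runs_nonempty 0 [:: C; A; B; D; K; [::]; [::]; [::]] isT.
case: C r1 r2 => [|g C'] r1 r2; last first.
  have r3 := @runs_mv [:: g :: C'; A; B; D; K; [::]; [::]; [::]] 0 2 g C' isT isT isT erefl.
  by apply: runs_le (runs_seq r1 (runs_if r2 r3)) _; lia.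
have r3 := @runs_allR [:: [::]; A; B; D; K; [::]; [::]; [::]] 2 0 isT isT isT.
rewrite /= cats0 in r3.
have r4 := @runs_nonempty 0 [:: rev B; A; [::]; D; K; [::]; [::]; [::]] isT.
rewrite /next_cut; case: (rev B) r3 r4 => [|g C'] r3 r4; last first.
  have r5 := @runs_mv [:: g :: C'; A; [::]; D; K; [::]; [::]; [::]] 0 1 g C' isT isT isT erefl.
  by apply: runs_le (runs_seq r1 (runs_if r2 (runs_seq r3 (runs_if r4 r5)))) _; slia.
have r5 := @runs_allR [:: [::]; A; [::]; D; K; [::]; [::]; [::]] 1 0 isT isT isT.
rewrite /= cats0 in r5.
have r6 := @runs_nonempty 4 [:: rev A; [::]; [::]; D; K; [::]; [::]; [::]] isT.
case: K r1 r2 r3 r4 r5 r6 => [|k K'] r1 r2 r3 r4 r5 r6.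
  apply: runs_le (runs_seq r1 (runs_if r2 (runs_seq r3 (runs_if r4 (runs_seq r5
    (runs_if r6 (runs_const _ _))))))) _.
  by slia.
have r7 := @runs_mv [:: rev A; [::]; [::]; D; k :: K'; [::]; [::]; [::]] 4 3 k K' isT isT isT erefl.
apply: runs_le (runs_seq r1 (runs_if r2 (runs_seq r3 (runs_if r4 (runs_seq r5 (runs_if r6 r7)))))) _.
by slia.
Qed.

Definition state := (seq tok * seq tok * seq tok * seq tok * seq tok)%type.
Definition step_state (s : state) : bool * state :=
  let: (C, A, B, D, K) := s in step C A B D K.
Definition clean (s : state) := regs s [::] [::] [::].
(** [K] is left out: the loop only pops it, so its length does not enter the cost of a round. *)
Definition fits N (s : state) := all (fun x => size x <= N) (take 4 (clean s)).

Lemma runs_body s N : fits N s ->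
  runs Body (clean s) (step_state s).1 (clean (step_state s).2) (40 * (N.+1 * X N)).
Proof.
case: s => [[[[C A] B] D] K]; rewrite /fits /= => /and5P[sC sA sB sD _].
have r1 := runs_abn C A D K sB; set P := abn (lt B) in r1 *.
have sP : size P <= N.
  have := size_foldl_insl [::] (lt B); rewrite -/(abn (lt B)) size_map add0n => sP.
  exact: leq_trans sP sB.
have sgP : size (map grey P) <= N by rewrite size_map.
have r2 := runs_cmp C A B K sgP sD; rewrite size_map in r2.
have r3 := runs_allnw C A D K (map grey P) sB.
have rN := runs_next C D K sgP sA sB.
have XN : X N <= N.+1 * X N by rewrite leq_pmull.
have X10 : 2 * gcard tok + 10 <= X N by rewrite /xcost; nia.
rewrite /clean /step_state /step -/P; case: ifP r2 => lePD r2; last first.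
  by apply: runs_le (runs_seq r1 (runs_if r2 rN)) _; lia.
case: ifP r3 => nwB r3; last first.
  have r4 := @runs_test _ 1 (fun o : option tok => if o is Some g then bk g else true)
    [:: C; A; B; D; K; map grey P; [::]; [::]] isT.
  have r5 := @runs_test _ 2 (fun o : option tok => if o is Some g then bk g else false)
    [:: C; A; B; D; K; map grey P; [::]; [::]] isT.
  have eAB : mergeable A B = (if ohead A is Some g then bk g else true) &&
    (if ohead B is Some g then bk g else false) by rewrite /mergeable; case: (A); case: (B).
  rewrite eAB; rewrite /= in r4 r5; move: r4 r5.
  case: (if ohead A is Some g then bk g else true) => /= r4 r5; last first.
    by apply: runs_le (runs_seq r1 (runs_if r2 (runs_if r3 (runs_if r4 rN)))) _; lia.
  move: r5; case: (if ohead B is Some g then bk g else false) => /= r5; last first.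
    by apply: runs_le (runs_seq r1 (runs_if r2 (runs_if r3 (runs_if r4 (runs_if r5 rN))))) _; lia.
  have r6 := runs_merge D K sA sB sC sP.
  by apply: runs_le (runs_seq r1 (runs_if r2 (runs_if r3 (runs_if r4 (runs_if r5 r6))))) _; lia.
have r4 := @runs_test _ 3 (fun o : option tok => ~~ isSome o)
    [:: C; A; B; D; K; map grey P; [::]; [::]] isT.
have eD : ~~ isSome (ohead D) = nilp D by case: (D).
rewrite /= eD in r4.
case: (boolP (nilp D)) r4 => [D0|D0] r4; last first.
  have -> : (if A is e :: A' then
      if [&& false, bk e & ohead C == Some (black (linv e.1))]
      then (true, (split_out (behead C) A' B e, [::], [::], D, K)) else next_cut C A B D K
    else next_cut C A B D K) = next_cut C A B D K by case: (A).
  by apply: runs_le (runs_seq r1 (runs_if r2 (runs_if r3 (runs_if r4 rN)))) _; lia.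
(* At distance 0 the path is empty, so register 5 is already clear, as [Split] leaves it. *)
have P0 : P = [::].
  by apply/nilP; rewrite /nilp -leqn0; apply: leq_trans lePD _; rewrite leqn0.
case: A {eD} sA r1 r2 r3 r4 rN => [|e A] sA r1 r2 r3 r4 rN.
  have r5 := @runs_ontop_else _ 1 bk (fun e => If (Test 0 (pred1 (Some (black (linv e.1)))))
     (Split e) Next) Next [:: C; [::]; B; D; K; map grey P; [::]; [::]] _ _ _ isT isT rN.
  by apply: runs_le (runs_seq r1 (runs_if r2 (runs_if r3 (runs_if r4 r5)))) _; lia.
case: (boolP (bk e)) => be; last first.
  have r5 := @runs_ontop_else _ 1 bk (fun e => If (Test 0 (pred1 (Some (black (linv e.1)))))
     (Split e) Next) Next [:: C; e :: A; B; D; K; map grey P; [::]; [::]] _ _ _ isT be rN.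
  by apply: runs_le (runs_seq r1 (runs_if r2 (runs_if r3 (runs_if r4 r5)))) _; lia.
have r5 := @runs_test _ 0 (pred1 (Some (black (linv e.1))))
    [:: C; e :: A; B; D; K; map grey P; [::]; [::]] isT.
rewrite /= in r5.
case hC: (ohead C == _) r5 => /= r5; last first.
  have r6 := @runs_ontop _ 1 bk (fun e => If (Test 0 (pred1 (Some (black (linv e.1)))))
     (Split e) Next) Next [:: C; e :: A; B; D; K; map grey P; [::]; [::]] e A _ _ _ isT erefl be
     (runs_if r5 rN).
  by apply: runs_le (runs_seq r1 (runs_if r2 (runs_if r3 (runs_if r4 r6)))) _; lia.
case: C sC hC {rN} r1 r2 r3 r4 r5 => [|e' C] // sC _ r1 r2 r3 r4 r5.
rewrite P0 /= in r1 r2 r3 r4 r5.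
have r7 := @runs_split C A B D K e e' N (ltnW sA) sB (ltnW sC).
have r6 := @runs_ontop _ 1 bk (fun e => If (Test 0 (pred1 (Some (black (linv e.1)))))
     (Split e) Next) Next [:: e' :: C; e :: A; B; D; K; [::]; [::]; [::]] e A _ _ _ isT erefl be
     (runs_if r5 r7).
by apply: runs_le (runs_seq r1 (runs_if r2 (runs_if r3 (runs_if r4 r6)))) _; lia.
Qed.

(** Separates running time from correctness: an invariant that bounds the registers and a decreasing
    measure are all that is asked of the algorithm. *)
Lemma runs_main_loop (Inv Fin : state -> Prop) (mu : state -> nat) N :
  (forall s, Inv s -> fits N s) ->
  (forall s, Inv s -> (step_state s).1 ->
     Inv (step_state s).2 /\ mu (step_state s).2 < mu s) ->
  (forall s, Inv s -> ~~ (step_state s).1 -> Fin (step_state s).2) ->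
  forall s, Inv s -> exists2 s', Fin s' &
    runs (While Body) (clean s) true (clean s') ((mu s).+1 * (40 * (N.+1 * X N)).+1).
Proof.
move=> fit stepI stopF s; have [m] := ubnP (mu s); elim: m s => // m IH s lt_mu Is.
have := runs_body (fit s Is); have := stepI s Is; have := stopF s Is.
case E: (step_state s) => [[] s'] /= => [_ /(_ isT)[Is' mus]|/(_ isT) Fs' _] r1; last first.
  by exists s' => //; apply: runs_le (runs_stop r1) _; rewrite leq_pmull.
have [|s2 F2 r2] := IH s' _ Is'; first by lia.
exists s2 => //; apply: runs_le (runs_loop r1 r2) _.
rewrite -addSn addnC -mulSnr leq_mul2r; apply/orP; right; lia.
Qed.

Lemma runs_main (Inv Fin : state -> Prop) (mu : state -> nat) N (w : seq tok) :
  size w <= N -> Inv (w, [::], [::], [::], w) ->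
  (forall s, Inv s -> fits N s) ->
  (forall s, Inv s -> (step_state s).1 ->
     Inv (step_state s).2 /\ mu (step_state s).2 < mu s) ->
  (forall s, Inv s -> ~~ (step_state s).1 -> Fin (step_state s).2) ->
  exists2 s', Fin s' & runs Main (w :: nseq 7 [::]) true (clean s')
    ((mu (w, [::], [::], [::], w)).+2 * (42 * (N.+1 * X N))).
Proof.
move=> sw Iw fit stepI stopF.
have [s' F r3] := runs_main_loop fit stepI stopF Iw; exists s' => //.
have r1 := @runs_allR (w :: nseq 7 [::]) 0 6 isT isT isT.
rewrite /= cats0 in r1.
have r2 := @runs_xfer2R [:: [::]; [::]; [::]; [::]; [::]; [::]; rev w; [::]] 6 0 id 4 id
  isT isT isT isT isT isT.
rewrite /= !cats0 !map_id !revK in r2.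
apply: runs_le (runs_seq r1 (runs_seq r2 r3)) _.
rewrite size_rev; have := leq_xcost sw.
have XN : X N <= N.+1 * X N by rewrite leq_pmull.
have X10 : 2 * gcard tok + 10 <= X N by rewrite /xcost; nia.
set m := mu _; set Y := N.+1 * X N in XN *; move: (X (size w)) => Z.
rewrite (mulSn m.+1); have: m.+1 * (40 * Y).+1 <= m.+1 * (42 * Y) by rewrite leq_mul2l; lia.
lia.
Qed.

End Algorithm.

(** * Joining vertex sets at small cost *)

Section Metric.
Variable r : nat.
Local Notation L := (letter r).
Local Notation vertex := (vertex r).
Local Notation edge := (edge r).
Local Open Scope ring_scope.
Implicit Types (x y z : vertex) (u v w : seq L) (U X Y : seq vertex) (l : seq (seq vertex)).

Definition nrm x : nat := (\sum_(i < r) `|x i|)%N.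
Definition dist x y := nrm (y - x).

Lemma nrmD x y : (nrm (x + y)%R <= nrm x + nrm y)%N.
Proof. by rewrite /nrm -big_split leq_sum // => i _; rewrite !ffunE /=; lia. Qed.

Lemma nrmN x : nrm (- x) = nrm x.
Proof. by apply: eq_bigr => i _; rewrite ffunE abszN. Qed.

Lemma nrm_dl (a : L) : nrm (dl a) = 1%N.
Proof.
rewrite /nrm (bigD1 a.1) //= big1 => [|i ne]; last by rewrite ffunE (negPf ne).
by rewrite ffunE eqxx; case: (a.2).
Qed.

Lemma distxx x : dist x x = 0%N.
Proof. by rewrite /dist subrr /nrm big1 // => i _; rewrite ffunE. Qed.

Lemma dist_sym x y : dist x y = dist y x.
Proof. by rewrite /dist -opprB nrmN. Qed.

Lemma dist_step z x (a : L) : (dist z (x + dl a)%R <= (dist z x).+1)%N.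
Proof. by rewrite /dist addrAC; apply: leq_trans (nrmD _ _) _; rewrite nrm_dl addn1. Qed.

Lemma insl_mem w (a : L) :
  if linv a \in w then exists w1 w2, w = w1 ++ linv a :: w2 /\ insl w a = w1 ++ w2
  else insl w a = rcons w a.
Proof.
have := pref_suff (predC1 (linv a)) w; have := all_pref (predC1 (linv a)) w.
rewrite /insl; case E: (suff _ w) => [|b s].
  rewrite cats0 => h e; rewrite e in h; case: ifP => // /(allP h).
  by rewrite /= eqxx.
have [/=] := suff_head E; rewrite negbK => /eqP -> _ _ e; rewrite -{1}e mem_cat inE eqxx orbT.
by exists (pref (predC1 (linv a)) w), s; rewrite e.
Qed.

Definition nopp w := forall a, a \in w -> linv a \notin w.

Lemma nopp_insl w a : nopp w -> nopp (insl w a).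
Proof.
move=> nw; have := insl_mem w a; case: ifPn => [_ [w1 [w2 [e ->]]] b bw|na -> b].
  have sub c : c \in w1 ++ w2 -> c \in w.
    by rewrite e !mem_cat inE => /orP[] ->; rewrite ?orbT.
  by apply: contra (nw _ (sub _ bw)); apply: sub.
rewrite !mem_rcons !inE negb_or => /predU1P[->|bw].
  by rewrite linv_neq.
rewrite nw // andbT; apply: contra na => /eqP <-; by rewrite linvK.
Qed.

Lemma disp_insl w a : disp (insl w a) = disp w + dl a.
Proof.
have := insl_mem w a; case: ifPn => [_ [w1 [w2 [-> ->]]]|_ ->].
  by rewrite !disp_cat disp_cons dl_linv -[RHS]addrA (addrAC (- dl a)) addNr add0r.
by rewrite -cats1 disp_cat disp_cons disp_nil addr0.
Qed.

Lemma abn_spec w : nopp (abn w) /\ disp (abn w) = disp w.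
Proof.
suff: forall w0, nopp w0 -> nopp (foldl (@insl r) w0 w) /\ disp (foldl (@insl r) w0 w) = disp w0 + disp w.
  by case/(_ [::]) => // n1 d1; split=> //; rewrite d1 disp_nil add0r.
elim: w => [|a w IH] w0 n0 /=; first by rewrite disp_nil addr0.
have [n1 ->] := IH _ (nopp_insl (a := a) n0); split=> //.
by rewrite disp_insl disp_cons addrA.
Qed.

Lemma disp_abn w : disp (abn w) = disp w.
Proof. by have [] := abn_spec w. Qed.

Lemma size_count_letters w :
  size w = (\sum_(i < r) (count_mem (i, false) w + count_mem (i, true) w))%N.
Proof.
elim: w => [|[j b] w IH] /=; first by rewrite big1.
rewrite (eq_bigr (fun i => ((j == i) + (count_mem (i, false) w + count_mem (i, true) w)))%N).
  rewrite big_split /= -IH (bigD1 j) //= eqxx big1 // => i ne.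
  by rewrite eq_sym (negPf ne).
by move=> i _; rewrite !xpair_eqE; case: b; case: (j == i) ; rewrite /= ?add0n ?add1n ?addSn ?addnS.
Qed.

(** Without opposite letters each coordinate is covered in one direction only, so [abn] produces a
    shortest path of Z^r. *)
Lemma nrm_nopp w : nopp w -> nrm (disp w) = size w.
Proof.
move=> nw; rewrite size_count_letters; apply: eq_bigr => i _; rewrite disp_coord.
have := nw (i, false); rewrite /linv /= -!has_pred1 !has_count; set a := count _ _; set b := count _ _; lia.
Qed.

Lemma size_abn w : size (abn w) = nrm (disp w).
Proof. by have [n1 <-] := abn_spec w; rewrite nrm_nopp. Qed.

(* Sets [X_1, ..., X_k] are joined to [U] one after the other, each at its
   distance from what is already there; [q] bounds the total cost. *)
Fixpoint chain U l q : Prop :=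
  if l is X :: l' then exists x y q', [/\ x \in U, y \in X, (dist x y + q' <= q)%N &
     chain (U ++ X) l' q']
  else True.

Definition sep d X Y := all (fun x => all (fun y => (d <= dist x y)%N) Y) X.

Lemma sepP d X Y :
  reflect (forall x y, x \in X -> y \in Y -> (d <= dist x y)%N) (sep d X Y).
Proof.
apply: (iffP allP) => [h x y xX yY|h x xX]; first exact: (allP (h x xX)).
by apply/allP => y; apply: h.
Qed.

Lemma sep_sym d X Y : sep d X Y = sep d Y X.
Proof.
by apply/sepP/sepP => h x y xX yY; rewrite dist_sym; apply: h.
Qed.

Lemma sep_eql d X X' Y : X =i X' -> sep d X Y = sep d X' Y.
Proof. by move=> e; apply: eq_all_r. Qed.

Lemma chain_mono U U' l q : {subset U <= U'} -> chain U l q -> chain U' l q.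
Proof.
elim: l U U' q => //= X l IH U U' q sub [x [y [q' [xU yX le c]]]].
exists x, y, q'; split=> //; first exact: sub.
apply: IH c => z; rewrite !mem_cat => /orP[/sub ->|->] //; exact: orbT.
Qed.

(** [Y] was joined to [U] or to a set of [l1], all at distance at least [d] from it. With its
    vertices available from the start that connection is saved, and the later ones remain
    possible. *)
Lemma chain_remove d U U2 l1 Y l2 q :
  sep d U Y -> all (fun X => sep d X Y) l1 ->
  {subset U <= U2} -> {subset Y <= U2} ->
  chain U (l1 ++ Y :: l2) q -> exists2 q', (q' + d <= q)%N & chain U2 (l1 ++ l2) q'.
Proof.
elim: l1 U U2 q => [|X l1 IH] U U2 q /= sUY.
  move=> _ sub subY [x [y [q' [xU yY le c]]]]; exists q'.
    by have /sepP/(_ _ _ xU yY) := sUY; lia.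
  by apply: chain_mono c => z; rewrite mem_cat => /orP[/sub|/subY].
case/andP=> sXY sl1 sub subY [x [y [q' [xU yX le c]]]].
have [|||q2 le2 c2] := IH (U ++ X) (U2 ++ X) q' _ sl1 _ _ c.
- by rewrite /sep all_cat; apply/andP.
- by move=> z; rewrite !mem_cat => /orP[/sub ->|->] //; apply: orbT.
- by move=> z /subY zU; rewrite mem_cat zU.
exists (dist x y + q2)%N; first by lia.
by exists x, y, q2; split=> //; apply: sub.
Qed.

(* Whichever of the two merged sets was joined last no longer has to be joined,
   and that connection had cost at least [d]. *)
Lemma chain_merge d U l1 X l2 Y l3 Z q :
  all (fun X => sep d X Y) (U :: l1 ++ X :: l2) ->
  {subset X <= Z} -> {subset Y <= Z} ->
  chain U (l1 ++ X :: l2 ++ Y :: l3) q ->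
  exists2 q', (q' + d <= q)%N & chain U (l1 ++ Z :: l2 ++ l3) q'.
Proof.
elim: l1 U q => [|W l1 IH] U q /=.
  case/and3P=> sUY sXY sl2 subX subY [x [y [q' [xU yX le c]]]].
  have [|||q2 le2 c2] := @chain_remove d (U ++ X) (U ++ Z) l2 Y l3 q' _ sl2 _ _ c.
  - by rewrite /sep all_cat; apply/andP.
  - by move=> z; rewrite !mem_cat => /orP[->|/subX ->] //; apply: orbT.
  - by move=> z /subY zU; rewrite mem_cat zU orbT.
  exists (dist x y + q2)%N; first by lia.
  by exists x, y, q2; split=> //; apply: subX.
case/and3P=> sUY sWY sl subX subY [x [y [q' [xU yW le c]]]].
have [|q2 le2 c2] := IH (U ++ W) q' _ subX subY c.
  by rewrite /= sl andbT /sep all_cat; apply/andP.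
exists (dist x y + q2)%N; first by lia.
by exists x, y, q2.
Qed.

(* A walk visits the sets of [R] in some order; before it enters a new set, the
   steps made since it last left a visited one do not use edges of [E]. *)
Lemma chain_walk (E : seq edge) (All : seq (seq vertex)) v x U (R : seq (seq vertex)) z k :
  (forall e, e \in E -> exists2 X, X \in All & (e.1 \in X) && (e.1 + dl e.2 \in X)) ->
  (forall X, X \in All -> X \in R \/ {subset X <= U}) ->
  z \in U -> (dist z x <= k)%N ->
  exists s t q, [/\ perm_eq (s ++ t) R, chain U s q,
    (q <= k + count (predC (mem E)) (edges x v))%N &
    forall X, X \in t -> x \notin X /\ forall e, e \in edges x v -> e.1 + dl e.2 \notin X].
Proof.
move=> hE; have [n] := ubnP (size v + size R)%N.
elim: n v x U R z k => // n IH v x U R z k lt_n hA zU dzx.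
have [/hasP[X XR xX]|noR] := boolP (has (fun X : seq vertex => x \in X) R).
  (* The walk stands in the new set [X]: joining it costs [dist z x], at most [k], and the count
     restarts with [x] as the visited vertex. *)
  have pR : perm_eq R (X :: rem X R) by apply: perm_to_rem.
  have [||||s [t [q [p1 c1 q1 t1]]]] := IH v x (U ++ X) (rem X R) x 0%N.
  - by move: lt_n; rewrite (perm_size pR) addnS.
  - move=> Y /hA[YR|sub]; last by right=> y /sub yU; rewrite mem_cat yU.
    move: YR; rewrite (perm_mem pR) inE => /predU1P[->|]; last by left.
    by right=> y yX; rewrite mem_cat yX orbT.
  - by rewrite mem_cat xX orbT.
  - by rewrite distxx.
  exists (X :: s), t, (dist z x + q)%N; split=> //; last by lia.
    by rewrite perm_sym; apply: perm_trans pR _; rewrite /= perm_cons perm_sym.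
  by exists z, x, q.
have xR X : X \in R -> x \notin X by move=> XR; apply: contra noR => xX; apply/hasP; exists X.
case: v lt_n => [|a v] lt_n.
  by exists [::], R, 0%N; split=> // X /xR.
(* Both ends of an edge of [E] lie in one set, which has been visited since [x] is in no set of [R];
   then the new vertex is in [U] and the count restarts. Any other edge adds one to the count. *)
have [z' [k' [z'U dz' lek']]] : exists z' k', [/\ z' \in U, (dist z' (x + dl a)%R <= k')%N &
    (k' <= k + ((x, a) \notin E))%N].
  have [eE|eE] := boolP ((x, a) \in E).
    have [X XA /andP[/= xX x'X]] := hE _ eE.
    exists (x + dl a), 0%N; rewrite distxx; split=> //.
    by case: (hA X XA) => [/xR|]; [rewrite xX|apply].
  exists z, k.+1; split=> //; last by rewrite addn1.
  by apply: leq_trans (dist_step _ _ _) _.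
have [|s [t [q [p1 c1 q1 t1]]]] := IH v (x + dl a) U R z' k' _ hA z'U dz'.
  by move: lt_n => /=; lia.
exists s, t, q; split=> //.
  by apply: leq_trans q1 _; rewrite /= addnA leq_add2r.
move=> X Xt; have XR : X \in R by rewrite -(perm_mem p1) mem_cat Xt orbT.
split; first exact: xR.
have [n1 n2] := t1 X Xt; move=> e; rewrite /= inE => /predU1P[->|/n2] //.
Qed.

End Metric.

(** * Pieces of a coloured word *)

Ltac vertex_eq := apply/ffunP => ?; rewrite !ffunE /=; clear; lia.

Section Pieces.
Variable r : nat.
Local Notation L := (letter r).
Local Notation tok := (tok r).
Local Notation vertex := (vertex r).
Local Notation edge := (edge r).
Local Open Scope ring_scope.
Implicit Types (g : tok) (A B C S W X Y c x y : seq tok) (p q : vertex).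

Definition piece : eqType := (vertex * seq tok)%type.
Implicit Types (pc : piece) (l : seq piece).

Definition td S : vertex := disp (lt S).

Lemma td_cat X Y : td (X ++ Y) = td X + td Y.
Proof. by rewrite /td /lt map_cat disp_cat. Qed.

Lemma td_cons g X : td (g :: X) = dl g.1 + td X.
Proof. exact: disp_cons. Qed.

Lemma td_nil : td [::] = 0.
Proof. exact: disp_nil. Qed.

Lemma td_rev X : td (rev X) = td X.
Proof. by apply: disp_perm; rewrite /lt map_rev perm_rev. Qed.

Definition addp q c l : seq piece := if nilp c then l else (q, c) :: l.

Lemma addp_cat q c l1 l2 : addp q c (l1 ++ l2) = addp q c l1 ++ l2.
Proof. by rewrite /addp; case: nilp. Qed.

(** The first component is the nonwhite run starting at [p]; it may continue a piece begun further
    left, so it gets no base point of its own. *)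
Fixpoint parse p S : seq tok * seq piece :=
  if S is g :: S' then
    let: (c, l) := parse (p + dl g.1) S' in
    if nw g then (g :: c, l) else ([::], addp (p + dl g.1) c l)
  else ([::], [::]).

Lemma parse_root p S : (parse p S).1 = pref (@nw r) S.
Proof.
elim: S p => //= g S IH p; rewrite pref_cons -(IH (p + dl g.1)).
by case: (parse _ S) => c l; case: ifP.
Qed.

Lemma parse_nw p c Y : all (@nw r) c ->
  parse p (c ++ Y) = (c ++ (parse (p + td c) Y).1, (parse (p + td c) Y).2).
Proof.
elim: c p => [|g c IH] p /=; first by rewrite td_nil addr0; case: parse.
by case/andP=> -> /IH ->; rewrite td_cons addrA.
Qed.

(** [swhite] and [ewhite] say that a factor starts or ends at a border between pieces. The end of
    the word is such a border; an empty left factor means that the root follows, and is treated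
    separately. *)
Definition swhite Y := if Y is g :: _ then ~~ nw g else true.
Definition ewhite X := if X is g :: X' then ~~ nw (last g X') else false.

Lemma swhite_root p Y : swhite Y -> (parse p Y).1 = [::].
Proof. by rewrite parse_root; case: Y => //= g Y /negPf ng; rewrite pref_cons ng. Qed.

Lemma swhite_suff Y : swhite (suff (@nw r) Y).
Proof. by case E: (suff _ _) => [|g s] //=; have [] := suff_head E. Qed.

Lemma ewhite_rev X : ~~ nilp (suff (@nw r) X) -> ewhite (rev (suff (@nw r) X)).
Proof.
case E: (suff _ _) => [|g s] // _; have [ng _] := suff_head E.
rewrite rev_cons; case F: (rev s) => [|h s'] /=; by rewrite ?last_rcons.
Qed.

Lemma parse_ewhite p X Y : ewhite X ->
  parse p (X ++ Y) = ((parse p X).1, (parse p X).2 ++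
    addp (p + td X) (parse (p + td X) Y).1 (parse (p + td X) Y).2).
Proof.
elim: X p => // g X IH p eX; rewrite /= td_cons addrA.
case: X IH eX => [|h X] IH eX.
  rewrite /= td_nil addr0; move: eX => /= /negPf ->; case: parse => c l /=.
  by rewrite /addp.
rewrite (IH (p + dl g.1)) //; case: (parse (p + dl g.1) (h :: X)) => c l.
by case: ifP => _ //=; rewrite addp_cat.
Qed.

Lemma parse_allwhite p W : all (predC (@nw r)) W -> parse p W = ([::], [::]).
Proof. by elim: W p => //= g W IH p /andP[/negPf ng /IH ->]; rewrite ng. Qed.

Lemma parse_white p W Y : ~~ nilp W -> all (predC (@nw r)) W ->
  parse p (W ++ Y) =
  ([::], addp (p + td W) (parse (p + td W) Y).1 (parse (p + td W) Y).2).
Proof.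
move=> nW aW; rewrite parse_ewhite ?(parse_allwhite _ aW) //.
case: W nW aW => //= g W _ /andP[ng]; case/lastP: W => //= W h.
by rewrite all_rcons last_rcons => /andP[].
Qed.

(* The first piece, based at the origin, is kept even when it is empty. *)
Definition ap S : seq piece := (0, (parse 0 S).1) :: (parse 0 S).2.

Definition blockp (root : bool) q x : seq piece := if ~~ root && nilp x then [::] else [:: (q, x)].

Lemma ap_block X x Y : nilp X || ewhite X -> all (@nw r) x -> swhite Y ->
  ap (X ++ x ++ Y) = (if nilp X then [::] else ap X) ++ blockp (nilp X) (td X) x ++
    (parse (td X + td x) Y).2.
Proof.
case: (@nilP _ X) => [->|_] /= eX nx sY.
  by rewrite /ap parse_nw // swhite_root // cats0 /blockp td_nil !add0r.
rewrite /ap parse_ewhite // add0r parse_nw // (@swhite_root _ Y) // cats0 /=.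
by rewrite /addp /blockp /=; case: nilp.
Qed.

Lemma td_white (w : seq L) : td (map (@white r) w) = disp w.
Proof. by rewrite /td /lt -map_comp map_id_in. Qed.

Lemma td_grey (w : seq L) : td (map (@grey r) w) = disp w.
Proof. by rewrite /td /lt -map_comp map_id_in. Qed.

Lemma all_white (w : seq L) : all (predC (@nw r)) (map (@white r) w).
Proof. by rewrite all_map; apply/allP. Qed.

Lemma all_grey (w : seq L) : all (@nw r) (map (@grey r) w).
Proof. by rewrite all_map; apply/allP. Qed.

Lemma suff_rev_split X :
  rev X = rev (suff (@nw r) X) ++ rev (pref (@nw r) X).
Proof. by rewrite -rev_cat pref_suff. Qed.

Lemma nilp_rev X : nilp (rev X) = nilp X.
Proof. by rewrite /nilp size_rev. Qed.

Lemma nilp_ewhite_rev X : nilp (rev (suff (@nw r) X)) || ewhite (rev (suff (@nw r) X)).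
Proof. by rewrite nilp_rev; case: (boolP (nilp _)) => //= /ewhite_rev. Qed.

(** The white letters before [rev B] lead from the end of [a c] to the old base point of the loop,
    those after it lead back, so no piece of [rest] moves. *)
Lemma split_pieces A B C (e e' : tok) :
  all (@nw r) B -> nw e -> nw e' -> e'.1 = linv e.1 -> td B = 0 ->
  exists pre q a c rest,
  [/\ ap (rev A ++ e :: rev B ++ e' :: C) = pre ++ (q, a ++ e :: rev B ++ e' :: c) :: rest,
      ap (split_out C A B e) =
        pre ++ blockp (nilp pre) q (a ++ c) ++ addp (q + td a + dl e.1) (rev B) rest,
      c = pref (@nw r) C & all (@nw r) (a ++ c) ].
Proof.
move=> nB ne ne' ee' tB.
set a := rev (pref (@nw r) A); set X := rev (suff (@nw r) A).
set c := pref (@nw r) C; set Y := suff (@nw r) C.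
have na : all (@nw r) a by rewrite all_rev all_pref.
have nc : all (@nw r) c by apply: all_pref.
exists (if nilp X then [::] else ap X), (td X), a, c, (parse (td X + td a + td c) Y).2.
have eX := nilp_ewhite_rev A; rewrite -/X in eX.
have sY := swhite_suff C; rewrite -/Y in sY.
split; last by rewrite all_cat na nc.
- have -> : rev A ++ e :: rev B ++ e' :: C = X ++ (a ++ e :: rev B ++ e' :: c) ++ Y.
    by rewrite suff_rev_split -/X -/a -!catA /= -catA /= pref_suff.
  rewrite ap_block //; last by rewrite all_cat /= all_cat /= all_rev na ne nB ne' nc.
  congr (_ ++ _); rewrite /blockp.
  have -> : nilp (a ++ e :: rev B ++ e' :: c) = false by rewrite /nilp size_cat /= addnS.
  rewrite andbF /= !(td_cat, td_cons) (td_rev B) tB add0r ee' dl_linv.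
  by rewrite (addrA (dl e.1)) subrr add0r addrA.
- have -> : nilp (if nilp X then [::] else ap X) = nilp X by case: (nilp X).
  have -> : split_out C A B e = X ++ (a ++ c) ++ (map (@white r) (winv (lt c)) ++ [:: white e.1]) ++
      rev B ++ (map (@white r) (linv e.1 :: lt c)) ++ Y.
    by rewrite /split_out suff_rev_split -/X -/a -/c -/Y -!catA.
  rewrite ap_block ?all_cat ?na ?nc //; last first.
    by rewrite /swhite; case: (winv _).
  rewrite parse_white; last by rewrite all_cat all_white.
  rewrite parse_nw ?all_rev // parse_white ?all_white //= cats0.
  rewrite (@swhite_root _ Y) // [addp _ [::] _]/addp /=.
  rewrite !td_cat (td_rev B) tB td_white disp_winv -/(td c) !td_cons td_white td_nil /= -/(td c).
  rewrite dl_linv; congr (_ ++ (_ ++ _)).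
  have -> : td X + (td a + td c) + (- td c + (dl e.1 + 0)) = td X + td a + dl e.1.
    by move: (td X) (td a) (td c) (dl _) => ? ? ? ?; vertex_eq.
  have -> // : td X + td a + dl e.1 + 0 + (- dl e.1 + td c) = td X + td a + td c.
    by move: (td X) (td a) (td c) (dl _) => ? ? ? ?; vertex_eq.
  by rewrite /nilp size_cat addn1.
- by [].
Qed.

(** Taking [s t] out of its place keeps the later base points only if it is a loop, whence the
    premise of the second clause. The third clause says that [P] leads from the first cut to the
    second. *)
Lemma merge_pieces A B C (P : seq L) :
  ~~ all (@nw r) B -> mergeable A B -> disp P = td B ->
  exists pre q a b mid q2 s t rest,
  [/\ ap (rev A ++ rev B ++ C) = pre ++ (q, a ++ b) :: mid ++ (q2, s ++ t) :: rest,
      (td (s ++ t) = 0 -> ap (merge_out C A B P) = pre ++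
        (q, a ++ map (@grey r) P ++ t ++ s ++ map (@grey r) (winv P) ++ b) :: mid ++ rest) &
      q + td a + disp P = q2 + td s].
Proof.
move=> nB mAB dP.
set a := rev (pref (@nw r) A); set X := rev (suff (@nw r) A).
set B1 := rev (suff (@nw r) B); set s := rev (pref (@nw r) B).
set b := pref (@nw r) B1; set W := suff (@nw r) B1.
set t := pref (@nw r) C; set Y := suff (@nw r) C.
have na : all (@nw r) a by rewrite all_rev all_pref.
have nb : all (@nw r) b by apply: all_pref.
have ns : all (@nw r) s by rewrite all_rev all_pref.
have nt : all (@nw r) t by apply: all_pref.
have eX := nilp_ewhite_rev A; rewrite -/X in eX.
have sY := swhite_suff C; rewrite -/Y in sY.
have sW := swhite_suff B1; rewrite -/W in sW.
have nB1 : ~~ nilp (suff (@nw r) B).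
  by apply: contra nB => /nilP e; rewrite -(pref_suff (@nw r) B) e cats0 all_pref.
have eB1 : ewhite B1 by apply: ewhite_rev.
have bW : b ++ W = B1 by apply: pref_suff.
have eW : ewhite W.
  case: (W) bW eB1 sW => [|g W'] <-; first by rewrite cats0; case/lastP: (b) nb => // b' h;
    rewrite all_rcons => /andP[nh _]; case: b' => [|h' b'] /=; rewrite ?last_rcons nh.
  by case: (b) => [|h b'] //=; rewrite last_cat.
have blk x : (nilp X = false -> ~~ nilp x) -> blockp (nilp X) (td X) x = [:: (td X, x)].
  by rewrite /blockp; case: (nilp X) => //= /(_ erefl) /negPf ->.
(* [mergeable] puts a black letter before each cut, so neither piece is an empty one that parsing
   drops; only the root may be empty. *)
have abn0 : nilp X = false -> ~~ nilp a.
  move: mAB; rewrite /mergeable /X /a !nilp_rev; case: (A) => [|g A'] //= /andP[bg _].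
  by rewrite pref_cons /nw (eqP bg).
have s0 : ~~ nilp s.
  move: mAB; rewrite /mergeable /s nilp_rev; case: (B) => [|g B'] //=; rewrite ?andbF //.
  by case/andP=> _ bg; rewrite pref_cons /nw (eqP bg).
have ncat x y : ~~ nilp x -> ~~ nilp (x ++ y) by case: x.
exists (if nilp X then [::] else ap X), (td X), a, b,
  (parse (td X + td (a ++ b)) W).2, (td X + td (a ++ b) + td W), s, t,
  (parse (td X + td (a ++ b) + td W + td (s ++ t)) Y).2.
split.
- have -> : rev A ++ rev B ++ C = X ++ (a ++ b) ++ W ++ (s ++ t) ++ Y.
    by rewrite (suff_rev_split A) (suff_rev_split B) -/X -/a -/B1 -/s -bW -!catA pref_suff.
  rewrite ap_block ?all_cat ?na ?nb //; last by move: sW; case: (W) eW.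
  rewrite blk => [|/abn0/ncat] //.
  rewrite parse_ewhite // parse_nw ?all_cat ?ns ?nt // (@swhite_root _ Y) // cats0 /addp.
  by rewrite (negPf (ncat _ _ s0)).
- move=> st0.
  have -> : merge_out C A B P = X ++ (a ++ map (@grey r) P ++ t ++ s ++ map (@grey r) (winv P) ++ b)
       ++ W ++ Y.
    by rewrite /merge_out (suff_rev_split A) -/X -/a -/B1 -/s -/t -/Y -bW -!catA.
  rewrite ap_block ?all_cat ?na ?nb ?ns ?nt ?all_grey //; last by move: sW; case: (W) eW.
  rewrite blk => [|/abn0/ncat] //.
  have -> : td (a ++ map (@grey r) P ++ t ++ s ++ map (@grey r) (winv P) ++ b) = td (a ++ b).
    rewrite !td_cat !td_grey disp_winv; move: st0; rewrite td_cat.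
    by move: (td s) (td t) (td a) (td b) (disp P) => ? ? ? ? ? /addr0_eq <-; vertex_eq.
  by rewrite parse_ewhite // (@swhite_root _ Y) // /addp /= st0 addr0.
- rewrite dP -(td_rev B) suff_rev_split -/B1 -/s -bW !td_cat.
  by move: (td X) (td a) (td b) (td W) (td s) => ? ? ? ? ?; vertex_eq.
Qed.

Lemma parse_split p S l1 q c l2 : (parse p S).2 = l1 ++ (q, c) :: l2 ->
  exists X Y, [/\ S = X ++ c ++ Y, ewhite X, q = p + td X,
    parse p X = ((parse p S).1, l1) & all (@nw r) c && ~~ nilp c].
Proof.
elim: S p l1 => [|g S IH] p l1 /=; first by case: l1.
case E: (parse (p + dl g.1) S) => [c0 l].
have {}IH l1' : l = l1' ++ (q, c) :: l2 ->
  exists X Y, [/\ g :: S = (g :: X) ++ c ++ Y, ewhite (g :: X), q = p + td (g :: X),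
    parse (p + dl g.1) X = (c0, l1') & all (@nw r) c && ~~ nilp c].
  move=> el; have := IH (p + dl g.1) l1'; rewrite E => /(_ el)[X [Y [-> eX -> pX nc]]].
  exists X, Y; split=> //; last by rewrite td_cons addrA.
  by case: X eX {pX}.
case: ifP => ng /=.
  by case/IH=> X [Y [eS eX eq pX nc]]; exists (g :: X), Y; rewrite eS /= pX ng.
have c0E : c0 = pref (@nw r) S by rewrite -(parse_root (p + dl g.1)) E.
rewrite /addp; case: (boolP (nilp c0)) => nc0.
  by case/IH=> X [Y [eS eX eq pX nc]]; exists (g :: X), Y; rewrite eS /= pX ng /addp nc0.
case: l1 => [|[q1 c1] l1] /= [].
  move=> <- <- _; exists [:: g], (suff (@nw r) S); rewrite /= ng c0E pref_suff; split=> //.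
    by rewrite td_cons td_nil addr0.
  by rewrite all_pref -c0E.
move=> <- <- /IH[X [Y [eS eX eq pX nc]]]; exists (g :: X), Y.
by rewrite eS /= pX ng /addp (negPf nc0).
Qed.

(** Translates a piece back into a factorisation of the word, and so into positions of the cuts. *)
Lemma ap_split S l1 q c l2 : ap S = l1 ++ (q, c) :: l2 ->
  exists X Y, [/\ S = X ++ c ++ Y, q = td X,
    if nilp l1 then nilp X else ewhite X && (ap X == l1),
    all (@nw r) c & ~~ nilp l1 -> ~~ nilp c].
Proof.
rewrite /ap; case: l1 => [[<- <- _]|[q1 c1] l1 [<- <- /parse_split[X [Y [eS eX -> pX /andP[nc c0]]]]]] /=.
  exists [::], (suff (@nw r) S); rewrite parse_root /= pref_suff td_nil.
  by split=> //; apply: all_pref.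
by exists X, Y; rewrite add0r eX /ap pX eqxx.
Qed.

End Pieces.

Lemma pairwise_split (T : Type) (R : rel T) (s : seq T) :
  (forall s1 x s2 y s3, s = s1 ++ x :: s2 ++ y :: s3 -> R x y) -> pairwise R s.
Proof.
elim: s => //= x s IH h; apply/andP; split.
  elim: s {IH} h => //= y s IH h; rewrite (h [::] x [::] y s) //=; apply: IH => s1 a s2 b s3 e.
  case: s1 e => [|a' s1] /= [xa e]; subst; last by apply: (h (_ :: y :: s1) _ s2 _ s3).
  by apply: (h [::] _ (y :: s2) b s3).
by apply: IH => s1 a s2 b s3 e; apply: (h (x :: s1) _ s2 _ s3); rewrite /= e.
Qed.

Lemma pairwise_mem (T : eqType) (R : rel T) (s : seq T) x y :
  symmetric R -> pairwise R s -> x \in s -> y \in s -> x != y -> R x y.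
Proof.
move=> sR; elim: s => //= z s IH /andP[zs ps]; rewrite !inE.
move=> /predU1P[->|xs] /predU1P[->|ys]; rewrite ?eqxx // => ne.
- exact: (allP zs).
- by rewrite sR; apply: (allP zs).
- exact: IH.
Qed.

Lemma size_le_count_mem (T : eqType) (s1 s2 : seq T) :
  (forall x, count_mem x s1 <= count_mem x s2) -> size s1 <= count (mem s1) s2.
Proof.
move=> h; have /count_subseqP[s sub p] : forall x, count_mem x s1 <= count_mem x s2 by [].
rewrite (perm_size p) -size_filter; apply: size_subseq.
by rewrite subseq_filter sub andbT; apply/allP => x xs; rewrite /= (perm_mem p).
Qed.

(** * Vertex sets of pieces, irreducible words and comparison with a competitor *)

Section Geometry.
Variable r : nat.
Local Notation L := (letter r).
Local Notation tok := (tok r).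
Local Notation vertex := (vertex r).
Local Notation edge := (edge r).
Local Notation piece := (piece r).
Local Open Scope ring_scope.
Implicit Types (g : tok) (A B C S W X Y Z c x y : seq tok) (p q : vertex).
Implicit Types (pc : piece) (l : seq piece).

(** The initial vertex is omitted: for a closed black piece it reappears as the last endpoint, and
    for the root, possibly open, [vsets] adds the origin. *)
Fixpoint bv q c : seq vertex :=
  if c is g :: c' then
    if bk g then (q + dl g.1) :: bv (q + dl g.1) c' else bv (q + dl g.1) c'
  else [::].

Lemma bv_cat q x y : bv q (x ++ y) = bv q x ++ bv (q + td x) y.
Proof.
elim: x q => [|g x IH] q /=; first by rewrite td_nil addr0.
by rewrite IH td_cons addrA; case: ifP.
Qed.

Lemma bv_grey q (w : seq L) : bv q (map (@grey r) w) = [::].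
Proof. by elim: w q => //= a w IH q; rewrite IH. Qed.

Lemma bv_mem q x u : u \in bv q x ->
  exists a g b, [/\ x = a ++ g :: b, bk g & u = q + td (rcons a g)].
Proof.
elim: x q => // g x IH q /=; case: ifP => [bg|_].
  rewrite inE => /predU1P[->|]; first by exists [::], g, x; rewrite /= td_cons td_nil addr0.
  by case/IH=> a [h [b [-> bh ->]]]; exists (g :: a), h, b; rewrite /= td_cons addrA.
by case/IH=> a [h [b [-> bh ->]]]; exists (g :: a), h, b; rewrite /= td_cons addrA.
Qed.

Definition vs pc : seq vertex := bv pc.1 pc.2.
Definition vsets l : seq (seq vertex) :=
  if l is pc :: l' then (0 :: vs pc) :: map vs l' else [::].

(** The condition under which [step] performs a surgery instead of moving the cuts, with [d] for the
    length of [D]. *)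
Definition applies (d : nat) A B C : bool :=
  (size (abn (lt B)) <= d)%N && (if all (@nw r) B then
    (if A is e :: _ then [&& d == 0%N, bk e & ohead C == Some (black (linv e.1))] else false)
  else mergeable A B).

Definition irreducible d S :=
  forall A B C, rev A ++ rev B ++ C = S -> ~~ applies d A B C.

Lemma ewhite_rcons X g : ewhite (rcons X g) = ~~ nw g.
Proof. by case: X => //= h X; rewrite last_rcons. Qed.

Lemma bk_nw g : bk g -> nw g.
Proof. by rewrite /nw => /eqP ->. Qed.

(** Place the cuts at [u] and [v]. The factor between them has displacement [v - u], so at distance
    at most [d] a merge would apply. *)
Lemma irreducible_far d S pre q x mid q2 y rest u v :
  irreducible d S -> ap S = pre ++ (q, x) :: mid ++ (q2, y) :: rest ->
  u \in (if nilp pre then 0 :: bv q x else bv q x) -> v \in bv q2 y ->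
  (d < dist u v)%N.
Proof.
move=> irr apS uq /bv_mem[s0 [g [t [ey bg vE]]]].
have apS' : ap S = (pre ++ (q, x) :: mid) ++ (q2, y) :: rest by rewrite apS -catA.
have [Z [Y2 [eS q2E]]] := ap_split apS'.
have -> : nilp (pre ++ (q, x) :: mid) = false by rewrite /nilp size_cat addnS.
case/andP=> eZ /eqP apZ ny _.
have [X [Y1 [eZ' qE apX nx _]]] := ap_split apZ.
have [a [b [ex uE aE]]] : exists a b, [/\ x = a ++ b, u = q + td a &
    (X ++ a == [::]) || (if rev a is h :: _ then bk h else false)].
  have inbv : u \in bv q x -> exists a b, [/\ x = a ++ b, u = q + td a &
    (X ++ a == [::]) || (if rev a is h :: _ then bk h else false)].
    case/bv_mem=> a [h [b [-> bh ->]]]; exists (rcons a h), b.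
    by rewrite cat_rcons rev_rcons bh orbT.
  case: (nilp pre) uq apX => /= uq; last by move=> _; apply: inbv.
  move=> /nilP X0; move: uq; rewrite inE => /predU1P[->|//].
  by exists [::], x; rewrite qE X0 !td_nil addr0.
rewrite ltnNge; apply/negP => le_d.
have := irr (rev (X ++ a)) (rev (b ++ Y1 ++ rcons s0 g)) (t ++ Y2).
rewrite !revK; have -> : (X ++ a) ++ (b ++ Y1 ++ rcons s0 g) ++ t ++ Y2 = S.
  by rewrite eS eZ' ex ey -!catA cat_rcons.
move/(_ erefl)/negP; apply; rewrite /applies.
have -> : (size (abn (lt (rev (b ++ Y1 ++ rcons s0 g)))) <= d)%N.
  rewrite size_abn -/(td _) td_rev; move: le_d; rewrite /dist.
  congr (nrm _ <= d)%N; rewrite vE uE q2E eZ' ex qE !td_cat.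
  move: (td X) (td a) (td b) (td Y1) (td (rcons s0 g)) => ? ? ? ? ?; vertex_eq.
rewrite ifF.
  rewrite /= /mergeable rev_cat; apply/andP; split.
    case/orP: aE => [/eqP e|]; first by rewrite -rev_cat e.
    by case: (rev a).
  by rewrite -rcons_cat -rcons_cat rev_rcons.
(* Some letter between the cuts is white: the part before the second piece ends in a white letter,
   which cannot belong to [X ++ a], as that is empty or ends in a black letter. *)
apply/negP; rewrite all_rev catA all_cat => /andP[nbY _].
move: eZ; rewrite eZ' ex -catA catA.
case/lastP: (b ++ Y1) nbY => [_|s h]; last first.
  by rewrite all_rcons -rcons_cat ewhite_rcons => /andP[->].
rewrite cats0; case/orP: aE => [/eqP -> //|].
case/lastP: (a) => // a' h; rewrite rev_rcons -rcons_cat ewhite_rcons => /bk_nw ->.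
by [].
Qed.

Lemma irreducible_sep d S : irreducible d S -> pairwise (sep d.+1) (vsets (ap S)).
Proof.
move=> irr; rewrite /vsets {1}/ap pairwise_cons pairwise_map; apply/andP; split.
  rewrite all_map; apply/allP => -[q2 y] yS; apply/sepP => u v uX vY.
  have [mid [rest e]] : exists mid rest, (parse 0 S).2 = mid ++ (q2, y) :: rest.
    by case/splitPr: yS => mid rest; exists mid, rest.
  by apply: (@irreducible_far d S [::] _ _ mid _ _ rest u v irr _ uX vY); rewrite /ap e.
apply: pairwise_split => s1 [q x] mid [q2 y] rest e; apply/sepP => u v uX vY.
apply: (@irreducible_far d S (head (0, [::]) (ap S) :: s1) q x mid q2 y rest u v irr) => //.
by rewrite /ap /= e.
Qed.

Definition pedges pc : seq edge := edges pc.1 (lt pc.2).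
Definition all_edges l : seq edge := flatten (map pedges l).

Lemma edges_split2 q c e1 e2 : e1 != e2 -> e1 \in edges q (lt c) -> e2 \in edges q (lt c) ->
  exists a g b g' c', c = a ++ g :: b ++ g' :: c' /\
    let f1 := (q + td a, g.1) in let f2 := (q + td (rcons a g) + td b, g'.1) in
    (e1, e2) = (f1, f2) \/ (e1, e2) = (f2, f1).
Proof.
have one q' c' e : e \in edges q' (lt c') ->
    exists a g b, c' = a ++ g :: b /\ e = (q' + td a, g.1).
  elim: c' q' => //= g c' IH q'; rewrite inE => /predU1P[->|].
    by exists [::], g, c'; rewrite td_nil addr0.
  by case/IH=> a [h [b [-> ->]]]; exists (g :: a), h, b; rewrite td_cons addrA.
elim: c q => //= g c IH q ne; rewrite !inE => /predU1P[e1E|m1] /predU1P[e2E|m2].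
- by rewrite e1E e2E eqxx in ne.
- have [a [h [b [-> ->]]]] := one _ _ _ m2; exists [::], g, a, h, b; split=> //=; left.
  by rewrite e1E td_cons td_nil !addr0.
- have [a [h [b [-> ->]]]] := one _ _ _ m1; exists [::], g, a, h, b; split=> //=; right.
  by rewrite e2E td_cons td_nil !addr0.
have [a [h [b [h' [c' [-> e12]]]]]] := IH _ ne m1 m2.
exists (g :: a), h, b, h', c'; split=> //; move: e12.
by rewrite rcons_cons !td_cons !addrA.
Qed.

Definition all_black pc := all (@bk r) pc.2.
Definition closed pc := td pc.2 == 0.

Lemma bv_ends q c e : all (@bk r) c -> e \in edges q (lt c) ->
  (e.1 \in q :: bv q c) && (e.1 + dl e.2 \in bv q c).
Proof.
elim: c q => //= g c IH q /andP[-> bc]; rewrite inE => /predU1P[->|/IH-/(_ bc)/andP[h1 h2]] /=.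
  by rewrite !inE !eqxx.
by rewrite inE h1 orbT inE h2 orbT.
Qed.

Lemma bv_closed q c : all (@bk r) c -> ~~ nilp c -> td c = 0 -> q \in bv q c.
Proof.
case/lastP: c => // c g; rewrite all_rcons => /andP[bg _] _ tc.
rewrite -cats1 bv_cat mem_cat /= bg inE -addrA.
have -> : td c + dl g.1 = 0 by rewrite -tc -cats1 td_cat td_cons td_nil addr0.
by rewrite addr0 eqxx orbT.
Qed.

Lemma pedges_ends pc e : all_black pc -> closed pc -> e \in pedges pc ->
  (e.1 \in vs pc) && (e.1 + dl e.2 \in vs pc).
Proof.
case: pc => q c; rewrite /all_black /closed /pedges /vs /= => bc /eqP tc eE.
have /andP[h1 ->] := bv_ends bc eE; rewrite andbT.
move: h1; rewrite inE => /predU1P[->|//]; apply: bv_closed => //.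
by case: c eE {bc tc}.
Qed.

(** This supplies the first hypothesis of [chain_walk]: the edges of a piece never leave its vertex
    set. *)
Lemma all_edges_ends S e : all all_black (ap S) -> all closed (behead (ap S)) ->
  e \in all_edges (ap S) ->
  exists2 X, X \in vsets (ap S) & (e.1 \in X) && (e.1 + dl e.2 \in X).
Proof.
rewrite /all_edges {1}/ap /= => /andP[b0 bl] cl; rewrite mem_cat => /orP[e0|/flatten_mapP[pc pcl epc]].
  exists (0 :: vs (0, (parse 0 S).1)); first by rewrite inE eqxx.
  by have /andP[h1 h2] := bv_ends b0 e0; rewrite h1 inE h2 orbT.
exists (vs pc); first by rewrite inE (map_f vs pcl) orbT.
exact: pedges_ends (allP bl _ pcl) (allP cl _ pcl) epc.
Qed.

(** Between an edge and its reverse on one path lies a loop, and the cuts around that loop would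
    admit a split. *)
Lemma no_opposite_in_piece S l1 q c l2 e : irreducible 0 S ->
  ap S = l1 ++ (q, c) :: l2 -> all (@bk r) c -> e \in edges q (lt c) ->
  ebar e \notin edges q (lt c).
Proof.
move=> irr /ap_split[X [Y [eS _ _ nc _]]] bc eE; apply/negP => e'E.
have ne : e != ebar e by rewrite eq_sym ebar_neq.
have [a [g [b [g' [c' [ec e12]]]]]] := edges_split2 ne eE e'E.
have {e12} [tb gg'] : td b = 0 /\ g'.1 = linv g.1.
  have wlog f : f = (q + td a, g.1) -> ebar f = (q + td (rcons a g) + td b, g'.1) ->
      td b = 0 /\ g'.1 = linv g.1.
    move=> ->; rewrite /ebar /= -cats1 td_cat td_cons td_nil addr0 => -[e1 <-]; split=> //.
    move: e1; rewrite !addrA => /eqP.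
    by rewrite -subr_eq0 opprD addrA subrr add0r oppr_eq0 => /eqP.
  case: e12 => e12; have := congr1 fst e12; have := congr1 snd e12 => /= h2 h1.
    exact: wlog h1 h2.
  by apply: wlog h2 _; rewrite ebarK.
move: bc nc; rewrite ec !all_cat /= !all_cat /= => /and4P[_ bg _ /andP[bg' _]] /and4P[_ _ nb _].
have := irr (g :: rev (X ++ a)) (rev b) (g' :: c' ++ Y).
rewrite rev_cons !revK; have -> : rcons (X ++ a) g ++ b ++ g' :: c' ++ Y = S.
  by rewrite eS ec cat_rcons -!catA /= -catA.
move/(_ erefl)/negP; apply; rewrite /applies all_rev nb size_abn -/(td _) td_rev tb.
rewrite -(subrr (0 : vertex)) -[nrm _]/(dist 0 0) distxx bg /=; apply/eqP; congr Some.
by move: g' gg' bg' {ec} => [x' o] /= -> /eqP /= ->.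
Qed.

(** Edges [e] and [ebar e] on different pieces share a vertex, which contradicts the separation of
    irreducible pieces. *)
Lemma no_opposite S e : irreducible 0 S -> all all_black (ap S) ->
  all closed (behead (ap S)) -> e \in all_edges (ap S) -> ebar e \notin all_edges (ap S).
Proof.
move=> irr bS cS /flatten_mapP[pc pcS epc]; apply/negP => /flatten_mapP[pc' pcS' epc'].
have same : pc = pc' -> False.
  move=> epp; rewrite -epp in epc'; case: pc pcS epc epc' {epp} => q c pcS epc epc'.
  have [l1 [l2 apS]] : exists l1 l2, ap S = l1 ++ (q, c) :: l2.
    by case/splitPr: pcS => l1 l2; exists l1, l2.
  by have /negP := no_opposite_in_piece irr apS (allP bS _ pcS) epc; apply.
have := irreducible_sep irr; move: bS cS pcS pcS'; rewrite /ap /=.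
set rt := (0, _); set l := (parse 0 S).2 => /andP[b0 bl] cl; rewrite !inE => pc1 pc2 /andP[far pair].
have farl pc3 u : pc3 \in l -> u \in vs pc3 -> u \in 0 :: vs rt -> False.
  move=> pcl uX u0; have /sepP/(_ u u u0 uX) := allP far _ (map_f vs pcl).
  by rewrite distxx.
have ends pc3 e1 : pc3 \in l -> e1 \in pedges pc3 ->
    (e1.1 \in vs pc3) && (e1.1 + dl e1.2 \in vs pc3).
  by move=> pl; apply: pedges_ends (allP bl _ pl) (allP cl _ pl).
have rends e1 : e1 \in pedges rt -> (e1.1 \in 0 :: vs rt) && (e1.1 + dl e1.2 \in 0 :: vs rt).
  by move=> e1r; have /andP[h1 h2] := bv_ends b0 e1r; rewrite h1 inE h2 orbT.
case/predU1P: pc1 => [pE|pl]; case/predU1P: pc2 => [pE'|pl'].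
- by apply: same; rewrite pE pE'.
- rewrite pE in epc; have /andP[_ h2] := rends _ epc; have /andP[h1 _] := ends _ _ pl' epc'.
  exact: farl pl' h1 h2.
- rewrite pE' in epc'; have /andP[_ h2] := ends _ _ pl epc; have /andP[h1 _] := rends _ epc'.
  exact: farl pl h2 h1.
have /andP[_ h2] := ends _ _ pl epc; have /andP[h1 _] := ends _ _ pl' epc'.
have [/same //|ne] := eqVneq pc pc'.
rewrite pairwise_map in pair.
have sR : symmetric (relpre vs (sep 1)) by move=> x y; apply: sep_sym.
by have /sepP/(_ _ _ h2 h1) := pairwise_mem sR pair pl pl' ne; rewrite distxx.
Qed.

(** Without opposite edges the multiplicity of an edge in the pieces is its flow, so [v] contains
    all these edges. They account for the first summand; the steps of [v] off the pieces pay for the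
    joining. *)
Lemma initial_chain S (v : seq L) : irreducible 0 S -> all all_black (ap S) ->
  all closed (behead (ap S)) ->
  (forall e, flow (all_edges (ap S)) e = flow (edges 0 v) e) ->
  exists s n, [/\ perm_eq s (behead (vsets (ap S))), chain (head [::] (vsets (ap S))) s n &
    (size (all_edges (ap S)) + n <= size v)%N].
Proof.
move=> irr bS cS fE; set E := all_edges _ in fE *.
have cE e : (count_mem e E <= count_mem e (edges 0%R v))%N.
  have [eE|/count_memPn -> //] := boolP (e \in E).
  have /count_memPn c0 := no_opposite irr bS cS eE.
  by have := fE e; rewrite /flow c0; lia.
have := size_le_count_mem cE => sE.
have [] := @chain_walk r E (vsets (ap S)) v 0 (head [::] (vsets (ap S))) (behead (vsets (ap S))) 0 0.
- by move=> e; apply: all_edges_ends.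
- by move=> X; rewrite /vsets /ap inE => /predU1P[->|]; [right|left].
- by rewrite /vsets /ap inE eqxx.
- by rewrite distxx.
move=> s [t [q [p c lq far]]].
(* A piece other than the root is nonempty, and [v] traverses its first edge, so [v] does enter
   it. *)
have t0 : t = [::].
  case: t p far => // X t p far; have Xin : X \in map vs (parse 0 S).2.
    by rewrite -(perm_mem p) mem_cat inE eqxx orbT.
  have /mapP[[q' c'] pcl eX] := Xin; have [_ noX] := far X (mem_head _ _).
  have [m [m' eS]] : exists m m', (parse 0 S).2 = m ++ (q', c') :: m'.
    by case/splitPr: pcl => m m'; exists m, m'.
  have [_ [_ [_ _ _ _ /(_ isT)]]] := @ap_split _ S ((0, (parse 0 S).1) :: m) q' c' m' (congr1 (cons _) eS).
  case: c' pcl eX {eS} => // g c' pcl eX _.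
  have eE : (q', g.1) \in E.
    by apply/flatten_mapP; exists (q', g :: c'); rewrite inE ?eqxx // pcl orbT.
  have bgc : all_black (q', g :: c') by apply: (allP bS); rewrite inE pcl orbT.
  have /andP[_ h2] := bv_ends bgc (mem_head (q', g.1) _ : (q', g.1) \in edges q' (lt (g :: c'))).
  have ev : (q', g.1) \in edges 0 v.
    by rewrite -has_pred1 has_count; apply: leq_trans (cE _); rewrite -has_count has_pred1.
  by have := noX _ ev; rewrite eX /vs h2.
exists s, q; split=> //; first by rewrite -[s]cats0 -t0.
by rewrite -(size_edges 0 v) -(count_predC (mem E) (edges 0 v)); apply: leq_add.
Qed.

End Geometry.

Lemma pairwise_insert (T : eqType) (R : rel T) (s1 s2 : seq T) x : symmetric R ->
  pairwise R (s1 ++ x :: s2) = all (R^~ x) (s1 ++ s2) && pairwise R (s1 ++ s2).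
Proof.
move=> sR; elim: s1 => [|y s1 IH] /=.
  by congr (_ && _); apply: eq_all => z; rewrite sR.
by rewrite IH !all_cat /=; case: (R y x); case: (all (R y) s1); case: (all (R y) s2);
  rewrite /= ?andbF.
Qed.

(** * Merging two sets of a separated family *)

Section MergeSets.
Variable r : nat.
Local Notation vertex := (vertex r).
Implicit Types (X Y Z H U : seq vertex) (l s : seq (seq vertex)).

Lemma sep_symm d : symmetric (@sep r d).
Proof. by move=> X Y; apply: sep_sym. Qed.

Lemma merge_pairwise d pre X mid Y rest Z : Z =i X ++ Y ->
  pairwise (sep d) (pre ++ X :: mid ++ Y :: rest) ->
  pairwise (sep d) (pre ++ Z :: mid ++ rest).
Proof.
move=> eZ; rewrite (pairwise_insert _ _ X (sep_symm d)) catA (pairwise_insert _ _ Y (sep_symm d)).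
rewrite (pairwise_insert _ _ Z (sep_symm d)) -!catA => /and3P[aX aY ->]; rewrite andbT.
have aX' : all ((sep d)^~ X) (pre ++ mid ++ rest).
  by move: aX; rewrite !all_cat /= => /and3P[-> -> /andP[_ ->]].
apply/allP => W Wl; rewrite /= sep_sym (sep_eql _ _ eZ) /sep all_cat.
by apply/andP; split; rewrite -/(sep _ _ _) sep_sym; [apply: (allP aX')|apply: (allP aY)].
Qed.

(** The root set starts the chain and is not in the order [s]. If [X] is the root, [Y] is removed
    from [s]; otherwise [chain_merge] is used, with [X] and [Y] in the order in which [s] meets
    them. *)
Lemma merge_chain d pre X mid Y rest Z s n : Z =i X ++ Y ->
  pairwise (sep d) (pre ++ X :: mid ++ Y :: rest) ->
  perm_eq s (behead (pre ++ X :: mid ++ Y :: rest)) ->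
  chain (head [::] (pre ++ X :: mid ++ Y :: rest)) s n ->
  exists s' n', [/\ perm_eq s' (behead (pre ++ Z :: mid ++ rest)), n' + d <= n &
    chain (head [::] (pre ++ Z :: mid ++ rest)) s' n'].
Proof.
move=> eZ pw; have subX : {subset X <= Z} by move=> x xX; rewrite eZ mem_cat xX.
have subY : {subset Y <= Z} by move=> x xX; rewrite eZ mem_cat xX orbT.
move: pw; rewrite (pairwise_insert _ _ X (sep_symm d)) [in X in _ && X]catA.
rewrite (pairwise_insert _ _ Y (sep_symm d)) -!catA => /and3P[aX aY _].
have sXY : sep d X Y.
  by rewrite sep_sym; move: aX; rewrite !all_cat /= => /and3P[_ _ /andP[]].
have perm2 (W : seq vertex) s1 s2 : perm_eq (s1 ++ W :: s2) (W :: s1 ++ s2).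
  by rewrite (perm_catCA s1 [:: W]).
have perm3 (W1 W2 : seq vertex) s1 s2 s3 :
    perm_eq (s1 ++ W1 :: s2 ++ W2 :: s3) (W1 :: W2 :: s1 ++ s2 ++ s3).
  by rewrite (permPl (perm2 _ _ _)) perm_cons catA (permPl (perm2 _ _ _)) -catA.
case: pre aX aY => [|H pre] aX aY /= ps c.
  have Ys : Y \in s by rewrite (perm_mem ps) mem_cat inE eqxx orbT.
  case/splitPr: Ys ps c => s1 s2 ps c.
  have ps' : perm_eq (s1 ++ s2) (mid ++ rest).
    by move: ps; rewrite (permPl (perm2 Y s1 s2)) (permPr (perm2 Y mid rest)) perm_cons.
  have [|n' le' c'] := chain_remove sXY _ subX subY c.
    by apply/allP => W Ws; apply: (allP aY); rewrite /= -(perm_mem ps') mem_cat Ws.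
  by exists (s1 ++ s2), n'.
have aX' : all ((sep d)^~ X) (H :: pre ++ mid ++ rest).
  by move: aX; rewrite /= !all_cat /= => /and4P[-> -> -> /andP[_ ->]].
have Xs : X \in s by rewrite (perm_mem ps) mem_cat inE eqxx orbT.
have := ps; rewrite (permPr (perm3 X Y pre mid rest)) => ps2.
case/splitPr: Xs ps2 c {ps} => s1 s2 ps2 c.
have Ys : Y \in s1 ++ s2.
  by move: ps2; rewrite (permPl (perm2 X s1 s2)) perm_cons => /perm_mem ->; rewrite inE eqxx.
have far W : W \in [:: H & pre ++ mid ++ rest] -> sep d W X && sep d W Y.
  by move=> Wl; rewrite (allP aX' _ Wl) (allP aY _ Wl).
move: Ys; rewrite mem_cat => /orP[] Ys.
  case/splitPr: Ys ps2 c => t1 t2; rewrite -catA /= => ps2 c.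
  have ps3 : perm_eq (t1 ++ t2 ++ s2) (pre ++ mid ++ rest).
    move: ps2; rewrite (permPl (perm3 Y X t1 t2 s2)) (perm_catCA [:: Y] [:: X]) /=.
    by rewrite !perm_cons.
  have sub W : W \in t1 ++ t2 -> W \in [:: H & pre ++ mid ++ rest].
    by move=> Wt; rewrite inE -(perm_mem ps3) catA mem_cat Wt !orbT.
  have [|n' le' c'] := @chain_merge r d H t1 Y t2 X s2 Z n _ subY subX c.
    rewrite /= (allP aX' H (mem_head _ _)); apply/allP => W; rewrite mem_cat inE orbCA -mem_cat.
    by case/predU1P=> [->|/sub/far/andP[]//]; rewrite sep_sym.
  exists (t1 ++ Z :: t2 ++ s2), n'; split=> //.
  by rewrite (permPl (perm2 _ _ _)) (permPr (perm2 _ _ _)) perm_cons.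
case/splitPr: Ys ps2 c => t1 t2 ps2 c.
have ps3 : perm_eq (s1 ++ t1 ++ t2) (pre ++ mid ++ rest).
  by move: ps2; rewrite (permPl (perm3 X Y s1 t1 t2)) !perm_cons.
have sub W : W \in s1 ++ t1 -> W \in [:: H & pre ++ mid ++ rest].
  by move=> Wt; rewrite inE -(perm_mem ps3) catA mem_cat Wt !orbT.
have [|n' le' c'] := @chain_merge r d H s1 X t1 Y t2 Z n _ subX subY c.
  rewrite /= (allP aY H (mem_head _ _)); apply/allP => W; rewrite mem_cat inE orbCA -mem_cat.
  by case/predU1P=> [->|/sub/far/andP[]//].
exists (s1 ++ Z :: t1 ++ t2), n'; split=> //.
by rewrite (permPl (perm2 _ _ _)) (permPr (perm2 _ _ _)) perm_cons.
Qed.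

End MergeSets.

(** * Effect of splits and merges on the pieces *)

Section Effects.
Variable r : nat.
Local Notation L := (letter r).
Local Notation tok := (tok r).
Local Notation vertex := (vertex r).
Local Notation edge := (edge r).
Local Notation piece := (piece r).
Local Open Scope ring_scope.
Implicit Types (g : tok) (a b c s t x : seq tok) (p q : vertex).
Implicit Types (pc : piece) (l pre mid rest : seq piece) (P : seq L).

(** When all other pieces are closed, the root must carry the displacement of the group element. *)
Definition root_disp l : vertex := td (head (0, [::]) l).2.

Lemma all_edges_cat l1 l2 : all_edges (l1 ++ l2) = all_edges l1 ++ all_edges l2.
Proof. by rewrite /all_edges map_cat flatten_cat. Qed.

Lemma all_edges_cons pc l : all_edges (pc :: l) = pedges pc ++ all_edges l.
Proof. by []. Qed.

Lemma all_edges_block root q x : all_edges (blockp root q x) = edges q (lt x).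
Proof. by rewrite /blockp; case: root; case: x => //= g x; rewrite /all_edges /= cats0. Qed.

Lemma all_edges_addp q x l : all_edges (addp q x l) = edges q (lt x) ++ all_edges l.
Proof. by rewrite /addp; case: x. Qed.

Lemma edges_lt_cat q x y : edges q (lt (x ++ y)) = edges q (lt x) ++ edges (q + td x) (lt y).
Proof. by rewrite /lt map_cat edges_cat. Qed.

Lemma edges_lt_cons q g x : edges q (lt (g :: x)) = (q, g.1) :: edges (q + dl g.1) (lt x).
Proof. by []. Qed.

Section Split.
Variables (pre rest : seq piece) (q : vertex) (a b c : seq tok) (e e' : tok).
Hypotheses (ee' : e'.1 = linv e.1) (tb : td b = 0).
Let l := pre ++ (q, a ++ e :: b ++ e' :: c) :: rest.
Let l' := pre ++ blockp (nilp pre) q (a ++ c) ++ addp (q + td a + dl e.1) b rest.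

Let tdE : td (a ++ e :: b ++ e' :: c) = td (a ++ c).
Proof.
rewrite !(td_cat, td_cons) tb ee' dl_linv.
by move: (td a) (td c) (dl _) => ? ? ?; vertex_eq.
Qed.

Lemma split_edges f : count_mem f (all_edges l) =
  (count_mem f (all_edges l') + count_mem f [:: ((q + td a)%R, e.1); ebar ((q + td a)%R, e.1)])%N.
Proof.
rewrite /l /l' !all_edges_cat all_edges_block all_edges_addp all_edges_cons.
rewrite /pedges [(_, _).1]/= [(_, _).2]/= !(edges_lt_cat, edges_lt_cons) tb addr0 ee' dl_linv addrK.
rewrite /ebar [(_, _).1]/= [(_, _).2]/=; move: (edges q _) (edges _ (lt b)) (edges _ (lt c)) => E1 E2 E3.
rewrite -[_ :: E3]cat1s -[_ :: _ ++ _]cat1s -[[:: _; _]]cat1s !count_cat.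
by move: (count _ _) (count _ _) (count _ _) (count _ _) (count _ _) (count _ _) (count _ _) => * ; lia.
Qed.

Lemma split_flow f : flow (all_edges l') f = flow (all_edges l) f.
Proof.
have := flow_pair (q + td a, e.1) f; rewrite /flow !split_edges.
move: (count_mem f [:: _; _]) (count_mem (ebar f) [:: _; _]) => i j.
by move: (count_mem f _) (count_mem (ebar f) _) => m n; lia.
Qed.

Lemma split_size_edges : (size (all_edges l') + 2 = size (all_edges l))%N.
Proof.
rewrite /l /l' !all_edges_cat all_edges_block all_edges_addp all_edges_cons.
rewrite /pedges [(_, _).1]/= [(_, _).2]/= !size_cat !size_edges /lt !size_map !size_cat /= size_cat /=.
lia.
Qed.

Lemma split_size : (size l' <= (size l).+1)%N.
Proof.
rewrite /l /l' !size_cat /= /blockp /addp.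
by case: (_ && _); case: (nilp b) => /=; lia.
Qed.

Lemma split_closed : all (@closed r) (behead l) -> all (@closed r) (behead l').
Proof.
have h root : all (@closed r) rest -> closed (q, a ++ c) ->
    all (@closed r) (blockp root q (a ++ c) ++ addp (q + td a + dl e.1) b rest).
  move=> cr cac; rewrite all_cat; apply/andP; split.
    by rewrite /blockp; case: ifP => //= _; rewrite cac.
  by rewrite /addp; case: ifP => //= _; rewrite cr /closed /= tb eqxx.
have cE : closed (q, a ++ e :: b ++ e' :: c) = closed (q, a ++ c) by rewrite /closed /= tdE.
rewrite /l /l'; case: pre => [|pc0 pre'] /=.
  by rewrite /addp; case: ifP => //= _ ->; rewrite /closed /= tb eqxx.
by rewrite !all_cat /= cE => /and3P[-> cac cr]; rewrite -all_cat h.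
Qed.

Lemma split_root : root_disp l' = root_disp l.
Proof. by rewrite /l /l' /root_disp; case: pre => [|pc0 pre'] //=; rewrite tdE. Qed.

Lemma split_black : all (@all_black r) l -> all (@all_black r) l'.
Proof.
rewrite /l /l' !all_cat /= => /and3P[-> hb hr]; move: hb.
rewrite {1}/all_black /= all_cat /= all_cat /= => /and5P[ba _ bb _ bc].
apply/andP; split; first by rewrite /blockp; case: ifP => //= _; rewrite /all_black /= all_cat ba bc.
by rewrite /addp; case: ifP => //= _; rewrite /all_black /= bb.
Qed.

End Split.

Section Merge.
Variables (pre mid rest : seq piece) (q q2 : vertex) (a b s t : seq tok) (P : seq L).
Hypothesis meet : q + td a + disp P = q2 + td s.
Let c := a ++ map (@grey r) P ++ t ++ s ++ map (@grey r) (winv P) ++ b.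
Let l := pre ++ (q, a ++ b) :: mid ++ (q2, s ++ t) :: rest.
Let l' := pre ++ (q, c) :: mid ++ rest.
Hypothesis cl : all (@closed r) (behead l).

(** The second of two merged pieces is never the root, hence is closed. *)
Lemma merge_loop : td (s ++ t) = 0.
Proof.
apply/eqP; apply: (allP cl (q2, s ++ t)); rewrite /l.
by case: (pre) => [|pc0 pre'] /=; rewrite !(mem_cat, inE) eqxx ?orbT.
Qed.

Let tst : td s + td t = 0.
Proof. by rewrite -td_cat merge_loop. Qed.

Let tdE : td c = td (a ++ b).
Proof.
rewrite /c !td_cat !td_grey disp_winv; move: tst.
by move: (td s) (td t) (td a) (td b) (disp P) => ? ? ? ? ? /addr0_eq <-; vertex_eq.
Qed.

Let at_t : q + td a + disp P + td t = q2.
Proof. by rewrite meet -addrA tst addr0. Qed.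

Lemma merge_flow f : flow (all_edges l') f = flow (all_edges l) f.
Proof.
rewrite /l /l' !all_edges_cat !all_edges_cons !all_edges_cat all_edges_cons.
rewrite /pedges /c [(_, _).1]/= [(_, _).2]/= !edges_lt_cat !td_grey disp_winv.
rewrite at_t -!meet.
have ltg w : lt (map (@grey r) w) = w by rewrite /lt -map_comp map_id_in.
rewrite !ltg addrK; have := flow_winv (q + td a) P f; rewrite !flow_cat => ->.
by do !move: (flow _ _) => ?; lia.
Qed.

Lemma merge_size_edges : (size (all_edges l') = size (all_edges l) + 2 * size P)%N.
Proof.
rewrite /l /l' !all_edges_cat !all_edges_cons !all_edges_cat all_edges_cons.
rewrite !size_cat /pedges !size_edges /lt !size_map /c !size_cat !size_map size_winv; lia.
Qed.

Lemma merge_size : ((size l').+1 = size l)%N.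
Proof. by rewrite /l /l' !size_cat /= !size_cat /=; lia. Qed.

Lemma merge_closed : all (@closed r) (behead l').
Proof.
have cE : closed (q, c) = closed (q, a ++ b) by rewrite /closed /= tdE.
move: cl; rewrite /l /l'; case: pre => [|pc0 pre'] /=; rewrite !all_cat /=.
  by case/and3P=> -> _ ->.
by rewrite cE !all_cat /= => /and5P[-> -> -> _ ->].
Qed.

Lemma merge_root : root_disp l' = root_disp l.
Proof. by rewrite /l /l' /root_disp; case: pre => [|pc0 pre'] //=; rewrite tdE. Qed.

Lemma merge_black : P = [::] -> all (@all_black r) l -> all (@all_black r) l'.
Proof.
move=> P0; rewrite /l /l' /c P0 !all_cat /= !all_cat /= /all_black /= !all_cat.
by case/and5P=> -> /andP[-> ->] -> /andP[-> ->] ->.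
Qed.

(** Grey letters contribute no vertex, and rotating the loop [s t] does not change its vertices. *)
Lemma merge_vsets : exists preL X midL Y restL Z, [/\ Z =i X ++ Y,
  vsets l = preL ++ X :: midL ++ Y :: restL & vsets l' = preL ++ Z :: midL ++ restL].
Proof.
have bvE : bv q c =i bv q (a ++ b) ++ bv q2 (s ++ t).
  move=> u; rewrite /c !bv_cat !bv_grey !td_grey disp_winv /= at_t meet.
  have -> : q2 + td s - disp P = q + td a by rewrite -meet addrK.
  by rewrite !mem_cat; do 4!case: (u \in _).
rewrite /l /l' /vsets; case: (pre) => [|pc0 pre'] /=.
  exists [::], (0 :: bv q (a ++ b)), (map (@vs r) mid), (bv q2 (s ++ t)), (map (@vs r) rest),
    (0 :: bv q c); rewrite !map_cat; split=> // u.
  by rewrite /= !inE bvE.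
exists ((0 :: vs pc0) :: map (@vs r) pre'), (bv q (a ++ b)), (map (@vs r) mid),
  (bv q2 (s ++ t)), (map (@vs r) rest), (bv q c).
by rewrite !map_cat /= !map_cat.
Qed.

End Merge.
End Effects.

(** * Correctness and running time *)

Section Correctness.
Variables (r : nat) (w : seq (letter r)).
Local Notation L := (letter r).
Local Notation tok := (tok r).
Implicit Types (A B C D K S : seq tok) (v : seq L).

Let n := size w.
(** Initial value of the word length plus [2 * n + 2] times the number of paid letters and pieces.
    At distance 0 a split trades two paid letters for at most one piece and a merge removes a piece,
    while the word grows by at most [2 * n]. *)
Definition size_bound := n + (2 * n + 2) * n.+1.
Local Notation blk S := (size (all_edges (ap S))).
Local Notation npc S := (size (ap S)).

Definition same_flow v := forall e, flow (edges 0%R v) e = flow (edges 0%R w) e.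

Definition shape S :=
  [/\ all (@closed r) (behead (ap S)), root_disp (ap S) = disp w &
      forall e, flow (all_edges (ap S)) e = flow (edges 0%R w) e].

(* What is already in the pieces, plus twice the cost of joining them along any
   competing word [v], is at most twice the length of [v]. *)
Definition budget S := forall v, same_flow v -> exists s m,
  [/\ perm_eq s (behead (vsets (ap S))), chain (head [::] (vsets (ap S))) s m &
      blk S + 2 * m <= 2 * size v].

(** At distance 0 opposite edges may still be present and no budget is available yet. Later the size
    potential counts pieces only, because merging buys new letters. *)
Definition phase d S :=
  if d is 0 then [/\ all (@all_black r) (ap S), blk S <= n &
    size S + (2 * n + 2) * (blk S + npc S) <= size_bound]
  else [/\ pairwise (sep d) (vsets (ap S)), budget S &
    size S + (2 * n + 2) * npc S <= size_bound].

(** [next_cut] enumerates the pairs of cuts lexicographically by [(size A, size B)]; all earlier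
    pairs have failed. *)
Definition tried C A B d := forall A' B' C', rev A' ++ rev B' ++ C' = rev A ++ rev B ++ C ->
  (size A' < size A) || ((size A' == size A) && (size B' < size B)) -> ~~ applies d A' B' C'.

Definition inv (s : state r) : Prop :=
  let: (C, A, B, D, K) := s in let S := rev A ++ rev B ++ C in
  [/\ size D + size K = n, shape S, phase (size D) S & tried C A B (size D)].

Definition final (s : state r) : Prop :=
  let: (C, _, _, _, _) := s in
  [/\ shape C, npc C = 1 & forall v, same_flow v -> blk C <= 2 * size v].

(** A lexicographic measure written in base [size_bound.+2]. Paid letters count only at distance 0,
    where a split gains a piece but loses two of them; afterwards merging would increase them. *)
Definition progress (s : state r) : nat :=
  let: (C, A, B, D, K) := s in let S := rev A ++ rev B ++ C in
  (size K + npc S + (if nilp D then blk S else 0)) * size_bound.+2 ^ 2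
  + (size B + size C) * size_bound.+2 + size C.

Variant step_spec C A B D K : bool * state r -> Prop :=
| StepFail of ~~ applies (size D) A B C : step_spec C A B D K (next_cut C A B D K)
| StepSplit e A1 C1 of D = [::] & A = e :: A1 & C = black (linv e.1) :: C1 & bk e
    & all (@nw r) B & td B = 0%R :
    step_spec C A B D K (true, (split_out C1 A1 B e, [::], [::], D, K))
| StepMerge of ~~ all (@nw r) B & mergeable A B & size (abn (lt B)) <= size D :
    step_spec C A B D K (true, (merge_out C A B (abn (lt B)), [::], [::], D, K)).

Lemma stepP C A B D K : step_spec C A B D K (step C A B D K).
Proof.
rewrite /step; case: leqP => lePD; last first.
  by apply: StepFail; rewrite /applies leqNgt lePD.
case: ifPn => nB; last first.
  case: ifPn => mAB; first exact: StepMerge.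
  by apply: StepFail; rewrite /applies (negPf nB) negb_and mAB orbT.
case EA: A => [|e A1]; first by apply: StepFail; rewrite /applies nB andbF.
case: ifPn => [/and3P[D0 be /eqP hC]|no]; last first.
  by apply: StepFail; rewrite /applies nB negb_and no orbT.
have D0' : D = [::] by apply/nilP.
case: C hC => // g C1 [->]; apply: StepSplit => //.
rewrite /td -disp_abn; move: lePD; rewrite D0' leqn0 => /nilP ->.
exact: disp_nil.
Qed.

Lemma size_split_out C A B e :
  size (split_out C A B e) = size A + size B + size C + 2 + 2 * size (pref (@nw r) C).
Proof.
have e1 : size (pref (@nw r) C) + size (suff (@nw r) C) = size C by rewrite -size_cat pref_suff.
have sc (g : tok) s : size (g :: s) = (size s).+1 by [].
rewrite /split_out !(size_cat, sc, size_rev, size_map, size_winv) -e1.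
by move: (size A) (size B) (size (pref _ _)) (size (suff _ _)) => *; lia.
Qed.

Lemma size_merge_out C A B P :
  size (merge_out C A B P) = size A + size B + size C + 2 * size P.
Proof.
have e1 : size (pref (@nw r) C) + size (suff (@nw r) C) = size C by rewrite -size_cat pref_suff.
have e2 : size (pref (@nw r) B) + size (suff (@nw r) B) = size B by rewrite -size_cat pref_suff.
rewrite /merge_out !(size_cat, size_rev, size_map, size_winv) -e1 -e2.
move: (size A) (size P) (size (pref _ B)) (size (suff _ B)) => *.
by move: (size (pref _ C)) (size (suff _ C)) => *; lia.
Qed.

Lemma phase_size d S : phase d S -> size S <= size_bound.
Proof. by case: d => [|d] /= [_ _]; lia. Qed.

Lemma tried_nil C d : tried C [::] [::] d.
Proof. by move=> A' B' C' _; rewrite !ltn0 andbF. Qed.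

Lemma cut_inj A A' X X' : size A' = size A -> rev A' ++ X' = rev A ++ X -> A' = A /\ X' = X.
Proof.
move=> sA /eqP; rewrite eqseq_cat ?size_rev // => /andP[/eqP eA /eqP ->]; split=> //.
by rewrite -[A']revK eA revK.
Qed.

Lemma exhausted A d : tried [::] A [::] d -> ~~ applies d A [::] [::] -> irreducible d (rev A).
Proof.
move=> tr na A' B' C' eS; have := congr1 size eS; rewrite !size_cat !size_rev => sS.
have eS' : rev A' ++ rev B' ++ C' = rev A ++ [::] by rewrite eS cats0.
have [lt|ge] := ltnP (size A') (size A); first by apply: (tr A' B' C') => //; rewrite lt.
have sA : size A' = size A by lia.
have [-> X0] := cut_inj sA eS'.
have B0 : B' = [::] by apply/nilP; rewrite /nilp; lia.
by move: X0; rewrite B0 /= => ->.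
Qed.

(** Only leaving distance 0 needs an argument: [initial_chain] gives [blk S + m <= size v], which
    implies the budget. At later distances the budget is inherited. *)
Lemma phase_next d S : shape S -> phase d S -> irreducible d S -> phase d.+1 S.
Proof.
case=> cS rS fS pS irr; split; first exact: irreducible_sep.
  case: d pS irr => [[bS _ _] irr|d [] //] v fv.
  have [|s [m [p1 c1 l1]]] := initial_chain (v := v) irr bS cS; first by move=> e; rewrite fS fv.
  by exists s, m; split=> //; lia.
by case: d pS {irr} => [[_ _]|d []//]; rewrite mulnDr; lia.
Qed.

Lemma inv_fits s : inv s -> fits size_bound s.
Proof.
case: s => [[[[C A] B] D] K] [sDK _ /phase_size sS _].
move: sS; rewrite /fits /= !size_cat !size_rev andbT => sS.
have Dn : size D <= size_bound by rewrite /size_bound -sDK; lia.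
by apply/and4P; split; move: sS Dn; slia.
Qed.

Lemma progress_drop a a' x y z N : a' < a -> x <= N -> y <= N ->
  a' * N.+2 ^ 2 + x * N.+2 + y < a * N.+2 ^ 2 + z.
Proof.
move=> la lx ly; apply: (@leq_trans (a'.+1 * N.+2 ^ 2)).
  by rewrite mulSn -mulnn; nia.
by apply: leq_trans (leq_addr z _); rewrite leq_mul2r la orbT.
Qed.

Lemma split_arith m s c E E' l l' N : E' + 2 = E -> l' <= l.+1 -> c <= m ->
  s + (2 * m + 2) * (E + l) <= N -> s + 2 * c + (2 * m + 2) * (E' + l') <= N.
Proof. by move=> <- ll cm; apply: leq_trans; nia. Qed.

Lemma merge_arith m s p E E' l l' N : l'.+1 = l -> p <= m -> E' <= E ->
  s + (2 * m + 2) * (E + l) <= N -> s + 2 * p + (2 * m + 2) * (E' + l') <= N.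
Proof. by move=> <- pm EE; apply: leq_trans; nia. Qed.

Lemma inv_restart C D K : size D + size K = n -> shape C -> phase (size D) C ->
  inv (C, [::], [::], D, K).
Proof. by move=> sDK sC pC; split=> //; apply: tried_nil. Qed.

Lemma progress_restart C D K N : size C <= size_bound ->
  size K + npc C + (if nilp D then blk C else 0) < N ->
  forall z, progress (C, [::], [::], D, K) < N * size_bound.+2 ^ 2 + z.
Proof. by move=> sC lN z; rewrite /progress [rev [::] ++ _]/= add0n; apply: progress_drop. Qed.

Lemma inv_step s : inv s -> (step_state s).1 ->
  inv (step_state s).2 /\ progress (step_state s).2 < progress s.
Proof.
case: s => [[[[C A] B] D] K] [sDK shS phS tr].
rewrite /step_state; case: stepP => [na|e A1 C1 D0 EA EC be nB tB|nB mAB leP].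
- have sN := phase_size phS.
  rewrite /next_cut; case: C phS shS tr na sN => [|g C] phS shS tr na sN; last first.
    move=> _; split; last by rewrite /progress /= rev_cons cat_rcons; nia.
    rewrite /inv /= rev_cons cat_rcons; split=> // A' B' C'; rewrite rev_cons cat_rcons => eS.
    have [lt _|ge] := ltnP (size A') (size A); first by apply: (tr _ _ _ eS); rewrite lt.
    (* The only pair added to the tried ones is the current one, where [applies] has just failed. *)
    case/andP=> /eqP sA; rewrite ltnS leq_eqVlt => /orP[/eqP sB|ltB].
      have [-> eX] := cut_inj sA eS.
      by have [-> ->] := cut_inj sB eX.
    by apply: (tr _ _ _ eS); rewrite sA eqxx ltB orbT.
  case EB: (rev B) => [|g C'].
    have B0 : B = [::] by rewrite -[B]revK EB.
    subst B; case: K sDK => [|k K] // sDK _.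
    have irr := exhausted tr na; rewrite !cats0 in phS shS.
    split; last first.
      rewrite /progress !cats0 /= -[X in _ < X]addnA.
      have sA : size (rev A ++ [::]) <= size_bound by [].
      rewrite cats0 in sA; apply: progress_drop; rewrite ?add0n //.
      by case: (nilp D); slia.
    change (inv (rev A, [::], [::], k :: D, K)); split.
    + by move: sDK => /=; lia.
    + exact: shS.
    + exact: phase_next.
    exact: tried_nil.
  move=> _; have eB : B = rcons (rev C') g by rewrite -[B]revK EB rev_cons.
  have eS : rev (g :: A) ++ rev [::] ++ C' = rev A ++ rev B ++ [::].
    by rewrite rev_cons cat_rcons EB cats0.
  split; last first.
    change (progress (C', g :: A, [::], D, K) < progress ([::], A, B, D, K)).
    have sB : size B = (size C').+1 by rewrite eB size_rcons size_rev.
    have sC : size C' <= size_bound.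
      by apply: leq_trans sN; rewrite cats0 size_cat !size_rev sB; lia.
    rewrite /progress eS sB /= addn0.
    rewrite add0n addn0 mulSn -!addnA ltn_add2l addnC ltn_add2r.
    exact: leq_trans sC _.
  change (inv (C', g :: A, [::], D, K)).
  rewrite /inv eS; split=> // A' B' C''; rewrite eS => eS'.
  rewrite ltn0 andbF orbF ltnS leq_eqVlt => /orP[/eqP sA|lt]; last by apply: (tr _ _ _ eS'); rewrite lt.
  (* With [C] empty the second cut is at the end of the word, so no [B'] is longer than [B]. *)
  have [eA eX] := cut_inj sA eS'.
  have := congr1 size eX; rewrite !size_cat !size_rev /= addn0 => sX.
  have [ltB|geB] := ltnP (size B') (size B); first by apply: (tr _ _ _ eS'); rewrite sA eqxx ltB orbT.
  have sB : size B' = size B by apply/eqP; rewrite eqn_leq geB andbT -sX leq_addr.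
  by have [-> ->] := cut_inj sB eX; rewrite eA.
- move=> _; subst D A C; rewrite rev_cons cat_rcons in shS phS *.
  have [pre [q [a [c [rest [eS eS' cE _]]]]]] :=
    @split_pieces r A1 B C1 e (black (linv e.1)) nB (bk_nw be) isT erefl tB.
  have tB' : td (rev B) = 0%R by rewrite td_rev.
  have ee' : (black (linv e.1)).1 = linv e.1 by [].
  move: shS phS; set S := rev A1 ++ _ in eS *.
  have szS : size S = size A1 + size B + size C1 + 2.
    by rewrite /S size_cat /= size_cat /= !size_rev; slia.
  case=> cS rS fS [bS lS sS]; rewrite eS in cS rS bS lS sS.
  have h1 := split_size_edges pre rest q a (rev B) c e (black (linv e.1)).
  have h2 := split_size pre rest q a (rev B) c e (black (linv e.1)).
  (* [c] is part of a piece, and at distance 0 the pieces have at most [n] letters altogether. *)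
  have h3 : size c <= n.
    apply: leq_trans lS; rewrite all_edges_cat all_edges_cons !size_cat.
    by rewrite /pedges size_edges /lt size_map !size_cat /= size_cat /=; slia.
  have sz := size_split_out C1 A1 B e; rewrite -cE in sz.
  have phS' : phase 0 (split_out C1 A1 B e).
    split; rewrite ?eS'.
    + exact: (@split_black r pre rest q a (rev B) c e (black (linv e.1)) bS).
    + by apply: leq_trans lS; rewrite -h1 leq_addr.
    by rewrite sz -szS; apply: split_arith h1 h2 h3 sS.
  split.
    apply: inv_restart => //; split; rewrite eS'.
    + exact: split_closed cS.
    + by rewrite (split_root pre rest q a c ee' tB').
    + by move=> f; rewrite (split_flow pre rest q a c ee' tB') -eS fS.
  rewrite [X in _ < X]/progress -addnA rev_cons cat_rcons -/S.
  apply: progress_restart; first exact: phase_size phS'.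
  rewrite eS eS' -h1 /=; move: h2; clear.
  by move: (size (all_edges _)) (size (_ ++ _)) (size (_ ++ _)) => *; lia.
- move=> _; have sN := phase_size phS.
  set S := rev A ++ rev B ++ C in shS phS sN.
  set P := abn (lt B) in leP *.
  have dP : disp P = td B by apply: disp_abn.
  have [pre [q [a [b [mid [q2 [s [t [rest [eS eS' meet]]]]]]]]]] := merge_pieces C nB mAB dP.
  rewrite -/S in eS; case: shS; rewrite eS => cS rS fS.
  have {}eS' := eS' (merge_loop cS).
  have m1 := merge_size_edges P cS; have m2 := merge_size P cS.
  have sz : size (merge_out C A B P) = size S + 2 * size P.
    by rewrite size_merge_out /S !size_cat !size_rev addnA.
  have Pn : size P <= n by rewrite -sDK; apply: leq_trans leP (leq_addr _ _).
  have shS' : shape (merge_out C A B P).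
    split; rewrite eS'.
    + exact: (merge_closed P cS).
    + by rewrite (merge_root P cS).
    + by move=> f; rewrite (merge_flow meet cS).
  have phS' : phase (size D) (merge_out C A B P).
    move: leP phS; case: (size D) => [|d].
      rewrite leqn0 => /nilP P0 [bS lS sS]; rewrite eS in bS lS sS.
      have sP0 : size P = 0 by rewrite P0.
      rewrite sP0 muln0 addn0 in m1.
      split; rewrite eS'; first exact: merge_black P0 bS.
        by rewrite m1.
      by rewrite sz; apply: merge_arith m2 Pn _ sS; rewrite m1.
    move=> leP [pw bud sS]; have [preL [X [mL [Y [rL [Z [eZ vl vl']]]]]]] := merge_vsets meet cS.
    split.
    + by rewrite eS' vl'; apply: merge_pairwise eZ _; rewrite -vl -eS.
    + move=> v /bud[x [m [px cx lx]]].
      move: pw px cx; rewrite eS vl => pw px cx.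
      (* The joining cost falls by at least the current distance, which pays for the [2 * size P]
         grey letters. *)
      have [x' [m' [px' lm cx']]] := merge_chain eZ pw px cx.
      exists x', m'; rewrite eS' vl'; split=> //; rewrite m1 -eS.
      by move: lm leP lx; clear; move: (size (all_edges _)) (size P) (size v) => *; lia.
    rewrite sz eS'; apply: leq_trans sS; rewrite eS -m2.
    by move: Pn; clear; move: (size P) (size S) (size (_ ++ _)) => *; nia.
  split; first by apply: inv_restart.
  rewrite [X in _ < X]/progress -addnA -/S; apply: progress_restart; first exact: phase_size phS'.
  rewrite eS eS' -m2.
  case D0: (nilp D); last by rewrite addn0 addnS ltnS leq_addr.
  have P0 : size P = 0 by apply/eqP; rewrite -leqn0; apply: leq_trans leP _; rewrite leqn0.
  by rewrite m1 P0 muln0 addn0 addnS addSn.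
Qed.

Lemma inv_final s : inv s -> ~~ (step_state s).1 -> final (step_state s).2.
Proof.
case: s => [[[[C A] B] D] K] [sDK shS phS tr].
rewrite /step_state; case: stepP => [na|e A1 C1 _ _ _ _ _ _|_ _ _] //.
rewrite /next_cut; case: C shS phS tr na => [|g C] // shS phS tr na.
case EB: (rev B) => [|g C'] //; have B0 : B = [::] by rewrite -[B]revK EB.
subst B; case: K sDK => [|k K] // sDK _.
have irr := exhausted tr na; rewrite !cats0 in phS shS.
have [pw bud _] := phase_next shS phS irr.
have [cS rS fS] := shS.
suff l0 : (parse 0%R (rev A)).2 = [::].
  split=> //; first by rewrite /ap l0.
  move=> v /bud[s [m [_ _ le_m]]]; apply: leq_trans le_m; exact: leq_addr.
(* With [w] as competitor the joining cost [m] is at most [n], whereas a second piece would lie at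
   distance at least [n + 1] from the root. *)
have [s [m [ps cs lm]]] := bud w (fun _ => erefl).
have mn : m <= n by move: lm; rewrite -/n; lia.
case El: (parse 0%R (rev A)).2 => [//|pc l]; exfalso.
move: pw ps cs; rewrite /vsets {1 3}/ap => /andP[far _] ps.
case: s ps => [|Y s] ps; first by have := perm_size ps; rewrite [size (behead _)]/= size_map El.
case=> x [y [q [xU yY le_q _]]].
have YE : Y \in map (@vs r) (parse 0%R (rev A)).2 by rewrite -(perm_mem ps) mem_head.
have /sepP/(_ _ _ xU yY) := allP far _ YE.
by move: sDK => /=; lia.
Qed.

End Correctness.

(** * Polynomial bounds, initial state and conclusion *)

Lemma size_reduce r (v : seq (letter r)) : size (reduce v) <= size v.
Proof.
elim: v => //= x v; case: (reduce v) => [|y s] //=.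
by case: ifP => _ h; rewrite ?(leq_trans _ h) // (leq_trans (leqnSn _)) // ltnW.
Qed.

Definition polynomial (f : nat -> nat) := exists c k, forall n, f n <= c * n.+1 ^ k.

Lemma polynomial_const a : polynomial (fun=> a).
Proof. by exists a, 0 => n; rewrite muln1. Qed.

Lemma polynomial_id : polynomial id.
Proof. by exists 1, 1 => n; rewrite mul1n. Qed.

Lemma polynomial_add f g : polynomial f -> polynomial g -> polynomial (fun n => f n + g n).
Proof.
case=> c [k hf] [d [l hg]]; exists (c + d), (k + l) => n; rewrite mulnDl; apply: leq_add.
  by apply: leq_trans (hf n) _; rewrite leq_mul2l leq_pexp2l ?leq_addr ?orbT.
by apply: leq_trans (hg n) _; rewrite leq_mul2l leq_pexp2l ?leq_addl ?orbT.
Qed.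

Lemma polynomial_mul f g : polynomial f -> polynomial g -> polynomial (fun n => f n * g n).
Proof.
case=> c [k hf] [d [l hg]]; exists (c * d), (k + l) => n.
by rewrite expnD mulnACA leq_mul.
Qed.

Lemma polynomial_succ f : polynomial f -> polynomial (fun n => (f n).+1).
Proof.
move=> pf; have [c [k h]] := polynomial_add pf (polynomial_const 1).
by exists c, k => n; rewrite -addn1.
Qed.

Definition untok r (g : tok r) : option (letter r) := if g.2 is None then None else Some g.1.

Lemma decode_untok r (S : seq (tok r)) : decode (@untok r) S = lt (pref (@nw r) S).
Proof.
elim: S => //= -[x [b|]] S IH; rewrite pref_cons /untok /nw //=.
by rewrite IH.
Qed.

Lemma parse_black r (w : seq (letter r)) : parse 0%R (map (@black r) w) = (map (@black r) w, [::]).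
Proof.
have := @parse_nw r 0%R (map (@black r) w) [::]; rewrite cats0 /= ?cats0; apply.
by rewrite all_map; apply/allP.
Qed.

Lemma inv_start r (w : seq (letter r)) :
  inv w (map (@black r) w, [::], [::], [::], map (@black r) w).
Proof.
have ltb : lt (map (@black r) w) = w by rewrite /lt -map_comp map_id_in.
have E0 : all_edges (ap (map (@black r) w)) = edges 0%R w.
  by rewrite /ap parse_black /all_edges /= cats0 /pedges /= ltb.
apply: inv_restart; rewrite ?size_map //.
  by split; rewrite ?E0 // /ap parse_black //= /root_disp /= /td ltb.
split; rewrite ?E0 ?size_edges //.
  by rewrite /ap parse_black /= /all_black /= all_map andbT; apply/allP.
by rewrite size_map /ap parse_black /= addn1.
Qed.

Lemma progress_start r (w : seq (letter r)) (S := map (@black r) w) :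
  progress w (S, [::], [::], [::], S) =
  (size w + 1 + size w) * (size_bound w).+2 ^ 2 + size w * (size_bound w).+2 + size w.
Proof.
have e1 : size (ap S) = 1 by rewrite /ap parse_black.
have e2 : size (all_edges (ap S)) = size w.
  by rewrite /ap parse_black /all_edges /= cats0 /pedges size_edges /lt !size_map.
have e3 : size S = size w by rewrite size_map.
have -> : progress w (S, [::], [::], [::], S) =
    (size S + size (ap S) + size (all_edges (ap S))) * (size_bound w).+2 ^ 2 +
    (0 + size S) * (size_bound w).+2 + size S by [].
by rewrite e1 e2 e3 add0n.
Qed.

Theorem theorem3p3 :
  forall r : nat,
  exists (M : TM (letter r)) (c k : nat),
  forall w : seq (letter r),
  exists t : nat,
    [/\ t <= c * (size w).+1 ^ k,
        tm_halted M (tm_run M t (tm_init M w)) &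
        let w' := tm_output M (tm_run M t (tm_init M w)) in
        mu_eq w' w /\
        (forall n, geodesic_length w n -> rlen w' <= 2 * n)].
Proof.
move=> r.
have [M hM] := @prog_TM (letter r) (tok r) (@black r) (@untok r) (fun=> erefl) 7 (Main r).
pose phi n := n + (2 * n + 2) * n.+1.
pose steps n := ((n + 1 + n) * ((phi n).+2 * (phi n).+2) + n * (phi n).+2 + n).+2 *
  (42 * ((phi n).+1 * ((phi n).+1 * (2 * gcard (tok r) + 10)))).
pose time n := 100 * ((n + 7 + steps n).+2 * (n + 7 + steps n).+2).
(* [time] is built from sums, products and successors only, so the closure lemmas apply to its
   syntax. *)
have [c [k hck]] : polynomial time.
  have pphi : polynomial phi.
    do ![apply: polynomial_add | apply: polynomial_mul | apply: polynomial_succ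
        | exact: polynomial_id | exact: polynomial_const].
  do ![apply: polynomial_add | apply: polynomial_mul | apply: polynomial_succ
      | exact: pphi | exact: polynomial_id | exact: polynomial_const].
exists M, c, k => w.
have sb : size (map (@black r) w) <= size_bound w by rewrite size_map leq_addr.
have [[[[[C A] B] D] K] fin [m le_m evm]] := runs_main sb (inv_start w) (@inv_fits r w) (@inv_step r w) (@inv_final r w).
have [t [le_t halt out]] := hM w _ _ _ _ evm.
exists t; split=> //.
  apply: leq_trans le_t _; apply: leq_trans (hck (size w)).
  rewrite leq_mul2l /= -mulnn; have: m <= steps (size w).
    by apply: leq_trans le_m _; rewrite progress_start -mulnn.
  by move=> ms; apply: leq_mul; rewrite !ltnS leq_add2l.
rewrite /= out decode_untok.
case: fin => [[cC rC fC] nC bC].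
(* The root is the only piece left, and it is exactly the nonwhite prefix that the machine
   outputs. *)
have pC : (parse 0%R C).2 = [::] by move: nC; rewrite /ap /=; case: (parse _ _).2.
have rootE : (parse 0%R C).1 = pref (@nw r) C by apply: parse_root.
have EC : all_edges (ap C) = edges 0%R (lt (pref (@nw r) C)).
  by rewrite /all_edges /ap pC /= cats0 /pedges /= rootE.
split.
  apply: flow_mu_eq; last by move=> e; rewrite -EC.
  by rewrite -rC /root_disp /ap /= rootE.
(* The budget is applied to the reduced form of [v], which has the same flow and length [rlen v]. *)
move=> n [[v [vw <-]] _]; rewrite /rlen; apply: leq_trans (size_reduce _) _.
rewrite -(size_edges 0%R) -EC; apply: bC => e.
by rewrite flow_reduce; apply: mu_eq_flow.
Qed.
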